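(* Let $\tau > 0$ and $\sigma > 0$. If $f\in B_\sigma$, then $$|f(x)| \le \left( \frac{\sigma}{\tau} + 1 \right) \| \sin (\tau t)\, f(t) \|_{C(\mathbb{R})}, \qquad x\in\mathbb{R}. \qquad ( * )$$ Moreover, for a function $f\in B_\sigma$ that is real-valued on $\mathbb{R}$ with $f\not\equiv 0$, equality holds in $( * )$ for some point $x = x_0 \in \mathbb{R}$ such that $\cos (\tau x_0) \ne 0$ if and only if $\sigma/\tau \in \mathbb{N}$ and $f(x) \equiv S \sin ((\sigma + \tau) x)/\sin (\tau x)$ for some real $S \ne 0$.
   Context: For $\gamma\ge 0$, $B_\gamma$ denotes the collection of entire functions of exponential type at most $\gamma$: an entire function $f:\mathbb{C}\to\mathbb{C}$ belongs to $B_\gamma$ if and only if for every $\varepsilon>0$ we have $\limsup_{|z|\to\infty}|f(z)|\exp(-(\gamma+\varepsilon)|z|)<\infty$. For a continuous function $g$ on $\mathbb{R}$, $\|g\|_{C(\mathbb{R})} = \|g(t)\|_{C(\mathbb{R})}= \sup_{t\in\mathbb{R}}|g(t)|$, which may be $+\infty$ (in which case $( * )$ holds trivially). $\mathbb{N}$ is the set of positive integers. The quotient $\sin((\sigma+\tau)x)/\sin(\tau x)$ is understood as extended continuously (holomorphically) at its removable singularities. *)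

(* Defs.v *)
From Stdlib Require Import Reals.
From Coquelicot Require Import Coquelicot.

Open Scope R_scope.

(* The derivative is the complex one: [C] is normed over itself here. *)
Definition entire (f : C -> C) : Prop :=
  forall z : C, ex_derive (K := C_AbsRing) (V := C_NormedModule) f z.

(* limsup of [h z] as |z| -> oo, i.e. inf over r of sup {h z : |z| >= r}. *)
Definition LimSup_Cmod_infty (h : C -> R) : Rbar :=
  Rbar_glb (fun s : Rbar =>
    exists r : R,
      s = Lub_Rbar (fun y : R => exists z : C, r <= Cmod z /\ y = h z)).

Definition B (gamma : R) (f : C -> C) : Prop :=
  entire f /\
  forall eps : R, 0 < eps ->
    Rbar_lt
      (LimSup_Cmod_infty
         (fun z => Cmod (f z) * exp (- ((gamma + eps) * Cmod z))))
      p_infty.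

(* The sup norm over the real line, possibly [p_infty]. *)
Definition sup_norm (g : R -> C) : Rbar :=
  Lub_Rbar (fun y : R => exists t : R, y = Cmod (g t)).

(* [Lim] is the limit over a punctured neighbourhood, so the value of [q] at [x]
   itself (e.g. a division by zero) is irrelevant. It is the continuous
   extension of [q] at [x] whenever [q] has a finite limit there. *)
Definition cont_ext (q : R -> R) (x : R) : R := real (Lim q x).

(* Main.v *)
Require Import Defs.
From Stdlib Require Import Reals ZArith Lra Lia List Classical ClassicalEpsilon.
From Coquelicot Require Import Coquelicot.
Open Scope R_scope.

(** Write [omega = sigma + tau] and let [M] be the supremum of
    [|sin (tau t) f t|] over the real line, assumed finite.

    Near a zero [a] of [sin (tau t)] put [G u = sin (tau u) * f (a + u)]. This
    entire function has exponential type [omega], is bounded by [M] on the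
    real line (shifting by [a] changes [sin (tau t)] by a sign only), and
    vanishes at [0]. By the Phragmen-Lindelof principle
    [|G z| <= M e^(omega |Im z|)] ([phragmen_lindelof]). For such a [G] the
    function [sin] is extremal: [|G u| <= M |sin (omega u)|] as long as
    [omega |u| < pi/2] ([sine_comparison]). Every real [x] is [a + u] with
    [tau |u| <= pi/2] for a suitable [a], and for such [u <> 0] the quantity
    [tau |sin (omega u)|], replaced by [tau] when [omega |u| >= pi/2], is less
    than [omega |sin (tau u)|]. Dividing by [|sin (tau u)|] gives
    [|f x| < (omega / tau) M] off the zeros of [sin (tau t)], when [M > 0]
    ([bound_off_sine_zeros]); at the zeros the bound follows by continuity.
    Hence equality forces [x0] to be such a zero, and then
    [|G' 0| = M omega]: in this case [G u = + or - M sin (omega u)]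
    ([sine_rigidity]). Taking [u = pi / tau], where [G] vanishes, shows that
    [omega / tau] is an integer. Conversely, if it is one and
    [f x = S sin (omega x) / sin (tau x)], then the product with [sin (tau x)] is
    [S sin (omega x)], of norm [|S|], and [f 0 = (omega / tau) S].

    Comparison and rigidity both come from one interpolation formula. For
    [omega = 1] it reads
      [G x / (x cos x) = - sum_p G(p) sin(p) / (p (x - p))],
    the sum being over the zeros [p] of [cos] taken symmetrically. When
    [|x| < pi/2] all weights [1 / (p (p - x))] are positive, and for [G = sin]
    every product [G(p) sin(p)] is [1], the largest value possible: this is the
    comparison. If [G' 0 = M] then, applying the formula to [M sin - G] and
    letting [x] tend to [0], a sum of nonnegative terms tends to [0], so
    [M sin - G] vanishes at all the [p], hence everywhere.

    The formula itself is proved without residues ([interpolation]): the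
    difference of [G z / (z cos z)] and a finite partial sum has only removable
    singularities in the square with vertices [N pi (+ or - 1 + or - i)] and is
    [O(1 / sqrt N)] on its boundary, so the maximum modulus principle bounds it
    inside.

    The maximum modulus principle is derived from Goursat's theorem for
    rectangles: it gives [|h p| <= K * max |h|] with an unspecified constant
    [K] depending on the rectangle and [p] only, and applying this to the
    powers of [h] removes [K]. Multiplying the powers by a fixed polynomial
    with double zeros at the removable singularities makes the product complex
    differentiable there, which takes the place of a theorem on removable
    singularities. *)

(** * Continuity and complex differentiability *)

Definition ccont (f : C -> C) (z : C) : Prop :=
  forall eps, 0 < eps -> exists delta, 0 < delta /\
    forall w, Cmod (w - z) < delta -> Cmod (f w - f z) < eps.

(** Caratheodory's form of differentiability: [phi z] is the derivative. With it
    the product and chain rules reduce to continuity of products and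
    compositions, and boundedness of difference quotients is boundedness of
    [phi]. *)
Definition cdiff (f : C -> C) (z : C) : Prop :=
  exists phi, ccont phi z /\ forall w, (f w = f z + phi w * (w - z))%C.

Lemma Cmod_sub_sym (z w : C) : Cmod (z - w) = Cmod (w - z).
Proof. rewrite <- Cmod_opp. f_equal. ring. Qed.

Lemma Cmod_triangle_sub (z w : C) : Cmod (z - w) <= Cmod z + Cmod w.
Proof.
  unfold Cminus. rewrite <- (Cmod_opp w). apply Cmod_triangle.
Qed.

Lemma Cmod_sub_ge (z w : C) : Cmod z - Cmod w <= Cmod (z - w).
Proof.
  assert (H := Cmod_triangle (z - w) w).
  replace (z - w + w)%C with z in H by ring. lra.
Qed.

Lemma Cmod_self_sub (z : C) : Cmod (z - z) = 0.
Proof. replace (z - z)%C with (RtoC 0) by ring. apply Cmod_0. Qed.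

Lemma Csub_neq_0 (w z : C) : w <> z -> (w - z <> 0)%C.
Proof.
  intros H E. apply H. replace w with (w - z + z)%C by ring. rewrite E. ring.
Qed.

Lemma ccont_bounded (f : C -> C) (z : C) :
  ccont f z -> exists delta, 0 < delta /\
    forall w, Cmod (w - z) < delta -> Cmod (f w) <= Cmod (f z) + 1.
Proof.
  intros Hf. destruct (Hf 1 Rlt_0_1) as [d [Hd H]].
  exists d; split; auto. intros w Hw. specialize (H w Hw).
  assert (G := Cmod_sub_ge (f w) (f z)). lra.
Qed.

Lemma ccont_const (c z : C) : ccont (fun _ => c) z.
Proof.
  intros eps He. exists 1; split; [lra|]. intros.
  rewrite Cmod_self_sub. lra.
Qed.

Lemma ccont_id (z : C) : ccont (fun w => w) z.
Proof. intros eps He. exists eps; split; auto. Qed.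

Lemma ccont_plus (f g : C -> C) (z : C) :
  ccont f z -> ccont g z -> ccont (fun w => (f w + g w)%C) z.
Proof.
  intros Hf Hg eps He.
  destruct (Hf (eps/2)) as [d1 [Hd1 H1]]; [lra|].
  destruct (Hg (eps/2)) as [d2 [Hd2 H2]]; [lra|].
  exists (Rmin d1 d2); split; [now apply Rmin_glb_lt|].
  intros w Hw.
  specialize (H1 w (Rlt_le_trans _ _ _ Hw (Rmin_l _ _))).
  specialize (H2 w (Rlt_le_trans _ _ _ Hw (Rmin_r _ _))).
  replace (f w + g w - (f z + g z))%C with ((f w - f z) + (g w - g z))%C by ring.
  eapply Rle_lt_trans; [apply Cmod_triangle|]. lra.
Qed.

Lemma ccont_mult (f g : C -> C) (z : C) :
  ccont f z -> ccont g z -> ccont (fun w => (f w * g w)%C) z.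
Proof.
  intros Hf Hg eps He.
  set (A := Cmod (g z) + 1). set (B0 := Cmod (f z) + 1).
  assert (HA : 0 < A) by (unfold A; assert (H := Cmod_ge_0 (g z)); lra).
  assert (HB : 0 < B0) by (unfold B0; assert (H := Cmod_ge_0 (f z)); lra).
  destruct (ccont_bounded g z Hg) as [d0 [Hd0 H0]].
  destruct (Hf (eps/(2*A))) as [d1 [Hd1 H1]]; [apply Rdiv_lt_0_compat; lra|].
  destruct (Hg (eps/(2*B0))) as [d2 [Hd2 H2]]; [apply Rdiv_lt_0_compat; lra|].
  exists (Rmin d0 (Rmin d1 d2)); split; [repeat apply Rmin_glb_lt; auto|].
  intros w Hw.
  assert (Hw0 := Rlt_le_trans _ _ _ Hw (Rmin_l _ _)).
  assert (Hw' := Rlt_le_trans _ _ _ Hw (Rmin_r _ _)).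
  specialize (H0 w Hw0).
  specialize (H1 w (Rlt_le_trans _ _ _ Hw' (Rmin_l _ _))).
  specialize (H2 w (Rlt_le_trans _ _ _ Hw' (Rmin_r _ _))).
  replace (f w * g w - f z * g z)%C with ((f w - f z) * g w + f z * (g w - g z))%C by ring.
  eapply Rle_lt_trans; [apply Cmod_triangle|]. rewrite !Cmod_mult.
  assert (T1 : Cmod (f w - f z) * Cmod (g w) <= eps/(2*A) * A).
  { apply Rmult_le_compat; try apply Cmod_ge_0; auto. lra. }
  assert (T2 : Cmod (f z) * Cmod (g w - g z) < B0 * (eps/(2*B0))).
  { apply Rle_lt_trans with (B0 * Cmod (g w - g z)).
    - apply Rmult_le_compat_r; [apply Cmod_ge_0|unfold B0; lra].
    - now apply Rmult_lt_compat_l. }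
  replace (eps/(2*A) * A) with (eps/2) in T1 by (field; lra).
  replace (B0 * (eps/(2*B0))) with (eps/2) in T2 by (field; lra). lra.
Qed.

Lemma ccont_comp (f g : C -> C) (z : C) :
  ccont f (g z) -> ccont g z -> ccont (fun w => f (g w)) z.
Proof.
  intros Hf Hg eps He.
  destruct (Hf eps He) as [d [Hd H]]. destruct (Hg d Hd) as [d' [Hd' H']].
  exists d'; split; auto.
Qed.

Lemma ccont_inv (z : C) : z <> 0%C -> ccont Cinv z.
Proof.
  intros Hz eps He.
  assert (Hm : 0 < Cmod z) by now apply Cmod_gt_0.
  assert (Hp : 0 < eps * (Cmod z * Cmod z) / 2).
  { apply Rdiv_lt_0_compat; [|lra]. now repeat apply Rmult_lt_0_compat. }
  exists (Rmin (Cmod z / 2) (eps * (Cmod z * Cmod z) / 2)). split.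
  { apply Rmin_glb_lt; lra. }
  intros w Hw.
  assert (Hw1 := Rlt_le_trans _ _ _ Hw (Rmin_l _ _)).
  assert (Hw2 := Rlt_le_trans _ _ _ Hw (Rmin_r _ _)).
  assert (Hwm : Cmod z / 2 < Cmod w).
  { assert (G := Cmod_sub_ge z w). rewrite Cmod_sub_sym in G. lra. }
  assert (Hw0 : w <> 0%C). { intro E. rewrite E, Cmod_0 in Hwm. lra. }
  replace (/ w - / z)%C with ((z - w) / (w * z))%C by (field; auto).
  rewrite Cmod_div by now apply Cmult_neq_0.
  rewrite Cmod_mult, Cmod_sub_sym.
  apply Rmult_lt_reg_r with (Cmod w * Cmod z); [apply Rmult_lt_0_compat; lra|].
  unfold Rdiv. rewrite Rmult_assoc, Rinv_l, Rmult_1_r by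
    (apply Rgt_not_eq, Rmult_lt_0_compat; lra).
  eapply Rlt_le_trans; [exact Hw2|].
  replace (eps * (Cmod z * Cmod z) / 2) with (eps * (Cmod z / 2 * Cmod z)) by field.
  apply Rmult_le_compat_l; [lra|]. apply Rmult_le_compat_r; lra.
Qed.

Lemma cdiff_ccont (f : C -> C) (z : C) : cdiff f z -> ccont f z.
Proof.
  intros [phi [Hp E]] eps He.
  assert (H : ccont (fun w => f z + phi w * (w - z))%C z).
  { apply ccont_plus; [apply ccont_const|]. apply ccont_mult; auto.
    apply ccont_plus; [apply ccont_id|apply ccont_const]. }
  destruct (H eps He) as [d [Hd H']]. exists d; split; auto.
  intros w Hw. rewrite (E w). specialize (H' w Hw). simpl in H'.
  replace (f z)%C with (f z + phi z * (z - z))%C at 2 by ring. exact H'.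
Qed.

Lemma cdiff_of_eps (f : C -> C) (z l : C) :
  (forall eps, 0 < eps -> exists delta, 0 < delta /\ forall w,
     Cmod (w - z) < delta -> Cmod (f w - f z - l * (w - z)) <= eps * Cmod (w - z)) ->
  cdiff f z.
Proof.
  intros H.
  exists (fun w => if Ceq_dec w z then l else ((f w - f z) / (w - z))%C). split.
  - intros eps He. destruct (H (eps/2)) as [d [Hd H']]; [lra|].
    exists d; split; auto. intros w Hw.
    destruct (Ceq_dec z z) as [_|N]; [|now destruct N].
    destruct (Ceq_dec w z) as [->|N].
    + rewrite Cmod_self_sub. lra.
    + assert (N' := Csub_neq_0 w z N).
      replace ((f w - f z) / (w - z) - l)%C with ((f w - f z - l * (w - z)) / (w - z))%C by (field; auto).
      rewrite Cmod_div by auto.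
      assert (P : 0 < Cmod (w - z)) by now apply Cmod_gt_0.
      apply Rle_lt_trans with (eps/2); [|lra].
      apply Rmult_le_reg_r with (Cmod (w - z)); auto.
      unfold Rdiv at 1. rewrite Rmult_assoc, Rinv_l, Rmult_1_r by lra. auto.
  - intros w. destruct (Ceq_dec w z) as [->|N].
    + ring.
    + assert (N' := Csub_neq_0 w z N). field; auto.
Qed.

(** A second-order error bound is how differentiability is obtained both for the
    exponential and at removable singularities. *)
Lemma cdiff_of_quadratic (f : C -> C) (z l : C) (K delta : R) :
  0 < delta ->
  (forall w, Cmod (w - z) < delta ->
     Cmod (f w - f z - l * (w - z)) <= K * (Cmod (w - z))^2) ->
  cdiff f z.
Proof.
  intros Hd H. apply cdiff_of_eps with l. intros eps He.
  set (K' := Rabs K + 1). assert (HK : 0 < K') by (unfold K'; assert (G := Rabs_pos K); lra).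
  exists (Rmin delta (eps / K')). split.
  { apply Rmin_glb_lt; auto. now apply Rdiv_lt_0_compat. }
  intros w Hw. eapply Rle_trans.
  { apply H. exact (Rlt_le_trans _ _ _ Hw (Rmin_l _ _)). }
  assert (Hw2 := Rlt_le_trans _ _ _ Hw (Rmin_r _ _)).
  simpl. rewrite Rmult_1_r, <- Rmult_assoc.
  apply Rmult_le_compat_r; [apply Cmod_ge_0|].
  apply Rle_trans with (K' * Cmod (w - z)).
  - apply Rmult_le_compat_r; [apply Cmod_ge_0|]. unfold K'. assert (G := Rle_abs K). lra.
  - apply Rmult_lt_compat_l with (r := K') in Hw2; auto.
    replace (K' * (eps / K')) with eps in Hw2 by (field; lra). lra.
Qed.

Lemma cdiff_ext (f g : C -> C) (z : C) :
  (forall w, f w = g w) -> cdiff f z -> cdiff g z.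
Proof.
  intros E [phi [Hp H]]. exists phi; split; auto. intros w. now rewrite <- !E.
Qed.

Lemma cdiff_const (c z : C) : cdiff (fun _ => c) z.
Proof.
  exists (fun _ => 0%C). split; [apply ccont_const|]. intros; ring.
Qed.

Lemma cdiff_id (z : C) : cdiff (fun w => w) z.
Proof.
  exists (fun _ => 1%C). split; [apply ccont_const|]. intros; ring.
Qed.

Lemma cdiff_plus (f g : C -> C) (z : C) :
  cdiff f z -> cdiff g z -> cdiff (fun w => f w + g w)%C z.
Proof.
  intros [p [Hp Ep]] [q [Hq Eq]]. exists (fun w => p w + q w)%C. split.
  - now apply ccont_plus.
  - intros w. rewrite (Ep w), (Eq w). ring.
Qed.

Lemma cdiff_mult (f g : C -> C) (z : C) :
  cdiff f z -> cdiff g z -> cdiff (fun w => f w * g w)%C z.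
Proof.
  intros Hf Hg. assert (Cg := cdiff_ccont g z Hg).
  destruct Hf as [p [Hp Ep]], Hg as [q [Hq Eq]].
  exists (fun w => p w * g w + f z * q w)%C. split.
  - apply ccont_plus; apply ccont_mult; auto. apply ccont_const.
  - intros w. rewrite (Ep w), (Eq w). ring.
Qed.

Lemma cdiff_comp (f g : C -> C) (z : C) :
  cdiff f (g z) -> cdiff g z -> cdiff (fun w => f (g w)) z.
Proof.
  intros [p [Hp Ep]] Hg. assert (Cg := cdiff_ccont g z Hg). destruct Hg as [q [Hq Eq]].
  exists (fun w => p (g w) * q w)%C. split.
  - apply ccont_mult; auto. now apply ccont_comp.
  - intros w. rewrite (Ep (g w)). rewrite (Eq w) at 2. ring.
Qed.

Lemma cdiff_inv (z : C) : z <> 0%C -> cdiff Cinv z.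
Proof.
  intros Hz. apply cdiff_of_eps with (- (/ z * / z))%C. intros eps He.
  assert (Hm : 0 < Cmod z) by now apply Cmod_gt_0.
  destruct (ccont_inv z Hz (eps * Cmod z)) as [d [Hd H]]; [now apply Rmult_lt_0_compat|].
  exists (Rmin d (Cmod z)). split; [now apply Rmin_glb_lt|].
  intros w Hw.
  specialize (H w (Rlt_le_trans _ _ _ Hw (Rmin_l _ _))).
  assert (Hw2 := Rlt_le_trans _ _ _ Hw (Rmin_r _ _)).
  assert (Hw0 : w <> 0%C).
  { intros ->. replace (0 - z)%C with (- z)%C in Hw2 by ring. rewrite Cmod_opp in Hw2. lra. }
  replace (/ w - / z - - (/ z * / z) * (w - z))%C
    with (- (/ w - / z) * / z * (w - z))%C by (field; auto).
  rewrite !Cmod_mult, Cmod_opp, Cmod_inv by auto.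
  apply Rmult_le_compat_r; [apply Cmod_ge_0|].
  apply Rmult_le_reg_r with (Cmod z); auto.
  rewrite Rmult_assoc, Rinv_l by lra. lra.
Qed.

Lemma cdiff_div (f g : C -> C) (z : C) :
  g z <> 0%C -> cdiff f z -> cdiff g z -> cdiff (fun w => f w / g w)%C z.
Proof.
  intros H Hf Hg. apply cdiff_mult; auto. apply cdiff_comp with (f := Cinv); auto.
  now apply cdiff_inv.
Qed.

Lemma cdiff_opp (f : C -> C) (z : C) : cdiff f z -> cdiff (fun w => - f w)%C z.
Proof.
  intros H. apply cdiff_ext with (fun w => RtoC (-1) * f w)%C.
  - intros w. apply injective_projections; simpl; ring.
  - apply cdiff_mult; auto. apply cdiff_const.
Qed.

Lemma cdiff_minus (f g : C -> C) (z : C) :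
  cdiff f z -> cdiff g z -> cdiff (fun w => f w - g w)%C z.
Proof. intros. apply cdiff_plus; auto. now apply cdiff_opp. Qed.

Lemma cdiff_pow (f : C -> C) (n : nat) (z : C) :
  cdiff f z -> cdiff (fun w => Cpow (f w) n) z.
Proof.
  intros H. induction n as [|n IH]; simpl.
  - apply cdiff_const.
  - apply cdiff_mult; auto.
Qed.

Lemma entire_cdiff (f : C -> C) : entire f -> forall z, cdiff f z.
Proof.
  intros Hf z. destruct (Hf z) as [l [_ Hl]].
  specialize (Hl z (fun P HP => HP)).
  apply cdiff_of_eps with l. intros eps He.
  destruct (Hl (mkposreal eps He)) as [d Hd].
  exists d; split; [apply cond_pos|].
  intros w Hw. 
  specialize (Hd w Hw). simpl in Hd.
  change (Cmod (f w - f z - (w - z) * l)%C <= eps * Cmod (w - z)%C) in Hd.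
  now rewrite (Cmult_comm l).
Qed.

(** * Complex exponential, sine and cosine *)

Lemma Cmod_sqr (z : C) : (Cmod z)^2 = (fst z)^2 + (snd z)^2.
Proof.
  unfold Cmod. rewrite pow2_sqrt; auto.
  apply Rplus_le_le_0_compat; apply pow2_ge_0.
Qed.

Lemma Cmod_le_parts (z : C) : Cmod z <= Rabs (fst z) + Rabs (snd z).
Proof.
  apply Rsqr_incr_0_var.
  - rewrite !Rsqr_pow2, Cmod_sqr, <- (pow2_abs (fst z)), <- (pow2_abs (snd z)).
    assert (H := Rabs_pos (fst z)). assert (H' := Rabs_pos (snd z)). nra.
  - apply Rplus_le_le_0_compat; apply Rabs_pos.
Qed.

Lemma Rabs_fst_le_Cmod (z : C) : Rabs (fst z) <= Cmod z.
Proof. eapply Rle_trans; [apply Rmax_l|apply Rmax_Cmod]. Qed.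

Lemma Rabs_snd_le_Cmod (z : C) : Rabs (snd z) <= Cmod z.
Proof. eapply Rle_trans; [apply Rmax_r|apply Rmax_Cmod]. Qed.

Definition cexp (z : C) : C := (exp (Re z) * cos (Im z), exp (Re z) * sin (Im z)).

Lemma cexp_plus (z w : C) : cexp (z + w) = (cexp z * cexp w)%C.
Proof.
  destruct z, w. unfold cexp. apply injective_projections; simpl.
  - rewrite exp_plus, cos_plus. ring.
  - rewrite exp_plus, sin_plus. ring.
Qed.

Lemma Cmod_cexp (z : C) : Cmod (cexp z) = exp (Re z).
Proof.
  unfold cexp, Cmod. simpl. 
  replace (exp (Re z) * cos (Im z) * (exp (Re z) * cos (Im z) * 1) +
    exp (Re z) * sin (Im z) * (exp (Re z) * sin (Im z) * 1))
    with ((exp (Re z))² * ((sin (Im z))² + (cos (Im z))²)) by (unfold Rsqr; ring).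
  rewrite sin2_cos2, Rmult_1_r. apply sqrt_Rsqr. left. apply exp_pos.
Qed.

Lemma exp_quadratic (x : R) : Rabs x <= /2 -> Rabs (exp x - 1 - x) <= 2 * x^2.
Proof.
  intros H. apply Rabs_le_between in H.
  assert (L := exp_ineq1_le x). assert (U := exp_ineq1_le (-x)).
  assert (P := exp_pos x). assert (E : exp x * exp (-x) = 1).
  { rewrite <- exp_plus, Rplus_opp_r. apply exp_0. }
  rewrite Rabs_pos_eq by lra.
  assert (exp x * (1 - x) <= 1) by nra.
  assert ((1 - x) * (1 + x + 2 * x^2) >= 1) by nra.
  nra.
Qed.

Lemma abs_sin_le (y : R) : Rabs (sin y) <= Rabs y.
Proof.
  destruct (MVT_gen sin 0 y cos) as [c [_ Hc]].
  - intros. auto_derive; auto; ring.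
  - intros. apply continuity_sin.
  - rewrite sin_0, !Rminus_0_r in Hc. rewrite Hc, Rabs_mult.
    rewrite <- (Rmult_1_l (Rabs y)) at 2. apply Rmult_le_compat_r; [apply Rabs_pos|].
    apply Rabs_le. apply COS_bound.
Qed.

Lemma cos_quadratic (y : R) : Rabs (cos y - 1) <= y^2 / 2.
Proof.
  replace y with (2 * (y/2)) at 1 by field. rewrite cos_2a_sin.
  replace (1 - 2 * sin (y/2) * sin (y/2) - 1) with (- (2 * (sin (y/2))^2)) by ring.
  rewrite Rabs_Ropp, Rabs_pos_eq by (assert (H := pow2_ge_0 (sin (y/2))); lra).
  assert (H := abs_sin_le (y/2)). apply Rsqr_le_abs_1 in H. unfold Rsqr in H. nra.
Qed.

Lemma sin_quadratic (y : R) : Rabs y <= 1 -> Rabs (sin y - y) <= y^2 / 2.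
Proof.
  intros H.
  destruct (MVT_gen sin 0 y cos) as [c [Hb Hc]].
  - intros. auto_derive; auto; ring.
  - intros. apply continuity_sin.
  - rewrite sin_0, !Rminus_0_r in Hc. rewrite Hc.
    replace (cos c * y - y) with ((cos c - 1) * y) by ring.
    rewrite Rabs_mult, <- (pow2_abs y).
    assert (Q := cos_quadratic c). assert (A := Rabs_pos y).
    assert (D : c^2 <= (Rabs y)^2).
    { rewrite pow2_abs. unfold Rmin, Rmax in Hb. destruct (Rle_dec 0 y); nra. }
    assert (Rabs (cos c - 1) * Rabs y <= (Rabs y)^2/2 * Rabs y)
      by (apply Rmult_le_compat_r; lra).
    nra.
Qed.

(** Together with the addition formula this gives the derivative of [cexp]
    everywhere, and the expansion of [csin] at [0] that controls the poles of
    [1 / ccos]. *)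
Lemma cexp_quadratic (w : C) :
  Cmod w <= /2 -> Cmod (cexp w - 1 - w) <= 4 * (Cmod w)^2.
Proof.
  intros H. destruct w as [x y].
  assert (Hx := Rabs_fst_le_Cmod (x, y)). assert (Hy := Rabs_snd_le_Cmod (x, y)).
  simpl in Hx, Hy.
  eapply Rle_trans; [apply Cmod_le_parts|]. rewrite Cmod_sqr. simpl.
  assert (E := exp_quadratic x ltac:(lra)).
  assert (K := cos_quadratic y). assert (S := sin_quadratic y ltac:(lra)).
  assert (S1 := abs_sin_le y).
  assert (C1 : Rabs (cos y) <= 1) by (apply Rabs_le, COS_bound).
  assert (Ax := Rabs_pos x). assert (Ay := Rabs_pos y).
  assert (F1 : Rabs (exp x * cos y + - (1) + - x) <= 2 * x^2 + y^2).
  { replace (exp x * cos y + - (1) + - x) with ((exp x - 1 - x) * cos y + (1 + x) * (cos y - 1)) by ring.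
    eapply Rle_trans; [apply Rabs_triang|]. rewrite !Rabs_mult.
    assert (Rabs (1 + x) <= 3/2).
    { eapply Rle_trans; [apply Rabs_triang|]. rewrite Rabs_R1. lra. }
    assert (Rabs (exp x - 1 - x) * Rabs (cos y) <= 2 * x^2 * 1)
      by (apply Rmult_le_compat; auto using Rabs_pos).
    assert (Rabs (1 + x) * Rabs (cos y - 1) <= 3/2 * (y^2/2))
      by (apply Rmult_le_compat; auto using Rabs_pos).
    nra. }
  assert (F2 : Rabs (exp x * sin y + - 0 + - y) <= 2 * Rabs x * Rabs y + y^2/2).
  { replace (exp x * sin y + - 0 + - y) with ((exp x - 1) * sin y + (sin y - y)) by ring.
    eapply Rle_trans; [apply Rabs_triang|]. rewrite !Rabs_mult.
    assert (Rabs (exp x - 1) <= 2 * Rabs x).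
    { replace (exp x - 1) with ((exp x - 1 - x) + x) by ring.
      eapply Rle_trans; [apply Rabs_triang|]. rewrite <- (pow2_abs x) in E. nra. }
    assert (Rabs (exp x - 1) * Rabs (sin y) <= 2 * Rabs x * Rabs y)
      by (apply Rmult_le_compat; auto using Rabs_pos).
    lra. }
  assert (D : 0 <= (Rabs x - Rabs y)^2) by apply pow2_ge_0.
  assert (Qx := pow2_abs x). assert (Qy := pow2_abs y).
  assert (Px := pow2_ge_0 x). assert (Py := pow2_ge_0 y).
  nra.
Qed.

Lemma cdiff_cexp (z : C) : cdiff cexp z.
Proof.
  apply cdiff_of_quadratic with (cexp z) (4 * Cmod (cexp z)) (/2); [lra|].
  intros w Hw.
  replace (cexp w - cexp z - cexp z * (w - z))%C
    with (cexp z * (cexp (w - z) - 1 - (w - z)))%C.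
  - rewrite Cmod_mult, Rmult_assoc, (Rmult_comm 4), Rmult_assoc.
    apply Rmult_le_compat_l; [apply Cmod_ge_0|].
    rewrite Rmult_comm. apply cexp_quadratic. lra.
  - replace w with (z + (w - z))%C at 3 by ring. rewrite cexp_plus. ring.
Qed.

Definition ccos (z : C) : C := ((cexp (Ci * z) + cexp (- (Ci * z))) / 2)%C.
Definition csin (z : C) : C := ((cexp (Ci * z) - cexp (- (Ci * z))) / (2 * Ci))%C.

Lemma Ci_neq_0 : Ci <> 0%C.
Proof. intros E. apply (f_equal snd) in E. simpl in E. lra. Qed.

Lemma C2_neq_0 : RtoC 2 <> 0%C.
Proof. intros E. apply (f_equal fst) in E. simpl in E. lra. Qed.

Lemma cdiff_cexp_scal (a z : C) : cdiff (fun w => cexp (a * w)) z.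
Proof.
  apply cdiff_comp; [apply cdiff_cexp|]. apply cdiff_mult; [apply cdiff_const|apply cdiff_id].
Qed.

Lemma cdiff_ccos (z : C) : cdiff ccos z.
Proof.
  unfold ccos. apply cdiff_mult; [|apply cdiff_const]. apply cdiff_plus.
  - apply cdiff_cexp_scal.
  - apply cdiff_ext with (fun w => cexp (- Ci * w)); [intros; f_equal; ring|].
    apply cdiff_cexp_scal.
Qed.

Lemma cdiff_csin (z : C) : cdiff csin z.
Proof.
  unfold csin. apply cdiff_mult; [|apply cdiff_const]. apply cdiff_minus.
  - apply cdiff_cexp_scal.
  - apply cdiff_ext with (fun w => cexp (- Ci * w)); [intros; f_equal; ring|].
    apply cdiff_cexp_scal.
Qed.

Lemma ccos_parts (x y : R) : ccos (x, y) = (cos x * cosh y, - (sin x * sinh y)).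
Proof.
  unfold ccos, cexp, cosh, sinh. simpl.
  replace (0 * x - 1 * y) with (- y) by ring. replace (0 * y + 1 * x) with x by ring.
  rewrite Ropp_involutive, cos_neg, sin_neg.
  apply injective_projections; simpl; field.
Qed.

Lemma csin_parts (x y : R) : csin (x, y) = (sin x * cosh y, cos x * sinh y).
Proof.
  unfold csin, cexp, cosh, sinh. simpl.
  replace (0 * x - 1 * y) with (- y) by ring. replace (0 * y + 1 * x) with x by ring.
  rewrite Ropp_involutive, cos_neg, sin_neg.
  apply injective_projections; simpl; field.
Qed.

Lemma ccos_RtoC (x : R) : ccos x = RtoC (cos x).
Proof.
  unfold RtoC. rewrite ccos_parts, cosh_0, sinh_0. apply injective_projections; simpl; ring.
Qed.

Lemma csin_RtoC (x : R) : csin x = RtoC (sin x).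
Proof.
  unfold RtoC. rewrite csin_parts, cosh_0, sinh_0. apply injective_projections; simpl; ring.
Qed.

Lemma cosh_ge_1 (y : R) : 1 <= cosh y.
Proof.
  unfold cosh. assert (exp y * exp (-y) = 1).
  { rewrite <- exp_plus, Rplus_opp_r. apply exp_0. }
  assert (P := exp_pos y). assert (P' := exp_pos (-y)).
  assert (0 <= (exp y - exp (-y))^2) by apply pow2_ge_0. nra.
Qed.

Lemma sinh_eq_0 (y : R) : sinh y = 0 -> y = 0.
Proof.
  unfold sinh. intros H. assert (E : exp y = exp (-y)) by lra.
  apply exp_inv in E. lra.
Qed.

Lemma ccos_eq_0 (z : C) : ccos z = 0%C -> cos (Re z) = 0 /\ Im z = 0.
Proof.
  destruct z as [x y]. rewrite ccos_parts. intros E. simpl.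
  assert (E1 := f_equal fst E). assert (E2 := f_equal snd E). simpl in E1, E2.
  assert (G := cosh_ge_1 y).
  assert (C0 : cos x = 0) by (apply Rmult_integral in E1; destruct E1; auto; lra).
  split; auto. apply sinh_eq_0.
  assert (S := sin2_cos2 x). rewrite C0 in S. unfold Rsqr in S.
  assert (sin x <> 0) by (intros E0; rewrite E0 in S; lra).
  assert (E3 : sin x * sinh y = 0) by lra.
  apply Rmult_integral in E3. now destruct E3.
Qed.

Lemma csin_eq_0 (z : C) : csin z = 0%C -> sin (Re z) = 0 /\ Im z = 0.
Proof.
  destruct z as [x y]. rewrite csin_parts. intros E. simpl.
  assert (E1 := f_equal fst E). assert (E2 := f_equal snd E). simpl in E1, E2.
  assert (G := cosh_ge_1 y).
  assert (C0 : sin x = 0) by (apply Rmult_integral in E1; destruct E1; auto; lra).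
  split; auto. apply sinh_eq_0.
  assert (S := sin2_cos2 x). rewrite C0 in S. unfold Rsqr in S.
  assert (cos x <> 0) by (intros E0; rewrite E0 in S; lra).
  apply Rmult_integral in E2. now destruct E2.
Qed.

Lemma ccos_shift (z : C) (p : R) :
  cos p = 0 -> ccos (p + z) = (- (RtoC (sin p) * csin z))%C.
Proof.
  intros H. destruct z as [x y]. unfold Cplus, RtoC. simpl.
  rewrite Rplus_0_l, ccos_parts, csin_parts, sin_plus, cos_plus, H.
  apply injective_projections; simpl; ring.
Qed.

Lemma csin_quadratic (w : C) : Cmod w <= /2 -> Cmod (csin w - w) <= 4 * (Cmod w)^2.
Proof.
  intros H.
  assert (Mi : Cmod (Ci * w)%C = Cmod w).
  { rewrite Cmod_mult. replace (Cmod Ci) with 1; [ring|].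
    unfold Cmod; simpl. replace (0 * (0 * 1) + 1 * (1 * 1)) with 1 by ring. now rewrite sqrt_1. }
  assert (A := cexp_quadratic (Ci * w)%C ltac:(rewrite Mi; auto)).
  assert (B0 := cexp_quadratic (- (Ci * w))%C ltac:(rewrite Cmod_opp, Mi; auto)).
  rewrite Cmod_opp in B0. rewrite Mi in A, B0.
  replace (csin w - w)%C with
    (((cexp (Ci * w) - 1 - Ci * w) - (cexp (- (Ci * w)) - 1 - - (Ci * w))) / (2 * Ci))%C.
  - assert (N : (2 * Ci)%C <> 0%C) by (apply Cmult_neq_0; [apply C2_neq_0|apply Ci_neq_0]).
    rewrite Cmod_div by auto.
    replace (Cmod (2 * Ci)%C) with 2.
    + assert (T := Cmod_triangle_sub (cexp (Ci * w) - 1 - Ci * w) (cexp (- (Ci * w)) - 1 - - (Ci * w))).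
      lra.
    + unfold Cmod; simpl. replace (_ + _) with (2 * 2) by ring. rewrite sqrt_square; lra.
  - unfold csin. field. apply Ci_neq_0.
Qed.

Lemma exp_le (x y : R) : x <= y -> exp x <= exp y.
Proof. intros [H| ->]; [left; now apply exp_increasing|right; auto]. Qed.

Lemma Cmod_csin_le (z : C) : Cmod (csin z) <= exp (Rabs (Im z)).
Proof.
  destruct z as [x y]. rewrite csin_parts. simpl.
  apply Rle_trans with (cosh y).
  - apply Rsqr_incr_0_var; [|assert (G := cosh_ge_1 y); lra].
    rewrite !Rsqr_pow2, Cmod_sqr. simpl fst; simpl snd.
    assert (S := sin2_cos2 x). unfold Rsqr in S.
    assert (E : cosh y ^2 - sinh y ^2 = 1).
    { unfold cosh, sinh.
      assert (exp y * exp (-y) = 1) by (rewrite <- exp_plus, Rplus_opp_r; apply exp_0). nra. }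
    replace ((sin x * cosh y)^2 + (cos x * sinh y)^2)
      with ((sin x * sin x + cos x * cos x) * cosh y^2 - cos x * cos x * (cosh y ^2 - sinh y^2)) by ring.
    rewrite S, E. nra.
  - unfold cosh. assert (exp y <= exp (Rabs y)) by apply exp_le, Rle_abs.
    assert (exp (-y) <= exp (Rabs y)).
    { apply exp_le. rewrite <- Rabs_Ropp. apply Rle_abs. }
    lra.
Qed.

Lemma exp_abs_le_cosh (y : R) : exp (Rabs y) / 2 <= cosh y.
Proof.
  unfold cosh. assert (P := exp_pos y). assert (P' := exp_pos (-y)).
  unfold Rabs. destruct (Rcase_abs y); lra.
Qed.

(** On the lines [Re z = k pi] the cosine is [+ or - cosh (Im z)]. *)
Lemma Cmod_ccos_ge_vert (z : C) :
  Rabs (cos (Re z)) = 1 -> exp (Rabs (Im z)) / 2 <= Cmod (ccos z).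
Proof.
  destruct z as [x y]. intros H. simpl in H. eapply Rle_trans; [apply exp_abs_le_cosh|].
  rewrite ccos_parts.
  eapply Rle_trans; [|apply Rabs_fst_le_Cmod]. simpl.
  rewrite Rabs_mult, H, Rmult_1_l. apply Rle_abs.
Qed.

(** [|cos z|^2 = cosh^2 y - sin^2 x >= cosh^2 y - 1], and [cosh y] is large enough
    once [|y| >= 2]. *)
Lemma Cmod_ccos_ge_horiz (z : C) :
  2 <= Rabs (Im z) -> exp (Rabs (Im z)) / 4 <= Cmod (ccos z).
Proof.
  destruct z as [x y]. intros H. simpl in *. rewrite ccos_parts.
  assert (E : cosh y ^2 - sinh y ^2 = 1).
  { unfold cosh, sinh.
    assert (exp y * exp (-y) = 1) by (rewrite <- exp_plus, Rplus_opp_r; apply exp_0). nra. }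
  assert (S := sin2_cos2 x). unfold Rsqr in S.
  assert (X := exp_abs_le_cosh y).
  assert (L := exp_ineq1_le (Rabs y)).
  apply Rsqr_incr_0_var; [|apply Cmod_ge_0].
  rewrite !Rsqr_pow2, Cmod_sqr. simpl fst; simpl snd.
  replace ((cos x * cosh y)^2 + (-(sin x * sinh y))^2)
    with ((sin x * sin x + cos x * cos x) * cosh y^2 - sin x * sin x * (cosh y ^2 - sinh y^2)) by ring.
  rewrite S, E.
  assert ((exp (Rabs y) / 2)^2 <= cosh y ^2) by (apply pow_incr; lra).
  assert (sin x * sin x <= 1) by nra. nra.
Qed.

(** * Goursat's theorem for rectangles *)

Definition rect (a b c d : R) (z : C) : Prop := a <= Re z <= b /\ c <= Im z <= d.

Definition edge (a b c d : R) (z : C) : Prop :=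
  rect a b c d z /\ (Re z = a \/ Re z = b \/ Im z = c \/ Im z = d).

Definition hint (g : C -> C) (y a b : R) : R := RInt (fun x => Re (g (x, y))) a b.
Definition vint (g : C -> C) (x c d : R) : R := RInt (fun y => Im (g (x, y))) c d.

(** The real part of the contour integral of [g] along the positively oriented
    boundary of the rectangle: [dz] is [dx] on the horizontal sides and [i dy] on
    the vertical ones, and [Re (i g) = - Im g]. Imaginary parts are recovered by
    multiplying [g] with a complex constant. *)
Definition bint (g : C -> C) (a b c d : R) : R :=
  hint g c a b - hint g d a b + vint g a c d - vint g b c d.

Lemma ccont_hor (g : C -> C) (x y : R) :
  ccont g (x, y) -> continuous (fun t => Re (g (t, y))) x.
Proof.
  intros H. apply filterlim_locally. intros [eps He]. simpl.
  destruct (H eps He) as [d [Hd H']]. exists (mkposreal d Hd). intros t Ht.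
  change (Rabs (t - x) < d) in Ht.
  assert (Hw : Cmod ((t, y) - (x, y)) < d).
  { eapply Rle_lt_trans; [apply Cmod_le_parts|]. simpl.
    replace (y + - y) with 0 by ring. rewrite Rabs_R0. unfold Rminus in Ht. lra. }
  specialize (H' _ Hw).
  change (Rabs (Re (g (t, y)) - Re (g (x, y))) < eps).
  eapply Rle_lt_trans; [|exact H']. apply (Rabs_fst_le_Cmod (g (t, y) - g (x, y))).
Qed.

Lemma ccont_ver (g : C -> C) (x y : R) :
  ccont g (x, y) -> continuous (fun t => Im (g (x, t))) y.
Proof.
  intros H. apply filterlim_locally. intros [eps He]. simpl.
  destruct (H eps He) as [d [Hd H']]. exists (mkposreal d Hd). intros t Ht.
  change (Rabs (t - y) < d) in Ht.
  assert (Hw : Cmod ((x, t) - (x, y)) < d).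
  { eapply Rle_lt_trans; [apply Cmod_le_parts|]. simpl.
    replace (x + - x) with 0 by ring. rewrite Rabs_R0. unfold Rminus in Ht. lra. }
  specialize (H' _ Hw).
  change (Rabs (Im (g (x, t)) - Im (g (x, y))) < eps).
  eapply Rle_lt_trans; [|exact H']. apply (Rabs_snd_le_Cmod (g (x, t) - g (x, y))).
Qed.

Lemma ex_hint (g : C -> C) (y a b : R) :
  a <= b -> (forall x, a <= x <= b -> ccont g (x, y)) ->
  ex_RInt (fun x => Re (g (x, y))) a b.
Proof.
  intros Hab H. apply (ex_RInt_continuous (V := R_CompleteNormedModule)). intros x Hx.
  rewrite Rmin_left, Rmax_right in Hx by auto. now apply ccont_hor, H.
Qed.

Lemma ex_vint (g : C -> C) (x c d : R) :
  c <= d -> (forall y, c <= y <= d -> ccont g (x, y)) ->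
  ex_RInt (fun y => Im (g (x, y))) c d.
Proof.
  intros Hab H. apply (ex_RInt_continuous (V := R_CompleteNormedModule)). intros y Hx.
  rewrite Rmin_left, Rmax_right in Hx by auto. now apply ccont_ver, H.
Qed.

Lemma hint_split (g : C -> C) (y a m b : R) :
  a <= m <= b -> (forall x, a <= x <= b -> ccont g (x, y)) ->
  hint g y a b = hint g y a m + hint g y m b.
Proof.
  intros Hm H. symmetry. apply (RInt_Chasles (V := R_CompleteNormedModule)); apply ex_hint;
    try tauto; intros; apply H; lra.
Qed.

Lemma vint_split (g : C -> C) (x c m d : R) :
  c <= m <= d -> (forall y, c <= y <= d -> ccont g (x, y)) ->
  vint g x c d = vint g x c m + vint g x m d.
Proof.
  intros Hm H. symmetry. apply (RInt_Chasles (V := R_CompleteNormedModule)); apply ex_vint;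
    try tauto; intros; apply H; lra.
Qed.

Lemma bint_split_ver (g : C -> C) (a m b c d : R) :
  a <= m <= b ->
  (forall x, a <= x <= b -> ccont g (x, c) /\ ccont g (x, d)) ->
  bint g a b c d = bint g a m c d + bint g m b c d.
Proof.
  intros Hm H. unfold bint.
  rewrite (hint_split g c a m b), (hint_split g d a m b) by (auto; intros; now apply H). ring.
Qed.

Lemma bint_split_hor (g : C -> C) (a b c m d : R) :
  c <= m <= d ->
  (forall y, c <= y <= d -> ccont g (a, y) /\ ccont g (b, y)) ->
  bint g a b c d = bint g a b c m + bint g a b m d.
Proof.
  intros Hm H. unfold bint.
  rewrite (vint_split g a c m d), (vint_split g b c m d) by (auto; intros; now apply H). ring.
Qed.

Lemma edge_sides (a b c d : R) (P : C -> Prop) :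
  a <= b -> c <= d -> (forall z, edge a b c d z -> P z) ->
  (forall x, a <= x <= b -> P (x, c) /\ P (x, d)) /\
  (forall y, c <= y <= d -> P (a, y) /\ P (b, y)).
Proof.
  intros Hab Hcd H.
  split; intros t Ht; split; apply H; unfold edge, rect; simpl; repeat split; try tauto; lra.
Qed.

Lemma bint_plus (g1 g2 : C -> C) (a b c d : R) :
  a <= b -> c <= d ->
  (forall z, edge a b c d z -> ccont g1 z /\ ccont g2 z) ->
  bint (fun z => g1 z + g2 z)%C a b c d = bint g1 a b c d + bint g2 a b c d.
Proof.
  intros Hab Hcd H. destruct (edge_sides _ _ _ _ _ Hab Hcd H) as [Hh Hv].
  assert (Eh : forall y, (y = c \/ y = d) ->
    hint (fun z => g1 z + g2 z)%C y a b = hint g1 y a b + hint g2 y a b).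
  { intros y Hy. apply (RInt_plus (V := R_CompleteNormedModule)); apply ex_hint; auto; intros x Hx;
      destruct Hy; subst y; now apply Hh. }
  assert (Ev : forall x, (x = a \/ x = b) ->
    vint (fun z => g1 z + g2 z)%C x c d = vint g1 x c d + vint g2 x c d).
  { intros x Hx. apply (RInt_plus (V := R_CompleteNormedModule)); apply ex_vint; auto; intros y Hy;
      destruct Hx; subst x; now apply Hv. }
  unfold bint. rewrite !Eh, !Ev by auto. ring.
Qed.

Lemma bint_ext (g1 g2 : C -> C) (a b c d : R) :
  a <= b -> c <= d -> (forall z, edge a b c d z -> g1 z = g2 z) ->
  bint g1 a b c d = bint g2 a b c d.
Proof.
  intros Hab Hcd H. destruct (edge_sides _ _ _ _ _ Hab Hcd H) as [Hh Hv].
  assert (Eh : forall y, (y = c \/ y = d) -> hint g1 y a b = hint g2 y a b).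
  { intros y Hy. apply RInt_ext. intros x Hx. rewrite Rmin_left, Rmax_right in Hx by auto.
    destruct Hy; subst y; f_equal; apply Hh; lra. }
  assert (Ev : forall x, (x = a \/ x = b) -> vint g1 x c d = vint g2 x c d).
  { intros x Hx. apply RInt_ext. intros y Hy. rewrite Rmin_left, Rmax_right in Hy by auto.
    destruct Hx; subst x; f_equal; apply Hv; lra. }
  unfold bint. now rewrite !Eh, !Ev by auto.
Qed.

Lemma bint_bound (g : C -> C) (a b c d m : R) :
  a <= b -> c <= d ->
  (forall z, edge a b c d z -> ccont g z /\ Cmod (g z) <= m) ->
  Rabs (bint g a b c d) <= 2 * m * ((b - a) + (d - c)).
Proof.
  intros Hab Hcd H. destruct (edge_sides _ _ _ _ _ Hab Hcd H) as [Hh Hv].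
  assert (Eh : forall y, (y = c \/ y = d) -> Rabs (hint g y a b) <= (b - a) * m).
  { intros y Hy. apply abs_RInt_le_const; auto.
    - apply ex_hint; auto; intros x Hx; destruct Hy; subst y; now apply Hh.
    - intros x Hx. eapply Rle_trans; [apply Rabs_fst_le_Cmod|].
      destruct Hy; subst y; now apply Hh. }
  assert (Ev : forall x, (x = a \/ x = b) -> Rabs (vint g x c d) <= (d - c) * m).
  { intros x Hx. apply abs_RInt_le_const; auto.
    - apply ex_vint; auto; intros y Hy; destruct Hx; subst x; now apply Hv.
    - intros y Hy. eapply Rle_trans; [apply Rabs_snd_le_Cmod|].
      destruct Hx; subst x; now apply Hv. }
  assert (E1 := Eh c (or_introl eq_refl)). assert (E2 := Eh d (or_intror eq_refl)).
  assert (E3 := Ev a (or_introl eq_refl)). assert (E4 := Ev b (or_intror eq_refl)).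
  apply Rabs_le_between in E1, E2, E3, E4. unfold bint. apply Rabs_le. lra.
Qed.

Lemma bint_affine (alpha beta : C) (a b c d : R) :
  bint (fun z => alpha + beta * z)%C a b c d = 0.
Proof.
  destruct alpha as [a1 a2], beta as [b1 b2]. unfold bint, hint, vint. simpl.
  assert (Q : forall u v s t, RInt (fun x => u + v * x) s t = u * (t - s) + v * (t^2 - s^2) / 2).
  { intros u v s t. apply is_RInt_unique.
    replace (u * (t - s) + v * (t^2 - s^2) / 2)
      with (minus ((fun x => u * x + v * x^2/2) t) ((fun x => u * x + v * x^2/2) s))
      by (unfold minus, plus, opp; simpl; field).
    apply (is_RInt_derive (V := R_CompleteNormedModule) (fun x => u * x + v * x^2/2)).
    - intros x _. auto_derive; auto. field.
    - intros x _. apply (ex_derive_continuous (V := R_NormedModule)). auto_derive; auto. }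
  rewrite (RInt_ext _ (fun x => (a1 - b2 * c) + b1 * x) a b) by (intros; simpl; ring).
  rewrite (RInt_ext (fun x => a1 + (b1 * x - b2 * d)) (fun x => (a1 - b2 * d) + b1 * x) a b) by (intros; simpl; ring).
  rewrite (RInt_ext _ (fun y => (a2 + b2 * a) + b1 * y) c d) by (intros; simpl; ring).
  rewrite (RInt_ext (fun y => a2 + (b1 * y + b2 * b)) (fun y => (a2 + b2 * b) + b1 * y) c d) by (intros; simpl; ring).
  rewrite !Q. field.
Qed.

Lemma nested_intervals (u v : nat -> R) :
  (forall n, u n <= u (S n)) -> (forall n, v (S n) <= v n) -> (forall n, u n <= v n) ->
  exists p, forall n, u n <= p <= v n.
Proof.
  intros Hu Hv Huv.
  assert (Mu : forall n k, u n <= u (n + k)%nat).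
  { intros n k. induction k; [rewrite Nat.add_0_r; lra|].
    rewrite Nat.add_succ_r. eapply Rle_trans; eauto. }
  assert (Mv : forall n k, v (n + k)%nat <= v n).
  { intros n k. induction k; [rewrite Nat.add_0_r; lra|].
    rewrite Nat.add_succ_r. eapply Rle_trans; eauto. }
  assert (Hb : forall n m, u n <= v m).
  { intros n m. eapply Rle_trans; [apply (Mu n m)|]. eapply Rle_trans; [apply Huv|].
    rewrite Nat.add_comm. apply Mv. }
  destruct (completeness (fun x => exists n, x = u n)) as [p [P1 P2]].
  - exists (v 0%nat). intros x [n ->]. apply Hb.
  - exists (u 0%nat). now exists 0%nat.
  - exists p. intros n. split.
    + apply P1. now exists n.
    + apply P2. intros x [k ->]. apply Hb.
Qed.

(** The four quarters have boundary integrals adding up to that of the whole, so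
    one of them carries at least a quarter of it. *)
Lemma bisection_step (g : C -> C) (x y w h : R) :
  0 <= w -> 0 <= h ->
  (forall z, rect x (x + w) y (y + h) z -> ccont g z) ->
  exists s : R * R,
    (x <= fst s /\ fst s + w / 2 <= x + w /\ y <= snd s /\ snd s + h / 2 <= y + h) /\
    Rabs (bint g x (x + w) y (y + h)) / 4 <=
    Rabs (bint g (fst s) (fst s + w / 2) (snd s) (snd s + h / 2)).
Proof.
  intros Hw Hh Hc.
  apply NNPP. intros N.
  assert (F : forall s : R * R,
    (x <= fst s /\ fst s + w / 2 <= x + w /\ y <= snd s /\ snd s + h / 2 <= y + h) ->
    Rabs (bint g (fst s) (fst s + w / 2) (snd s) (snd s + h / 2)) <
    Rabs (bint g x (x + w) y (y + h)) / 4).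
  { intros s Hs. apply Rnot_le_lt. intros L. apply N. now exists s. }
  assert (F1 := F (x, y)). assert (F2 := F (x + w/2, y)).
  assert (F3 := F (x, y + h/2)). assert (F4 := F (x + w/2, y + h/2)). simpl in *.
  specialize (F1 ltac:(lra)). specialize (F2 ltac:(lra)).
  specialize (F3 ltac:(lra)). specialize (F4 ltac:(lra)).
  replace (x + w/2 + w/2) with (x + w) in * by field.
  replace (y + h/2 + h/2) with (y + h) in * by field.
  rewrite (bint_split_ver g x (x + w/2) (x + w)) in F1, F2, F3, F4
    by (try lra; intros; split; apply Hc; unfold rect; simpl; lra).
  rewrite (bint_split_hor g x (x + w/2) y (y + h/2) (y + h)) in F1, F2, F3, F4
    by (try lra; intros; split; apply Hc; unfold rect; simpl; lra).
  rewrite (bint_split_hor g (x + w/2) (x + w) y (y + h/2) (y + h)) in F1, F2, F3, F4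
    by (try lra; intros; split; apply Hc; unfold rect; simpl; lra).
  set (q1 := bint g x (x + w / 2) y (y + h / 2)) in *.
  set (q2 := bint g (x + w / 2) (x + w) y (y + h / 2)) in *.
  set (q3 := bint g x (x + w / 2) (y + h / 2) (y + h)) in *.
  set (q4 := bint g (x + w / 2) (x + w) (y + h / 2) (y + h)) in *.
  assert (T := Rabs_triang (q1 + q3) (q2 + q4)).
  assert (T1 := Rabs_triang q1 q3). assert (T2 := Rabs_triang q2 q4). lra.
Qed.

(** Affine functions integrate to zero and approximate [g] near [p] to within
    [eps] times the diameter, so the boundary integral is small compared with
    the square of the diameter. *)
Lemma bint_local (g : C -> C) (p : C) (eps : R) :
  cdiff g p -> 0 < eps -> exists delta, 0 < delta /\
    forall x y w h, 0 <= w -> 0 <= h -> w + h < delta ->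
      rect x (x + w) y (y + h) p ->
      (forall z, rect x (x + w) y (y + h) z -> ccont g z) ->
      Rabs (bint g x (x + w) y (y + h)) <= 2 * eps * (w + h)^2.
Proof.
  intros [phi [Hp E]] He. destruct (Hp eps He) as [d [Hd H]].
  exists d; split; auto. intros x y w h Hw Hh Hs Rp Hc.
  set (A := fun z => ((g p - phi p * p) + phi p * z)%C).
  assert (CA : forall z, ccont A z).
  { intros z. apply ccont_plus; [apply ccont_const|].
    apply ccont_mult; [apply ccont_const|apply ccont_id]. }
  assert (Cr : forall z, edge x (x + w) y (y + h) z -> ccont (fun z => g z - A z)%C z).
  { intros z [Rz _]. apply ccont_plus; [now apply Hc|].
    intros e' He'. destruct (CA z e' He') as [d' [Hd' H']]. exists d'; split; auto.
    intros w' Hw'. specialize (H' w' Hw').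
    replace (- A w' - - A z)%C with (- (A w' - A z))%C by ring. now rewrite Cmod_opp. }
  rewrite (bint_ext g (fun z => A z + (g z - A z))%C) by (try lra; intros; ring).
  rewrite bint_plus by (try lra; intros; split; auto).
  unfold A at 1. rewrite bint_affine, Rplus_0_l.
  replace (2 * eps * (w + h)^2) with (2 * (eps * (w + h)) * (x + w - x + (y + h - y))) by ring.
  apply bint_bound; try lra. intros z Ez. split; auto.
  destruct Ez as [Rz _].
  assert (Dz : Cmod (z - p) <= w + h).
  { eapply Rle_trans; [apply Cmod_le_parts|]. destruct z, p. unfold rect in *. simpl in *.
    apply Rplus_le_compat; apply Rabs_le; lra. }
  unfold A. rewrite (E z).
  replace (g p + phi z * (z - p) - (g p - phi p * p + phi p * z))%C
    with ((phi z - phi p) * (z - p))%C by ring.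
  rewrite Cmod_mult. apply Rmult_le_compat; auto using Cmod_ge_0.
  left. apply H. lra.
Qed.

(** Repeated bisection gives rectangles shrinking to a point [p], with a boundary
    integral of at least [4^(-n)] times the initial one, while [bint_local] at [p]
    makes it at most [eps * 4^(-n)] up to a constant. *)
Theorem goursat (g : C -> C) (a b c d : R) :
  a <= b -> c <= d -> (forall z, rect a b c d z -> cdiff g z) ->
  bint g a b c d = 0.
Proof.
  intros Hab Hcd Hg.
  set (w := b - a). set (h := d - c).
  assert (Hw : 0 <= w) by (unfold w; lra). assert (Hh : 0 <= h) by (unfold h; lra).
  assert (P2 : forall n, 0 < 2^n) by (intros; apply pow_lt; lra).
  set (I := fun n (s : R * R) => bint g (fst s) (fst s + w / 2^n) (snd s) (snd s + h / 2^n)).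
  set (ok := fun n (s : R * R) => a <= fst s /\ fst s + w / 2^n <= b /\ c <= snd s /\ snd s + h / 2^n <= d).
  set (sub := fun n (s t : R * R) => fst s <= fst t /\ fst t + w / 2^(S n) <= fst s + w / 2^n /\
    snd s <= snd t /\ snd t + h / 2^(S n) <= snd s + h / 2^n /\ Rabs (I n s) / 4 <= Rabs (I (S n) t)).
  assert (Hpos : forall n, 0 <= w / 2^n /\ 0 <= h / 2^n).
  { intros n. split; apply Rmult_le_pos; auto; left; now apply Rinv_0_lt_compat. }
  assert (step : forall n s, exists t, ok n s -> sub n s t).
  { intros n s. destruct (classic (ok n s)) as [O|O]; [|exists s; tauto].
    destruct (Hpos n) as [W H].
    destruct (bisection_step g (fst s) (snd s) (w / 2^n) (h / 2^n)) as [t [T1 T2]]; auto.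
    - intros z Hz. apply cdiff_ccont, Hg. unfold rect, ok in *. lra.
    - exists t. intros _. unfold sub, I.
      replace (w / 2^(S n)) with (w / 2^n / 2) by (simpl; field; apply Rgt_not_eq, P2).
      replace (h / 2^(S n)) with (h / 2^n / 2) by (simpl; field; apply Rgt_not_eq, P2).
      tauto. }
  set (f := fun p : nat * (R * R) =>
    proj1_sig (constructive_indefinite_description _ (step (fst p) (snd p)))).
  assert (Hf : forall p, ok (fst p) (snd p) -> sub (fst p) (snd p) (f p)).
  { intros p. unfold f. now destruct (constructive_indefinite_description _ _). }
  set (s := fix s n := match n with O => (a, c) | S n => f (n, s n) end).
  assert (Hs : forall n, ok n (s n)).
  { induction n as [|n IH].
    - unfold ok, w, h. simpl. lra.
    - assert (Q := Hf (n, s n) IH). simpl in Q. change (f (n, s n)) with (s (S n)) in Q.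
      unfold sub, ok in *. lra. }
  assert (Hsub : forall n, sub n (s n) (s (S n))).
  { intros n. apply (Hf (n, s n)). apply Hs. }
  assert (HI : forall n, Rabs (bint g a b c d) / 4^n <= Rabs (I n (s n))).
  { induction n as [|n IH].
    - unfold I, w, h. simpl. unfold Rdiv. rewrite !Rinv_1, !Rmult_1_r.
      replace (a + (b - a)) with b by ring. replace (c + (d - c)) with d by ring. lra.
    - destruct (Hsub n) as [_ [_ [_ [_ Q]]]].
      replace (Rabs (bint g a b c d) / 4 ^ S n) with (Rabs (bint g a b c d) / 4 ^ n / 4)
        by (simpl; field; apply pow_nonzero; lra). lra. }
  destruct (nested_intervals (fun n => fst (s n)) (fun n => fst (s n) + w / 2^n)) as [px Hx].
  { intros n. apply Hsub. } { intros n. apply Hsub. } { intros n. destruct (Hpos n). lra. }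
  destruct (nested_intervals (fun n => snd (s n)) (fun n => snd (s n) + h / 2^n)) as [py Hy].
  { intros n. apply Hsub. } { intros n. apply Hsub. } { intros n. destruct (Hpos n). lra. }
  assert (Rp : rect a b c d (px, py)).
  { unfold rect; simpl. specialize (Hx O). specialize (Hy O). unfold w, h in *. simpl in *. lra. }
  apply NNPP. intros N. apply Rabs_pos_lt in N.
  set (D := w + h) in *.
  (* small enough for [2 * eps * D^2], the bound that the limit point yields, to be
     less than the value being estimated *)
  set (eps := Rabs (bint g a b c d) / (4 * (D^2 + 1))).
  assert (HD : 0 < D^2 + 1) by (assert (Q := pow2_ge_0 D); lra).
  assert (He : 0 < eps) by (apply Rdiv_lt_0_compat; lra).
  destruct (bint_local g (px, py) eps (Hg _ Rp) He) as [delta [Hd Q]].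
  assert (Hn : exists n, D / 2^n < delta).
  { destruct (pow_lt_1_zero (/2) ltac:(rewrite Rabs_pos_eq; lra) (delta / (D + 1))) as [n Hn].
    - apply Rdiv_lt_0_compat; auto. unfold D; lra.
    - exists n. specialize (Hn n (le_n n)). rewrite Rabs_pos_eq in Hn by (apply pow_le; lra).
      rewrite pow_inv in Hn. assert (HD1 : 0 < D + 1) by (unfold D; lra).
      apply Rmult_lt_compat_l with (r := D + 1) in Hn; auto.
      replace ((D + 1) * (delta / (D + 1))) with delta in Hn by (field; lra).
      assert (0 < / 2^n) by apply Rinv_0_lt_compat, P2. unfold Rdiv. lra. }
  destruct Hn as [n Hn]. destruct (Hpos n) as [W H].
  assert (B0 : Rabs (I n (s n)) <= 2 * eps * (w / 2^n + h / 2^n)^2).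
  { apply Q; auto.
    - unfold D in Hn. unfold Rdiv in *. lra.
    - unfold rect; simpl. specialize (Hx n). specialize (Hy n). simpl in *. lra.
    - intros z Hz. apply cdiff_ccont, Hg. assert (O := Hs n). unfold rect, ok in *. lra. }
  assert (A0 := HI n).
  assert (E4 : (w / 2^n + h / 2^n)^2 = D^2 / 4^n).
  { unfold D. replace 4 with (2^2) by ring. rewrite <- pow_mult, Nat.mul_comm, pow_mult. field.
    apply Rgt_not_eq, P2. }
  rewrite E4 in B0.
  assert (P4 : 0 < 4^n) by (apply pow_lt; lra).
  assert (C0 : Rabs (bint g a b c d) <= 2 * eps * D^2).
  { apply Rmult_le_reg_r with (/ 4^n); [now apply Rinv_0_lt_compat|].
    unfold Rdiv in *. lra. }
  assert (E5 : Rabs (bint g a b c d) = 4 * eps * (D^2 + 1)) by (unfold eps; field; lra).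
  assert (0 <= D^2) by apply pow2_ge_0. nra.
Qed.

(** * The maximum modulus principle *)

(** Boundedness on a punctured neighbourhood: the removable singularities. *)
Definition bounded_near (g : C -> C) (p : C) : Prop :=
  exists K delta, 0 < delta /\ forall z, z <> p -> Cmod (z - p) < delta -> Cmod (g z) <= K.

(** Cutting out a small square around [p] leaves rectangles on which Goursat's
    theorem applies, and the integral along the boundary of the square tends to
    zero with its perimeter. *)
Lemma goursat_punctured (g : C -> C) (a b c d : R) (p : C) :
  a < Re p < b -> c < Im p < d ->
  (forall z, rect a b c d z -> z <> p -> cdiff g z) -> bounded_near g p ->
  bint g a b c d = 0.
Proof.
  destruct p as [p q]. simpl. intros Hp Hq Hg [K [delta [Hd HK]]].
  set (r := Rmin (delta / 2) (Rmin (Rmin (p - a) (b - p)) (Rmin (q - c) (d - q)))).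
  assert (Hr : 0 < r) by (unfold r; repeat apply Rmin_glb_lt; lra).
  assert (Hr1 : r <= delta / 2) by apply Rmin_l.
  assert (Hr2 : r <= p - a /\ r <= b - p /\ r <= q - c /\ r <= d - q).
  { unfold r.
    assert (M1 := Rmin_r (delta / 2) (Rmin (Rmin (p - a) (b - p)) (Rmin (q - c) (d - q)))).
    assert (M2 := Rmin_l (Rmin (p - a) (b - p)) (Rmin (q - c) (d - q))).
    assert (M3 := Rmin_r (Rmin (p - a) (b - p)) (Rmin (q - c) (d - q))).
    assert (M4 := Rmin_l (p - a) (b - p)). assert (M5 := Rmin_r (p - a) (b - p)).
    assert (M6 := Rmin_l (q - c) (d - q)). assert (M7 := Rmin_r (q - c) (d - q)). lra. }
  assert (Small : forall e, 0 < e < r ->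
    bint g a b c d = bint g (p - e) (p + e) (q - e) (q + e)).
  { intros e He.
    assert (Hne : forall x y, (x <> p \/ y <> q) -> (x, y) <> (p, q)).
    { intros x y N E. inversion E. tauto. }
    assert (Cc : forall x y, a <= x <= b -> c <= y <= d -> (x <> p \/ y <> q) -> ccont g (x, y)).
    { intros x y Hx Hy N. apply cdiff_ccont, Hg; auto. now split. }
    rewrite (bint_split_ver g a (p - e) b) by
      (try lra; intros; split; apply Cc; lra).
    rewrite (bint_split_ver g (p - e) (p + e) b) by
      (try lra; intros; split; apply Cc; lra).
    rewrite (bint_split_hor g (p - e) (p + e) c (q - e) d) by
      (try lra; intros; split; apply Cc; lra).
    rewrite (bint_split_hor g (p - e) (p + e) (q - e) (q + e) d) by
      (try lra; intros; split; apply Cc; lra).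
    assert (G : forall a' b' c' d', a <= a' <= b' -> b' <= b -> c <= c' <= d' -> d' <= d ->
      (b' < p \/ p < a' \/ d' < q \/ q < c') -> bint g a' b' c' d' = 0).
    { intros a' b' c' d' H1 H2 H3 H4 H5. apply goursat; try lra.
      intros [x y] [Rx Ry]. simpl in Rx, Ry. apply Hg.
      - unfold rect; simpl; lra.
      - apply Hne. lra. }
    rewrite (G a (p - e) c d), (G (p + e) b c d), (G (p - e) (p + e) c (q - e)),
      (G (p - e) (p + e) (q + e) d) by lra.
    ring. }
  apply NNPP. intros N. apply Rabs_pos_lt in N.
  assert (HK0 : 0 <= K).
  { eapply Rle_trans; [apply Cmod_ge_0|]. apply (HK (p + delta / 2, q)).
    - intros E. inversion E. lra.
    - eapply Rle_lt_trans; [apply Cmod_le_parts|]. simpl.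
      replace (p + delta / 2 + - p) with (delta / 2) by ring.
      replace (q + - q) with 0 by ring. rewrite Rabs_R0, Rabs_pos_eq; lra. }
  set (e := Rmin (r / 2) (Rabs (bint g a b c d) / (16 * (K + 1)))).
  assert (He : 0 < e).
  { apply Rmin_glb_lt; [lra|]. apply Rdiv_lt_0_compat; lra. }
  assert (He1 : e <= r / 2) by apply Rmin_l.
  assert (He2 : e <= Rabs (bint g a b c d) / (16 * (K + 1))) by apply Rmin_r.
  assert (B0 : Rabs (bint g a b c d) <= 2 * K * ((p + e - (p - e)) + (q + e - (q - e)))).
  { rewrite (Small e) by lra. apply bint_bound; try lra.
    intros [x y] [[Rx Ry] Ez]. simpl in Rx, Ry, Ez.
    assert (Nz : (x, y) <> (p, q)).
    { intros E. inversion E. lra. }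
    split.
    - apply cdiff_ccont, Hg; auto. unfold rect; simpl; lra.
    - apply HK; auto. eapply Rle_lt_trans; [apply Cmod_le_parts|]. simpl.
      assert (Rabs (x + - p) <= e) by (apply Rabs_le; lra).
      assert (Rabs (y + - q) <= e) by (apply Rabs_le; lra). lra. }
  apply Rmult_le_compat_l with (r := 16 * (K + 1)) in He2; [|lra].
  replace (16 * (K + 1) * (Rabs (bint g a b c d) / (16 * (K + 1))))
    with (Rabs (bint g a b c d)) in He2 by (field; lra).
  nra.
Qed.

Lemma RInt_le_const (f : R -> R) (a b M : R) :
  a <= b -> ex_RInt f a b -> (forall x, a <= x <= b -> f x <= M) -> RInt f a b <= (b - a) * M.
Proof.
  intros Hab Hf H.
  rewrite <- (RInt_const (V := R_CompleteNormedModule) a b M : _ = (b - a) * M).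
  apply RInt_le; auto.
  - apply ex_RInt_const.
  - intros; apply H; lra.
Qed.

Lemma cdiff_kernel (p z : C) : z <> p -> cdiff (fun w => Ci / (w - p))%C z.
Proof.
  intros H. apply cdiff_div.
  - now apply Csub_neq_0.
  - apply cdiff_const.
  - apply cdiff_minus; [apply cdiff_id|apply cdiff_const].
Qed.

Lemma kernel_parts (x y p q : R) : (x, y) <> (p, q) ->
  (Ci / ((x, y) - (p, q)))%C =
  ((y - q) / ((x - p)^2 + (y - q)^2), (x - p) / ((x - p)^2 + (y - q)^2)).
Proof.
  intros N.
  assert (H : (x - p)^2 + (y - q)^2 <> 0).
  { intros E. apply N. assert (0 <= (x - p)^2) by apply pow2_ge_0.
    assert (0 <= (y - q)^2) by apply pow2_ge_0.
    assert (x - p = 0) by nra. assert (y - q = 0) by nra. f_equal; lra. }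
  apply injective_projections; simpl; field; unfold Rminus in H; simpl in H;
    intros E; apply H; rewrite <- E; ring.
Qed.

(** The integral of [i / (z - p)] around [p] is [-2 pi]; only its sign matters, and
    that is visible on each side of the rectangle. *)
Lemma kernel_bint_neg (a b c d : R) (p : C) :
  a < Re p < b -> c < Im p < d ->
  exists k, 0 < k /\ bint (fun z => Ci / (z - p))%C a b c d <= - k.
Proof.
  destruct p as [p q]. simpl. intros Hp Hq.
  set (D := (b - a)^2 + (d - c)^2).
  assert (HD : 0 < D) by (unfold D; nra).
  assert (Cc : forall x y, (x <> p \/ y <> q) -> ccont (fun z => Ci / (z - (p, q)))%C (x, y)).
  { intros x y N. apply cdiff_ccont, cdiff_kernel. intros E. inversion E. tauto. }
  assert (N : forall x y, a <= x <= b -> c <= y <= d -> (x <> p \/ y <> q) ->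
    0 < (x - p)^2 + (y - q)^2 <= D).
  { intros x y Hx Hy N. split.
    - destruct N as [N|N]; [assert (0 < (x-p)^2)|assert (0 < (y-q)^2)];
        try (apply pow2_gt_0; lra); assert (A1 := pow2_ge_0 (x-p)); assert (A2 := pow2_ge_0 (y-q)); lra.
    - unfold D. assert ((x-p)^2 <= (b-a)^2) by (apply pow_maj_Rabs, Rabs_le; lra).
      assert ((y-q)^2 <= (d-c)^2) by (apply pow_maj_Rabs, Rabs_le; lra). lra. }
  assert (K : forall x y, (x <> p \/ y <> q) ->
    (Ci / ((x, y) - (p, q)))%C = ((y - q) / ((x - p)^2 + (y - q)^2), (x - p) / ((x - p)^2 + (y - q)^2))).
  { intros x y Hn. apply kernel_parts. intros E; inversion E; tauto. }
  assert (L : forall s t, 0 < s -> 0 < t <= D -> s / D <= s / t).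
  { intros s t Hs Ht. unfold Rdiv. apply Rmult_le_compat_l; [lra|]. apply Rinv_le_contravar; lra. }
  exists ((b - a) * ((q - c) / D)). split.
  { apply Rmult_lt_0_compat; [lra|]. apply Rdiv_lt_0_compat; lra. }
  assert (I1 : hint (fun z => Ci / (z - (p, q)))%C c a b <= (b - a) * - ((q - c) / D)).
  { apply RInt_le_const; [lra| |].
    - apply (ex_hint (fun z => Ci / (z - (p, q)))%C); [lra|]. intros; apply Cc; lra.
    - intros x Hx. rewrite K by lra. cbn [Re Im fst snd].
      assert (Q := N x c Hx ltac:(lra) ltac:(lra)). assert (Q' := L (q - c) _ ltac:(lra) Q).
      unfold Rdiv in *. lra. }
  assert (I2 : 0 <= hint (fun z => Ci / (z - (p, q)))%C d a b).
  { apply RInt_ge_0; [lra| |].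
    - apply (ex_hint (fun z => Ci / (z - (p, q)))%C); [lra|]. intros; apply Cc; lra.
    - intros x Hx. rewrite K by lra. cbn [Re Im fst snd].
      assert (Q := N x d ltac:(lra) ltac:(lra) ltac:(lra)).
      left. apply Rdiv_lt_0_compat; lra. }
  assert (I3 : vint (fun z => Ci / (z - (p, q)))%C a c d <= (d - c) * 0).
  { apply RInt_le_const; [lra| |].
    - apply (ex_vint (fun z => Ci / (z - (p, q)))%C); [lra|]. intros; apply Cc; lra.
    - intros y Hy. rewrite K by lra. cbn [Re Im fst snd].
      assert (Q := N a y ltac:(lra) Hy ltac:(lra)).
      assert (0 < (p - a) / ((a - p)^2 + (y - q)^2)) by (apply Rdiv_lt_0_compat; lra).
      unfold Rdiv in *. lra. }
  assert (I4 : 0 <= vint (fun z => Ci / (z - (p, q)))%C b c d).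
  { apply RInt_ge_0; [lra| |].
    - apply (ex_vint (fun z => Ci / (z - (p, q)))%C); [lra|]. intros; apply Cc; lra.
    - intros y Hy. rewrite K by lra. cbn [Re Im fst snd].
      assert (Q := N b y ltac:(lra) ltac:(lra) ltac:(lra)).
      left. apply Rdiv_lt_0_compat; lra. }
  unfold bint. lra.
Qed.

(** Cauchy's formula in the weak form of a bound: the kernel [1 / (z - p)] times
    [h z - h p] is bounded near [p], hence has zero integral, and the integral of
    the kernel itself is bounded away from zero. The constant does not depend on
    [h], which is what the passage to powers of [h] needs. *)
Lemma cauchy_estimate (a b c d : R) (p : C) :
  a < Re p < b -> c < Im p < d ->
  exists K, 0 <= K /\ forall h m,
    (forall z, rect a b c d z -> cdiff h z) ->
    (forall z, edge a b c d z -> Cmod (h z) <= m) -> Cmod (h p) <= K * m.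
Proof.
  intros Hp Hq.
  destruct (kernel_bint_neg a b c d p Hp Hq) as [k [Hk HI]].
  set (s := Rmin (Rmin (Re p - a) (b - Re p)) (Rmin (Im p - c) (d - Im p))).
  assert (Hs : 0 < s) by (unfold s; repeat apply Rmin_glb_lt; lra).
  assert (Hs2 : s <= Re p - a /\ s <= b - Re p /\ s <= Im p - c /\ s <= d - Im p).
  { unfold s. set (A := Re p - a). set (B0 := b - Re p). set (A' := Im p - c). set (B' := d - Im p).
    assert (M2 := Rmin_l (Rmin A B0) (Rmin A' B')). assert (M3 := Rmin_r (Rmin A B0) (Rmin A' B')).
    assert (M4 := Rmin_l A B0). assert (M5 := Rmin_r A B0).
    assert (M6 := Rmin_l A' B'). assert (M7 := Rmin_r A' B'). lra. }
  assert (Far : forall z, edge a b c d z -> s <= Cmod (z - p)).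
  { intros [x y] [_ E]. destruct p as [p q]. simpl in *.
    assert (F1 := Rabs_fst_le_Cmod ((x, y) - (p, q))). assert (F2 := Rabs_snd_le_Cmod ((x, y) - (p, q))).
    simpl in F1, F2.
    destruct E as [-> |[-> |[-> | ->]]];
      [eapply Rle_trans; [|exact F1]; rewrite <- Rabs_Ropp|eapply Rle_trans; [|exact F1]
      |eapply Rle_trans; [|exact F2]; rewrite <- Rabs_Ropp|eapply Rle_trans; [|exact F2]];
      (eapply Rle_trans; [|apply Rle_abs]); lra. }
  set (L := 2 * ((b - a) + (d - c))).
  assert (HL : 0 < L) by (unfold L; lra).
  exists (L / (s * k)). split.
  { left. apply Rdiv_lt_0_compat; auto. now apply Rmult_lt_0_compat. }
  intros h m Hh Hm.
  assert (Hm0 : 0 <= m).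
  { eapply Rle_trans; [apply Cmod_ge_0|]. apply (Hm (a, c)).
    unfold edge, rect; simpl. lra. }
  destruct (Ceq_dec (h p) 0) as [E|NE].
  { rewrite E, Cmod_0. apply Rmult_le_pos; auto. left. apply Rdiv_lt_0_compat; auto.
    now apply Rmult_lt_0_compat. }
  assert (PH : 0 < Cmod (h p)) by now apply Cmod_gt_0.
  (* normalized so that [c0 * (h z - h p)] is [c0 * h z + i], with the kernel of
     [kernel_bint_neg] as its constant part *)
  set (c0 := (- Ci / h p)%C).
  assert (Hc0 : Cmod c0 = / Cmod (h p)).
  { unfold c0. rewrite Cmod_div, Cmod_opp by auto. rewrite Cmod_Ci. field. lra. }
  assert (Gz : bint (fun z => c0 * h z / (z - p) + Ci / (z - p))%C a b c d = 0).
  { apply goursat_punctured with p; auto.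
    - intros z Hz N. apply cdiff_plus; [|now apply cdiff_kernel].
      apply cdiff_div; [now apply Csub_neq_0| |].
      + apply cdiff_mult; [apply cdiff_const|now apply Hh].
      + apply cdiff_minus; [apply cdiff_id|apply cdiff_const].
    - destruct (Hh p) as [phi [Hphi E]]; [unfold rect; lra|].
      destruct (ccont_bounded phi p Hphi) as [delta [Hd Hb]].
      exists (Cmod c0 * (Cmod (phi p) + 1)), delta. split; auto.
      intros z N Hz. replace (c0 * h z / (z - p) + Ci / (z - p))%C with (c0 * phi z)%C.
      + rewrite Cmod_mult. apply Rmult_le_compat_l; [apply Cmod_ge_0|]. auto.
      + rewrite (E z). assert (N' := Csub_neq_0 z p N). unfold c0. field. auto. }
  assert (Ne : forall z, edge a b c d z -> z <> p).
  { intros z Ez ->. specialize (Far p Ez). rewrite Cmod_self_sub in Far. lra. }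
  assert (C1 : forall z, edge a b c d z -> ccont (fun z => c0 * h z / (z - p))%C z).
  { intros z Ez. apply cdiff_ccont. apply cdiff_div; [now apply Csub_neq_0, Ne| |].
    - apply cdiff_mult; [apply cdiff_const|]. apply Hh, Ez.
    - apply cdiff_minus; [apply cdiff_id|apply cdiff_const]. }
  rewrite bint_plus in Gz.
  2: lra. 2: lra.
  2: { intros z Ez. split; auto. apply cdiff_ccont, cdiff_kernel. now apply Ne. }
  assert (B0 : Rabs (bint (fun z => c0 * h z / (z - p))%C a b c d)
     <= 2 * (/ Cmod (h p) * m * / s) * ((b - a) + (d - c))).
  { apply bint_bound; try lra. intros z Ez. split; auto.
    assert (N' := Csub_neq_0 z p (Ne z Ez)).
    rewrite Cmod_div, Cmod_mult, Hc0 by auto. unfold Rdiv.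
    apply Rmult_le_compat.
    - apply Rmult_le_pos; [left; now apply Rinv_0_lt_compat|apply Cmod_ge_0].
    - left. now apply Rinv_0_lt_compat, Cmod_gt_0.
    - apply Rmult_le_compat_l; [left; now apply Rinv_0_lt_compat|]. now apply Hm.
    - apply Rinv_le_contravar; auto. }
  apply Rabs_le_between in B0.
  assert (Q : k <= L * m / (Cmod (h p) * s)).
  { replace (L * m / (Cmod (h p) * s)) with (2 * (/ Cmod (h p) * m * / s) * ((b - a) + (d - c))).
    - lra.
    - unfold L. field. lra. }
  apply Rmult_le_compat_r with (r := Cmod (h p) / k) in Q.
  - replace (k * (Cmod (h p) / k)) with (Cmod (h p)) in Q by (field; lra).
    replace (L * m / (Cmod (h p) * s) * (Cmod (h p) / k)) with (L / (s * k) * m) in Q by (field; lra).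
    exact Q.
  - left. now apply Rdiv_lt_0_compat.
Qed.

(** The polynomial with double zeros at the points of [P]. A double zero makes
    its product with a locally bounded function differentiable, with derivative
    zero. *)
Fixpoint pprod (P : list C) (z : C) : C :=
  match P with nil => 1%C | p :: P => ((z - p) * (z - p) * pprod P z)%C end.

Lemma cdiff_pprod (P : list C) (z : C) : cdiff (pprod P) z.
Proof.
  induction P as [|p P IH]; simpl; [apply cdiff_const|].
  assert (H : cdiff (fun z => z - p)%C z) by (apply cdiff_minus; [apply cdiff_id|apply cdiff_const]).
  apply cdiff_mult; auto. now apply cdiff_mult.
Qed.

Lemma pprod_neq_0 (P : list C) (z : C) : ~ In z P -> pprod P z <> 0%C.
Proof.
  induction P as [|p P IH]; simpl; intros H.
  - apply C1_nz.
  - assert (z - p <> 0)%C by (apply Csub_neq_0; auto).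
    repeat apply Cmult_neq_0; auto.
Qed.

Lemma pprod_bounded (P : list C) (r : R) :
  exists D, 0 < D /\ forall z, Cmod z <= r -> Cmod (pprod P z) <= D.
Proof.
  induction P as [|p P [D [HD IH]]]; simpl.
  - exists 1. split; [lra|]. intros. rewrite Cmod_1. lra.
  - exists ((Rabs r + Cmod p + 1) * (Rabs r + Cmod p + 1) * D).
    assert (Q : 0 < Rabs r + Cmod p + 1).
    { assert (A := Rabs_pos r). assert (A' := Cmod_ge_0 p). lra. }
    split; [now repeat apply Rmult_lt_0_compat|].
    intros z Hz. rewrite !Cmod_mult.
    assert (Cmod (z - p) <= Rabs r + Cmod p + 1).
    { assert (T := Cmod_triangle_sub z p). assert (A := Rle_abs r). lra. }
    repeat apply Rmult_le_compat; auto using Cmod_ge_0.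
    apply Rmult_le_pos; apply Cmod_ge_0.
Qed.

Lemma pprod_quadratic (P : list C) (p : C) :
  In p P -> exists K, 0 < K /\ forall z, Cmod (z - p) <= 1 -> Cmod (pprod P z) <= K * (Cmod (z - p))^2.
Proof.
  assert (Hz : forall z, Cmod (z - p) <= 1 -> Cmod z <= Cmod p + 1).
  { intros z Hz. assert (T := Cmod_sub_ge z p). lra. }
  induction P as [|q P IH]; cbn [pprod In]; [tauto|].
  intros [-> |H].
  - destruct (pprod_bounded P (Cmod p + 1)) as [D [HD H]].
    exists D. split; auto. intros z Z. rewrite !Cmod_mult.
    specialize (H z (Hz z Z)).
    replace (D * Cmod (z - p)^2) with (Cmod (z - p) * Cmod (z - p) * D) by ring.
    apply Rmult_le_compat_l; auto. apply Rmult_le_pos; apply Cmod_ge_0.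
  - destruct (IH H) as [K [HK HK']].
    destruct (pprod_bounded (q :: nil) (Cmod p + 1)) as [D [HD HD']].
    exists (D * K). split; [now apply Rmult_lt_0_compat|]. intros z Z.
    rewrite Cmod_mult, Rmult_assoc. specialize (HD' z (Hz z Z)). simpl in HD'.
    rewrite Cmult_1_r in HD'.
    apply Rmult_le_compat; auto using Cmod_ge_0.
Qed.

Lemma geometric_domination (A m c K : R) :
  0 <= m -> 0 < c -> (forall n, A^n * c <= K * m^n) -> A <= m.
Proof.
  intros Hm Hc H. apply Rnot_lt_le. intros N.
  set (t := (A + m) / 2). assert (Ht : m < t < A) by (unfold t; lra).
  destruct (Pow_x_infinity (A / t)) with (b := (Rabs K + 1) / c) as [n Hn].
  { rewrite Rabs_pos_eq by (left; apply Rdiv_lt_0_compat; lra).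
    apply Rmult_lt_reg_r with t; [lra|]. unfold Rdiv. rewrite Rmult_assoc, Rinv_l; lra. }
  specialize (Hn n (le_n n)). specialize (H n).
  rewrite Rabs_pos_eq in Hn by (apply pow_le; left; apply Rdiv_lt_0_compat; lra).
  unfold Rdiv in Hn at 1. rewrite Rpow_mult_distr, pow_inv in Hn.
  assert (Pt : 0 < t^n) by (apply pow_lt; lra).
  assert (Pm : 0 <= m^n <= t^n) by (split; [apply pow_le|apply pow_incr]; lra).
  apply Rge_le in Hn. apply Rmult_le_compat_r with (r := t^n * c) in Hn; [|nra].
  replace ((Rabs K + 1) / c * (t^n * c)) with ((Rabs K + 1) * t^n) in Hn by (field; lra).
  replace (A^n * / t^n * (t^n * c)) with (A^n * c) in Hn by (field; lra).
  assert (K * m^n <= Rabs K * t^n).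
  { apply Rle_trans with (Rabs K * m^n).
    - apply Rmult_le_compat_r; [lra|apply Rle_abs].
    - apply Rmult_le_compat_l; [apply Rabs_pos|lra]. }
  nra.
Qed.

(** [cauchy_estimate] for [W^n * pprod P] bounds [|W z0|^n] by a constant times
    [m^n]; as [n] grows the constant becomes immaterial. *)
Theorem maximum_modulus (W : C -> C) (P : list C) (a b c d m : R) (z0 : C) :
  a < Re z0 < b -> c < Im z0 < d -> ~ In z0 P ->
  (forall z, rect a b c d z -> ~ In z P -> cdiff W z) ->
  (forall p, In p P -> bounded_near W p) ->
  (forall z, edge a b c d z -> ~ In z P -> Cmod (W z) <= m) -> 0 <= m ->
  Cmod (W z0) <= m.
Proof.
  intros Hx Hy Hz0 Hd HP Hm Hm0.
  destruct (cauchy_estimate a b c d z0 Hx Hy) as [K [HK HE]].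
  destruct (pprod_bounded P (Rabs a + Rabs b + Rabs c + Rabs d)) as [D [HD HD']].
  assert (In_dec : forall z, {In z P} + {~ In z P}) by (intros; apply in_dec, Ceq_dec).
  assert (P0 : forall p, In p P -> pprod P p = 0%C).
  { intros p Hp. destruct (pprod_quadratic P p Hp) as [K' [_ H']].
    apply Cmod_eq_0. specialize (H' p). rewrite Cmod_self_sub in H'. specialize (H' ltac:(lra)).
    assert (Q := Cmod_ge_0 (pprod P p)). simpl in H'. lra. }
  apply geometric_domination with (Cmod (pprod P z0)) (K * D); auto.
  { apply Cmod_gt_0, pprod_neq_0, Hz0. }
  intros n.
  rewrite <- Cmod_pow, <- Cmod_mult, Rmult_assoc, (Rmult_comm D).
  apply (HE (fun z => Cpow (W z) n * pprod P z)%C).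
  - intros z Rz. destruct (In_dec z) as [I|I].
    + destruct (HP z I) as [M [delta [Hdelta HM]]].
      destruct (pprod_quadratic P z I) as [K' [HK' H']].
      apply cdiff_of_quadratic with (RtoC 0) ((Rabs M)^n * K') (Rmin delta 1).
      { apply Rmin_glb_lt; lra. }
      intros w Hw. rewrite (P0 z I).
      replace (Cpow (W w) n * pprod P w - Cpow (W z) n * RtoC 0 - RtoC 0 * (w - z))%C
        with (Cpow (W w) n * pprod P w)%C by ring.
      destruct (Ceq_dec w z) as [-> |N].
      * rewrite (P0 z I), Cmult_0_r, Cmod_0, Cmod_self_sub. simpl. lra.
      * rewrite Cmod_mult, Cmod_pow, Rmult_assoc.
        apply Rmult_le_compat; auto using Cmod_ge_0, pow_le.
        -- apply pow_incr. split; [apply Cmod_ge_0|].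
           eapply Rle_trans; [|apply Rle_abs]. apply HM; auto.
           exact (Rlt_le_trans _ _ _ Hw (Rmin_l _ _)).
        -- apply H'. left. exact (Rlt_le_trans _ _ _ Hw (Rmin_r _ _)).
    + apply cdiff_mult; [|apply cdiff_pprod]. apply cdiff_pow, Hd; auto.
  - intros z Ez. destruct (In_dec z) as [I|I].
    + rewrite (P0 z I), Cmult_0_r, Cmod_0. apply Rmult_le_pos; [now apply pow_le|lra].
    + rewrite Cmod_mult, Cmod_pow. apply Rmult_le_compat; auto using Cmod_ge_0, pow_le.
      * apply pow_incr. split; [apply Cmod_ge_0|]. now apply Hm.
      * apply HD'. destruct Ez as [[R1 R2] _].
        eapply Rle_trans; [apply Cmod_le_parts|]. 
        assert (T : forall u v x, u <= x <= v -> Rabs x <= Rabs u + Rabs v).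
        { intros u v x Hu. assert (A1 := Rle_abs v). assert (A2 := Rle_abs (-u)).
          rewrite Rabs_Ropp in A2. assert (A3 := Rabs_pos u). assert (A4 := Rabs_pos v).
          apply Rabs_le; lra. }
        assert (T1 := T a b _ R1). assert (T2 := T c d _ R2). unfold Re, Im in *. lra.
Qed.

(** * The Phragmen-Lindelof principle *)

(** The maximum modulus principle for [G * exp (- b)]: the harmonic function
    [Re b] dominates the growth of [log |G|] on the boundary, hence inside. *)
Lemma maximum_modulus_barrier (G b : C -> C) (a1 a2 c1 c2 m : R) (z0 : C) :
  a1 < Re z0 < a2 -> c1 < Im z0 < c2 -> 0 <= m ->
  (forall z, cdiff G z) -> (forall z, cdiff b z) ->
  (forall z, edge a1 a2 c1 c2 z -> Cmod (G z) <= m * exp (Re (b z))) ->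
  Cmod (G z0) <= m * exp (Re (b z0)).
Proof.
  intros Hx Hy Hm HG Hb HE.
  assert (Q : Cmod (G z0 * cexp (- b z0))%C <= m).
  { apply (maximum_modulus (fun z => G z * cexp (- b z))%C nil a1 a2 c1 c2); auto.
    - intros z _ _. apply cdiff_mult; auto. apply cdiff_comp; [apply cdiff_cexp|].
      now apply cdiff_opp.
    - intros p [].
    - intros z Ez _. rewrite Cmod_mult, Cmod_cexp. simpl.
      apply Rle_trans with (m * exp (Re (b z)) * exp (- Re (b z))).
      + apply Rmult_le_compat_r; [left; apply exp_pos|]. auto.
      + rewrite Rmult_assoc, <- exp_plus, Rplus_opp_r, exp_0. lra. }
  rewrite Cmod_mult, Cmod_cexp in Q. simpl in Q.
  apply Rmult_le_compat_r with (r := exp (Re (b z0))) in Q; [|left; apply exp_pos].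
  rewrite Rmult_assoc, <- exp_plus in Q. unfold Re in *.
  rewrite Rplus_opp_l, exp_0, Rmult_1_r in Q. exact Q.
Qed.

(** The barrier is [L] times the harmonic function [(x^2 - y^2) / X + 2 y], which
    is nonnegative on the bottom of the box [[-X,X] x [0,X]], at least [X] on its
    other three sides, and tends to [2 y] as [X] grows. *)
Lemma half_plane_box (G : C -> C) (m L X : R) (z : C) :
  (forall z, cdiff G z) -> 0 <= m -> 0 <= L -> 0 < X ->
  (forall t : R, Cmod (G t) <= m) ->
  (forall z, edge (-X) X 0 X z -> Im z <> 0 -> Cmod (G z) <= m * exp (L * X)) ->
  - X < Re z < X -> 0 < Im z < X ->
  Cmod (G z) <= m * exp (L * (((Re z)^2 - (Im z)^2) / X + 2 * Im z)).
Proof.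
  intros HG Hm HL HX Hb Hs Hx Hy.
  assert (E : forall z, Re (RtoC L * (z * z / RtoC X - 2 * Ci * z))%C
     = L * (((Re z)^2 - (Im z)^2) / X + 2 * Im z)).
  { intros [x y]. simpl. field. nra. }
  rewrite <- E.
  apply (maximum_modulus_barrier G (fun z => RtoC L * (z * z / RtoC X - 2 * Ci * z))%C
    (-X) X 0 X); auto.
  - intros w. apply cdiff_mult; [apply cdiff_const|].
    apply cdiff_minus; apply cdiff_mult; try apply cdiff_const; try apply cdiff_id.
    apply cdiff_mult; apply cdiff_id.
  - intros w Ew. rewrite E. destruct w as [x y].
    destruct (Req_dec y 0) as [-> |N].
    + apply Rle_trans with m; [apply Hb|].
      rewrite <- (Rmult_1_r m) at 1. apply Rmult_le_compat_l; auto.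
      rewrite <- exp_0. apply exp_le. simpl.
      apply Rmult_le_pos; auto. apply Rplus_le_le_0_compat; [|lra].
      apply Rmult_le_pos; [nra|]. left; now apply Rinv_0_lt_compat.
    + eapply Rle_trans; [apply Hs; auto|].
      apply Rmult_le_compat_l; auto. apply exp_le. simpl.
      apply Rmult_le_compat_l; auto.
      apply Rmult_le_reg_r with X; auto.
      replace (((x * (x * 1) - y * (y * 1)) / X + 2 * y) * X) with (x * x - y * y + 2 * y * X) by (field; lra).
      destruct Ew as [[R1 R2] S]. simpl in *. nra.
Qed.

Lemma le_of_exp_limit (A m a b : R) :
  0 <= A -> 0 <= m -> 0 <= a ->
  (exists X0, forall X, X0 < X -> A <= m * exp (a / X + b)) -> A <= m * exp b.
Proof.
  intros HA Hm Ha [X0 H]. apply Rnot_lt_le. intros N.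
  set (X := Rmax (X0 + 1) (Rmax 1 (A * a / (A - m * exp b) + 1))).
  assert (HX0 : X0 < X) by (unfold X; assert (Q := Rmax_l (X0+1) (Rmax 1 (A * a / (A - m * exp b) + 1))); lra).
  assert (M0 := Rmax_r (X0+1) (Rmax 1 (A * a / (A - m * exp b) + 1))). fold X in M0.
  assert (M1 := Rmax_l 1 (A * a / (A - m * exp b) + 1)).
  assert (M2 := Rmax_r 1 (A * a / (A - m * exp b) + 1)).
  assert (HX : 0 < X) by lra. assert (HX2 : A * a / (A - m * exp b) < X) by lra.
  specialize (H X HX0). rewrite exp_plus in H.
  assert (I := exp_ineq1_le (- (a / X))).
  assert (E : exp (a / X) * exp (- (a / X)) = 1) by (rewrite <- exp_plus, Rplus_opp_r; apply exp_0).
  assert (P := exp_pos (- (a / X))).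
  apply Rmult_le_compat_r with (r := exp (- (a / X))) in H; [|lra].
  replace (m * (exp (a / X) * exp b) * exp (- (a / X))) with (m * exp b) in H
    by (transitivity (m * exp b * (exp (a / X) * exp (- (a / X)))); [rewrite E; ring|ring]).
  assert (H2 : A * (1 - a / X) <= m * exp b) by nra.
  apply Rmult_lt_compat_r with (r := A - m * exp b) in HX2; [|lra].
  replace (A * a / (A - m * exp b) * (A - m * exp b)) with (A * a) in HX2 by (field; lra).
  assert (H3 : (A - m * exp b) * X <= A * a).
  { apply Rmult_le_compat_r with (r := X) in H2; [|lra].
    replace (A * (1 - a / X) * X) with (A * X - A * a) in H2 by (field; lra). lra. }
  lra.
Qed.

(** For a function bounded on the real line, exponential growth in the upper
    half-plane is exponential growth in the imaginary part alone, at the price of a worse rate. The rate is improved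
    afterwards. *)
Lemma half_plane_bound (G : C -> C) (m L r : R) (z : C) :
  (forall z, cdiff G z) -> 0 <= m -> 0 <= L ->
  (forall t : R, Cmod (G t) <= m) ->
  (forall z, r <= Cmod z -> Cmod (G z) <= m * exp (L * Cmod z)) ->
  0 <= Im z -> Cmod (G z) <= m * exp (4 * L * Im z).
Proof.
  intros HG Hm HL Hb Hs Hy.
  destruct z as [x y]. simpl in Hy.
  destruct (Req_dec y 0) as [-> |N].
  { simpl. rewrite Rmult_0_r, exp_0, Rmult_1_r. apply Hb. }
  apply le_of_exp_limit with (2 * L * x^2); auto using Cmod_ge_0.
  { assert (Q := pow2_ge_0 x). nra. }
  exists (Rmax (Rabs r) (Rmax (Rabs x) (Rabs y))). intros X HX.
  assert (X1 := Rmax_l (Rabs r) (Rmax (Rabs x) (Rabs y))).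
  assert (X2 := Rmax_r (Rabs r) (Rmax (Rabs x) (Rabs y))).
  assert (X3 := Rmax_l (Rabs x) (Rabs y)). assert (X4 := Rmax_r (Rabs x) (Rabs y)).
  assert (PX : 0 < X) by (assert (Q := Rabs_pos r); lra).
  assert (Ax : - X < x < X) by (apply Rabs_lt_between; lra).
  assert (Ay : - X < y < X) by (apply Rabs_lt_between; lra).
  eapply Rle_trans.
  - apply (half_plane_box G m (2 * L) X (x, y)); simpl; auto; try lra.
    intros w [[R1 R2] S] Nw. destruct w as [u v]. simpl in *.
    eapply Rle_trans; [apply Hs|].
    + assert (F1 := Rabs_fst_le_Cmod (u, v)). assert (F2 := Rabs_snd_le_Cmod (u, v)). simpl in *.
      assert (Ar := Rle_abs r).
      destruct S as [-> |[-> |[S | ->]]].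
      * rewrite Rabs_Ropp, Rabs_pos_eq in F1; lra.
      * rewrite Rabs_pos_eq in F1; lra.
      * now destruct Nw.
      * rewrite Rabs_pos_eq in F2; lra.
    + apply Rmult_le_compat_l; auto. apply exp_le.
      rewrite (Rmult_comm 2 L), Rmult_assoc. apply Rmult_le_compat_l; auto.
      eapply Rle_trans; [apply Cmod_le_parts|]. simpl.
      assert (Rabs u <= X) by (apply Rabs_le; lra). assert (Rabs v <= X) by (apply Rabs_le; lra). lra.
  - simpl. apply Rmult_le_compat_l; auto. apply exp_le.
    assert (0 <= y * y / X) by (apply Rmult_le_pos; [nra|left; now apply Rinv_0_lt_compat]).
    replace (2 * L * ((x * (x * 1) - y * (y * 1)) / X + 2 * y))
      with (2 * L * (x * (x * 1)) / X + 4 * L * y - 2 * L * (y * y / X)) by (field; lra).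
    assert (0 <= L * (y * y / X)) by (now apply Rmult_le_pos). lra.
Qed.

(** The barrier is [K x y / X] on the square [[0,X] x [0,X]]. It equals [K y] on the
    right side and [K x] on the top side, and tends to [0] as [X] grows. *)
Lemma quadrant_bound (G : C -> C) (m K : R) (z : C) :
  (forall z, cdiff G z) -> 0 <= m -> 0 <= K ->
  (forall t, 0 <= t -> Cmod (G (t, 0)) <= m) ->
  (forall t, 0 <= t -> Cmod (G (0, t)) <= m) ->
  (exists r, forall X t, r <= X -> 0 <= t <= X ->
     Cmod (G (X, t)) <= m * exp (K * t) /\ Cmod (G (t, X)) <= m * exp (K * t)) ->
  0 <= Re z -> 0 <= Im z -> Cmod (G z) <= m.
Proof.
  intros HG Hm HK Hh Hv [r Hr] Hx Hy. destruct z as [x y]. simpl in Hx, Hy.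
  destruct (Req_dec x 0) as [-> |Nx]; [now apply Hv|].
  destruct (Req_dec y 0) as [-> |Ny]; [now apply Hh|].
  rewrite <- (Rmult_1_r m), <- exp_0.
  apply le_of_exp_limit with (K * x * y); auto using Cmod_ge_0.
  { repeat apply Rmult_le_pos; auto. }
  exists (Rmax (Rabs r) (Rmax x y)). intros X HX.
  assert (X1 := Rmax_l (Rabs r) (Rmax x y)). assert (X2 := Rmax_r (Rabs r) (Rmax x y)).
  assert (X3 := Rmax_l x y). assert (X4 := Rmax_r x y). assert (Ar := Rle_abs r).
  assert (E : forall z, Re (RtoC (- K / (2 * X)) * Ci * (z * z))%C = K * Re z * Im z / X + 0).
  { intros [u v]. simpl. field. lra. }
  change x with (Re (x, y)) at 2. change y with (Im (x, y)) at 3. rewrite <- E.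
  apply (maximum_modulus_barrier G (fun z => RtoC (- K / (2 * X)) * Ci * (z * z))%C 0 X 0 X);
    [simpl; lra|simpl; lra|auto|auto| |].
  - intros w. apply cdiff_mult; [apply cdiff_const|]. apply cdiff_mult; apply cdiff_id.
  - intros [u v] [[R1 R2] S]. rewrite E, Rplus_0_r. simpl in *.
    destruct S as [-> |[-> |[-> | ->]]].
    + rewrite Rmult_0_r, Rmult_0_l. unfold Rdiv. rewrite Rmult_0_l, exp_0, Rmult_1_r. apply Hv; lra.
    + replace (K * X * v / X) with (K * v) by (field; lra). apply Hr; lra.
    + rewrite Rmult_0_r. unfold Rdiv. rewrite Rmult_0_l, exp_0, Rmult_1_r. apply Hh; lra.
    + replace (K * u * X / X) with (K * u) by (field; lra). apply Hr; lra.
Qed.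

Definition exp_type (F : C -> C) (gamma : R) : Prop :=
  forall eps, 0 < eps -> exists K r, forall z, r <= Cmod z ->
    Cmod (F z) <= K * exp ((gamma + eps) * Cmod z).

(** For [g > gamma], multiplying [F] by [exp (i g z)] makes it bounded on the
    imaginary half-axis, hence on both quadrants by [quadrant_bound], hence by [M]
    on the half-plane by [half_plane_box] with a growth rate of order [1 / X]. *)
Lemma upper_half_plane_type (F : C -> C) (M gamma : R) (z : C) :
  0 < M -> 0 <= gamma -> (forall z, cdiff F z) -> exp_type F gamma ->
  (forall t : R, Cmod (F t) <= M) -> 0 <= Im z ->
  Cmod (F z) <= M * exp (gamma * Im z).
Proof.
  intros HM Hg HF HT Hb Hz.
  assert (Main : forall eps, 0 < eps -> Cmod (F z) <= M * exp ((gamma + eps) * Im z)).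
  { intros eps He. set (g := gamma + eps). assert (Hgg : 0 < g) by (unfold g; lra).
    destruct (HT eps He) as [K0 [r0 HK0]]. fold g in HK0.
    set (K := Rabs K0 + M). set (r := Rabs r0).
    assert (Ar := Rle_abs r0). assert (AK := Rle_abs K0).
    assert (Pr : 0 <= r) by apply Rabs_pos. assert (PK : M <= K) by (unfold K; assert (Q := Rabs_pos K0); lra).
    assert (HK : forall w, r <= Cmod w -> Cmod (F w) <= K * exp (g * Cmod w)).
    { intros w Hw. eapply Rle_trans; [apply HK0; unfold r in Hw; lra|].
      apply Rmult_le_compat_r; [left; apply exp_pos|unfold K; lra]. }
    assert (S1 : forall w, 0 <= Im w -> Cmod (F w) <= K * exp (4 * g * Im w)).
    { intros w Hw. apply half_plane_bound with r; auto; try lra.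
      intros t. eapply Rle_trans; [apply Hb|lra]. }
    set (G := fun w => (F w * cexp (Ci * RtoC g * w))%C).
    assert (HG : forall w, cdiff G w).
    { intros w. apply cdiff_mult; auto. apply cdiff_cexp_scal. }
    assert (MG : forall w, Cmod (G w) = Cmod (F w) * exp (- (g * Im w))).
    { intros [u v]. unfold G. rewrite Cmod_mult, Cmod_cexp. f_equal. f_equal. simpl. ring. }
    (* [K] alone bounds [G] on the imaginary axis above height [r] only *)
    set (m := K * exp (4 * g * r)).
    assert (Pm : K <= m).
    { unfold m. rewrite <- (Rmult_1_r K) at 1. apply Rmult_le_compat_l; [lra|].
      rewrite <- exp_0. apply exp_le. repeat apply Rmult_le_pos; lra. }
    (* as [|w| <= |Re w| + Im w], the factor [exp (- g Im w)] leaves growth in [Re w] only *)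
    assert (Far : forall w, r <= Cmod w -> 0 <= Im w -> Cmod (G w) <= m * exp (4 * g * Rabs (Re w))).
    { intros w Hw Iw. rewrite MG.
      apply Rle_trans with (K * exp (g * Cmod w) * exp (- (g * Im w))).
      - apply Rmult_le_compat_r; [left; apply exp_pos|auto].
      - rewrite Rmult_assoc, <- exp_plus. apply Rmult_le_compat; auto; try lra.
        + left; apply exp_pos.
        + apply exp_le. assert (Q := Cmod_le_parts w).
          assert (Rabs (snd w) = Im w) by (apply Rabs_pos_eq; auto).
          fold (Re w) in Q. assert (P := Rabs_pos (Re w)). nra. }
    assert (Near : forall w, 0 <= Im w -> Cmod (G w) <= m * exp (4 * g * Im w)).
    { intros w Iw. rewrite MG. apply Rle_trans with (Cmod (F w) * 1).
      - apply Rmult_le_compat_l; [apply Cmod_ge_0|]. rewrite <- exp_0. apply exp_le. nra.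
      - rewrite Rmult_1_r. eapply Rle_trans; [apply S1; auto|].
        apply Rmult_le_compat_r; [left; apply exp_pos|auto]. }
    assert (Real : forall t, Cmod (G (t, 0)) <= M).
    { intros t. rewrite MG. simpl. rewrite Rmult_0_r, Ropp_0, exp_0, Rmult_1_r. apply Hb. }
    assert (Imag : forall t, 0 <= t -> Cmod (G (0, t)) <= m).
    { intros t Ht. destruct (Rle_dec r t) as [L|L].
      - rewrite <- (Rmult_1_r m). replace 1 with (exp (4 * g * Rabs (Re (0, t)))).
        + apply Far; auto. eapply Rle_trans; [exact L|].
          assert (Q := Rabs_snd_le_Cmod (0, t)). simpl in Q. assert (Q' := Rle_abs t). lra.
        + simpl. rewrite Rabs_R0, Rmult_0_r. apply exp_0.
      - rewrite MG. simpl. apply Rle_trans with (Cmod (F (0, t)) * 1).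
        + apply Rmult_le_compat_l; [apply Cmod_ge_0|]. rewrite <- exp_0. apply exp_le. nra.
        + rewrite Rmult_1_r. eapply Rle_trans; [apply S1; simpl; auto|].
          unfold m. apply Rmult_le_compat_l; [lra|]. apply exp_le. simpl.
          apply Rmult_le_compat_l; lra. }
    assert (Bounded : forall w, 0 <= Im w -> Cmod (G w) <= m).
    { intros w Iw. destruct (Rle_dec 0 (Re w)) as [Pos|Neg].
      - apply quadrant_bound with (4 * g); auto; try lra.
        + intros t _. specialize (Real t). lra.
        + exists r. intros X t HX Ht. split.
          * apply (Near (X, t)). simpl. lra.
          * rewrite <- (Rabs_pos_eq t) at 2 by lra. apply (Far (t, X)); simpl; [|lra].
            assert (Q := Rabs_snd_le_Cmod (t, X)). simpl in Q. assert (Q' := Rle_abs X). lra.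
      (* the second quadrant is the first one rotated *)
      - replace w with (Ci * (- Ci * w))%C by (destruct w; apply injective_projections; simpl; ring).
        apply (quadrant_bound (fun w => G (Ci * w)%C) m (4 * g)); try lra.
        + intros u. apply cdiff_comp; auto. apply cdiff_mult; [apply cdiff_const|apply cdiff_id].
        + intros t Ht. replace (Ci * (t, 0))%C with ((0, t) : C) by (apply injective_projections; simpl; ring).
          auto.
        + intros t Ht. replace (Ci * (0, t))%C with ((- t, 0) : C) by (apply injective_projections; simpl; ring).
          specialize (Real (- t)). lra.
        + exists r. intros X t HX Ht. 
          replace (Ci * (X, t))%C with ((- t, X) : C) by (apply injective_projections; simpl; ring).
          replace (Ci * (t, X))%C with ((- X, t) : C) by (apply injective_projections; simpl; ring).
          split.
          * replace (4 * g * t) with (4 * g * Rabs (- t)) by (rewrite Rabs_Ropp, Rabs_pos_eq; lra).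
            apply (Far (- t, X)); simpl; [|lra].
            assert (Q := Rabs_snd_le_Cmod (- t, X)). simpl in Q. assert (Q' := Rle_abs X). lra.
          * apply (Near (- X, t)). simpl. lra.
        + destruct w as [u v]. simpl in *. lra.
        + destruct w as [u v]. simpl in *. lra. }
    assert (Q : Cmod (G z) <= M * exp 0).
    { destruct z as [x y]. simpl in Hz.
      destruct (Req_dec y 0) as [-> |Ny]; [rewrite exp_0; specialize (Real x); lra|].
      set (l := ln (m / M)).
      assert (El : M * exp l = m).
      { unfold l. rewrite exp_ln; [field; lra|]. apply Rdiv_lt_0_compat; lra. }
      assert (Pl : 0 <= l).
      { apply Rnot_lt_le. intros Nl. apply exp_increasing in Nl. rewrite exp_0 in Nl. nra. }
      apply le_of_exp_limit with (l * (x^2 + 2 * y)); auto using Cmod_ge_0; try lra.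
      { apply Rmult_le_pos; auto. assert (T := pow2_ge_0 x). lra. }
      exists (Rmax 1 (Rmax (Rabs x) (Rabs y))). intros X HX.
      assert (X1 := Rmax_l 1 (Rmax (Rabs x) (Rabs y))).
      assert (X2 := Rmax_r 1 (Rmax (Rabs x) (Rabs y))).
      assert (X3 := Rmax_l (Rabs x) (Rabs y)). assert (X4 := Rmax_r (Rabs x) (Rabs y)).
      assert (Ax : - X < x < X) by (apply Rabs_lt_between; lra).
      assert (Ay : - X < y < X) by (apply Rabs_lt_between; lra).
      eapply Rle_trans.
      - apply (half_plane_box G M (l / X) X (x, y)); simpl; auto; try lra.
        + apply Rmult_le_pos; auto. left. apply Rinv_0_lt_compat. lra.
        + intros w [[R1 R2] _] _. replace (l / X * X) with l by (field; lra).
          rewrite El. apply Bounded. lra.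
      - simpl. apply Rmult_le_compat_l; [lra|]. apply exp_le. rewrite Rplus_0_r.
        replace (l / X * ((x * (x * 1) - y * (y * 1)) / X + 2 * y))
          with (l * ((x * x - y * y) / X + 2 * y) / X) by (field; lra).
        apply Rmult_le_compat_r; [left; apply Rinv_0_lt_compat; lra|].
        apply Rmult_le_compat_l; auto.
        assert ((x * x - y * y) / X <= x * x); [|lra].
        apply Rmult_le_reg_r with X; [lra|].
        replace ((x * x - y * y) / X * X) with (x * x - y * y) by (field; lra). nra. }
    rewrite exp_0, MG in Q.
    apply Rmult_le_compat_r with (r := exp (g * Im z)) in Q; [|left; apply exp_pos].
    rewrite Rmult_assoc, <- exp_plus, Rplus_opp_l, exp_0 in Q. lra. }
  apply le_of_exp_limit with (Im z); auto using Cmod_ge_0; try lra.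
  exists 0. intros X HX. 
  replace (Im z / X + gamma * Im z) with ((gamma + / X) * Im z) by (field; lra).
  apply Main. now apply Rinv_0_lt_compat.
Qed.

Theorem phragmen_lindelof (F : C -> C) (M gamma : R) (z : C) :
  0 <= gamma -> (forall z, cdiff F z) -> exp_type F gamma ->
  (forall t : R, Cmod (F t) <= M) ->
  Cmod (F z) <= M * exp (gamma * Rabs (Im z)).
Proof.
  intros Hg HF HT Hb.
  assert (HM : 0 <= M) by (eapply Rle_trans; [apply Cmod_ge_0|apply (Hb 0)]).
  assert (Main : forall M', M < M' -> Cmod (F z) <= M' * exp (gamma * Rabs (Im z))).
  { intros M' HM'.
    destruct (Rle_dec 0 (Im z)) as [Pos|Neg].
    - rewrite Rabs_pos_eq by auto. apply upper_half_plane_type; auto; try lra.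
      intros t. specialize (Hb t). lra.
    - rewrite Rabs_left by lra. replace z with (- (- z))%C at 1 by ring.
      apply (upper_half_plane_type (fun w => F (- w)%C) M' gamma (- z)%C); auto; try lra.
      + intros w. apply cdiff_comp; auto. apply cdiff_opp, cdiff_id.
      + intros eps He. destruct (HT eps He) as [K [r H]]. exists K, r. intros w Hw.
        rewrite <- (Cmod_opp w). apply H. now rewrite Cmod_opp.
      + intros t. rewrite <- RtoC_opp. specialize (Hb (- t)). lra.
      + simpl. unfold Im in Neg. lra. }
  apply Rnot_lt_le. intros N.
  assert (P := exp_pos (gamma * Rabs (Im z))). set (e := exp (gamma * Rabs (Im z))) in *.
  specialize (Main ((M + Cmod (F z) / e) / 2)).
  assert (Q : M < Cmod (F z) / e).
  { apply Rmult_lt_reg_r with e; auto. unfold Rdiv. rewrite Rmult_assoc, Rinv_l; lra. }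
  specialize (Main ltac:(lra)).
  replace ((M + Cmod (F z) / e) / 2 * e) with ((M * e + Cmod (F z)) / 2) in Main by (field; lra).
  lra.
Qed.

(** * Interpolation at the zeros of the cosine *)

Definition node (k : nat) : R := PI / 2 + INR k * PI.

(** The zeros of [cos] of modulus less than [n pi]. *)
Fixpoint nodes (n : nat) : list R :=
  match n with O => nil | S n => node n :: - node n :: nodes n end.

(** Since [cos' p = - sin p] and [sin p = + or - 1], this is minus the principal
    part of [G z / (z cos z)] at the zero [p] of [cos]. *)
Definition pole_term (G : C -> C) (p : R) (z : C) : C :=
  (G p * RtoC (sin p) / (RtoC p * (z - RtoC p)))%C.

Fixpoint pole_sum (G : C -> C) (L : list R) (z : C) : C :=
  match L with nil => 0%C | p :: L => (pole_term G p z + pole_sum G L z)%C end.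

Definition remainder (G : C -> C) (n : nat) (z : C) : C :=
  (G z / z / ccos z + pole_sum G (nodes n) z)%C.

Lemma PI_gt_2 : 2 < PI.
Proof. assert (H := PI2_1). lra. Qed.

Lemma sin_sqr_of_cos_0 (p : R) : cos p = 0 -> sin p * sin p = 1.
Proof. intros H. assert (S := sin2_cos2 p). rewrite H in S. unfold Rsqr in S. lra. Qed.

Lemma abs_sin_of_cos_0 (p : R) : cos p = 0 -> Rabs (sin p) = 1.
Proof.
  intros H. assert (S2 := sin_sqr_of_cos_0 p H).
  assert (Q0 := pow2_abs (sin p)). assert (Q1 := Rabs_pos (sin p)). nra.
Qed.

Lemma cos_node (k : nat) : cos (node k) = 0.
Proof.
  unfold node. induction k as [|k IH].
  - simpl. rewrite Rmult_0_l, Rplus_0_r. apply cos_PI2.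
  - rewrite S_INR. replace (PI / 2 + (INR k + 1) * PI) with (PI / 2 + INR k * PI + PI) by ring.
    rewrite neg_cos, IH. ring.
Qed.

Lemma nodes_spec (n : nat) (p : R) :
  In p (nodes n) -> cos p = 0 /\ PI / 2 <= Rabs p < INR n * PI.
Proof.
  assert (HP := PI_gt_2).
  induction n as [|n IH]; cbn [nodes In]; [tauto|]. rewrite S_INR.
  assert (A : Rabs (node n) = node n).
  { apply Rabs_pos_eq. unfold node. assert (H := pos_INR n). nra. }
  assert (Hn := pos_INR n).
  intros [<- |[<- |H]].
  - rewrite A. split; [apply cos_node|]. unfold node. nra.
  - rewrite Rabs_Ropp, A, cos_neg. split; [apply cos_node|]. unfold node. nra.
  - destruct (IH H) as [H1 H2]. split; auto. lra.
Qed.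

Lemma nodes_complete (n : nat) (x : R) : cos x = 0 -> Rabs x <= INR n * PI -> In x (nodes n).
Proof.
  assert (HP := PI_gt_2). intros Hc.
  destruct (cos_eq_0_0 x Hc) as [k Hk].
  induction n as [|n IH].
  - simpl. rewrite Rmult_0_l. intros H. exfalso.
    assert (E : x = 0) by (apply Rabs_eq_0; assert (Q := Rabs_pos x); lra).
    rewrite E, cos_0 in Hc. lra.
  - intros H. cbn [nodes In]. destruct (Rle_dec (Rabs x) (INR n * PI)) as [L|L]; auto.
    rewrite S_INR in H. apply Rnot_le_lt in L. unfold node.
    destruct (Rle_dec 0 x) as [Px|Nx].
    + rewrite Rabs_pos_eq in H, L by auto. left. rewrite Hk.
      assert (E : k = Z.of_nat n).
      { rewrite INR_IZR_INZ in H, L.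
        assert (IZR (Z.of_nat n) - 1 < IZR k) by (apply Rmult_lt_reg_r with PI; lra).
        assert (IZR k < IZR (Z.of_nat n) + 1) by (apply Rmult_lt_reg_r with PI; lra).
        rewrite <- minus_IZR in H0. rewrite <- plus_IZR in H1.
        apply lt_IZR in H0, H1. lia. }
      rewrite E, <- INR_IZR_INZ. ring.
    + rewrite Rabs_left in H, L by lra. right; left. rewrite Hk.
      assert (E : (k = - Z.of_nat n - 1)%Z).
      { rewrite INR_IZR_INZ in H, L.
        assert (- IZR (Z.of_nat n) - 2 < IZR k) by (apply Rmult_lt_reg_r with PI; lra).
        assert (IZR k < - IZR (Z.of_nat n)) by (apply Rmult_lt_reg_r with PI; lra).
        rewrite <- opp_IZR in H0, H1. rewrite <- minus_IZR in H0.
        apply lt_IZR in H0, H1. lia. }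
      rewrite E, minus_IZR, opp_IZR, <- INR_IZR_INZ. field.
Qed.

Lemma node_ge (k : nat) : INR k + 1 <= node k.
Proof.
  unfold node. assert (HP := PI_gt_2). assert (H := pos_INR k). nra.
Qed.

Lemma nodes_NoDup (n : nat) : NoDup (nodes n).
Proof.
  induction n as [|n IH]; cbn [nodes]; [constructor|].
  assert (HP := PI_gt_2). assert (Hn := node_ge n). assert (H0 := pos_INR n).
  assert (A : Rabs (node n) = node n) by (apply Rabs_pos_eq; lra).
  assert (B0 : INR n * PI <= node n) by (unfold node; lra).
  constructor; [|constructor; auto].
  - cbn [In]. intros [E|H]; [lra|]. destruct (nodes_spec n _ H). lra.
  - intros H. destruct (nodes_spec n _ H) as [_ Q]. rewrite Rabs_Ropp in Q. lra.
Qed.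

Lemma bounded_near_plus (f g : C -> C) (p : C) :
  bounded_near f p -> bounded_near g p -> bounded_near (fun z => f z + g z)%C p.
Proof.
  intros [K1 [d1 [Hd1 H1]]] [K2 [d2 [Hd2 H2]]].
  exists (K1 + K2), (Rmin d1 d2). split; [now apply Rmin_glb_lt|].
  intros z N Hz. eapply Rle_trans; [apply Cmod_triangle|].
  apply Rplus_le_compat; [apply H1|apply H2]; auto; eapply Rlt_le_trans; eauto;
    [apply Rmin_l|apply Rmin_r].
Qed.

Lemma ccont_bounded_near (f : C -> C) (p : C) : ccont f p -> bounded_near f p.
Proof.
  intros H. destruct (ccont_bounded f p H) as [d [Hd H']].
  exists (Cmod (f p) + 1), d. split; auto.
Qed.

Lemma RtoC_neq (x y : R) : x <> y -> RtoC x <> RtoC y.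
Proof. intros N E. apply N. now inversion E. Qed.

Lemma cdiff_pole_term (G : C -> C) (p : R) (z : C) :
  p <> 0 -> z <> RtoC p -> cdiff (pole_term G p) z.
Proof.
  intros Hp Hz. unfold pole_term. apply cdiff_div.
  - apply Cmult_neq_0; [now apply RtoC_neq|now apply Csub_neq_0].
  - apply cdiff_const.
  - apply cdiff_mult; [apply cdiff_const|]. apply cdiff_minus; [apply cdiff_id|apply cdiff_const].
Qed.

Lemma cdiff_pole_sum (G : C -> C) (L : list R) (z : C) :
  (forall p, In p L -> p <> 0 /\ z <> RtoC p) -> cdiff (pole_sum G L) z.
Proof.
  induction L as [|p L IH]; intros H; simpl; [apply cdiff_const|].
  apply cdiff_plus.
  - apply cdiff_pole_term; apply H; now left.
  - apply IH. intros q Hq. apply H. now right.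
Qed.

(** Near [p] one has [cos z = - sin p * sin (z - p)], and [sin w = w + O(w^2)]. *)
Lemma principal_part_bounded (A : C -> C) (p : R) :
  cos p = 0 -> cdiff A p ->
  bounded_near (fun z => A z / ccos z + A p * RtoC (sin p) / (z - RtoC p))%C p.
Proof.
  intros Hc [phi [Hphi E]]. destruct (ccont_bounded phi p Hphi) as [d [Hd Hb]].
  set (B0 := Cmod (phi p) + 1) in *.
  exists (2 * B0 + 8 * Cmod (A p)), (Rmin d (/8)). split; [apply Rmin_glb_lt; lra|].
  intros z N Hz.
  assert (Hz1 := Rlt_le_trans _ _ _ Hz (Rmin_l _ _)).
  assert (Hz2 := Rlt_le_trans _ _ _ Hz (Rmin_r _ _)).
  set (w := (z - RtoC p)%C) in *.
  assert (Hw : w <> 0%C) by now apply Csub_neq_0.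
  assert (Pw : 0 < Cmod w) by now apply Cmod_gt_0.
  assert (Q := csin_quadratic w ltac:(lra)).
  assert (Lw : Cmod w / 2 <= Cmod (csin w)).
  { assert (T := Cmod_sub_ge w (w - csin w)%C).
    replace (w - (w - csin w))%C with (csin w) in T by ring.
    rewrite (Cmod_sub_sym w) in T. nra. }
  assert (Hs : csin w <> 0%C).
  { intros E0. rewrite E0, Cmod_0 in Lw. lra. }
  assert (S2 := sin_sqr_of_cos_0 p Hc).
  assert (S2' : (RtoC (sin p) * RtoC (sin p))%C = RtoC 1) by (rewrite <- RtoC_mult; now f_equal).
  assert (Hsp : RtoC (sin p) <> 0%C).
  { apply RtoC_neq. intros E0. rewrite E0 in S2. lra. }
  replace (ccos z) with (- (RtoC (sin p) * csin w))%C
    by (rewrite <- (ccos_shift w p Hc); f_equal; unfold w; ring).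
  assert (Az : A z = (A p + phi z * w)%C) by apply E.
  assert (S3 : (/ RtoC (sin p) = RtoC (sin p))%C).
  { rewrite <- (Cmult_1_r (/ RtoC (sin p))), <- S2'. field. auto. }
  replace (A z / - (RtoC (sin p) * csin w) + A p * RtoC (sin p) / w)%C
    with (RtoC (sin p) * (A p * ((csin w - w) / (w * csin w)) - phi z * w / csin w))%C.
  - rewrite Cmod_mult, Cmod_R, (abs_sin_of_cos_0 p Hc), Rmult_1_l. eapply Rle_trans; [apply Cmod_triangle_sub|].
    rewrite Rplus_comm. apply Rplus_le_compat.
    + rewrite Cmod_div, Cmod_mult by auto.
      apply Rmult_le_reg_r with (Cmod (csin w)); [lra|].
      unfold Rdiv. rewrite Rmult_assoc, Rinv_l, Rmult_1_r by lra.
      specialize (Hb z Hz1). fold B0 in Hb. assert (PB := Cmod_ge_0 (phi z)). nra.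
    + rewrite Cmod_mult, Rmult_comm. apply Rmult_le_compat_r; [apply Cmod_ge_0|].
      rewrite Cmod_div, Cmod_mult by (now apply Cmult_neq_0).
      apply Rmult_le_reg_r with (Cmod w * Cmod (csin w)); [apply Rmult_lt_0_compat; lra|].
      unfold Rdiv. rewrite Rmult_assoc, Rinv_l, Rmult_1_r by (apply Rgt_not_eq, Rmult_lt_0_compat; lra).
      nra.
  - rewrite Az. unfold Cdiv at 3. 
    replace (/ - (RtoC (sin p) * csin w))%C with (- (RtoC (sin p) * / csin w))%C.
    + field. auto.
    + rewrite <- S3 at 1. field. auto.
Qed.

Lemma pole_sum_bounded (G : C -> C) (L : list R) (p : R) :
  In p L -> NoDup L -> (forall q, In q L -> q <> 0) ->
  bounded_near (fun z => pole_sum G L z - pole_term G p z)%C p.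
Proof.
  induction L as [|q L IH]; [intros []|].
  intros Hp HN H0. inversion HN as [|? ? Nq NL]; subst.
  assert (S0 : forall q, In q L -> q <> 0) by (intros; apply H0; now right).
  destruct Hp as [-> |Hp].
  - destruct (ccont_bounded_near (pole_sum G L) p) as [K [d [Hd H]]].
    + apply cdiff_ccont, cdiff_pole_sum. intros q Hq. split; [auto|].
      apply RtoC_neq. intros ->. contradiction.
    + exists K, d. split; auto. intros z N Hz. simpl.
      replace (pole_term G p z + pole_sum G L z - pole_term G p z)%C with (pole_sum G L z) by ring.
      auto.
  - destruct (bounded_near_plus (pole_term G q) _ p
      (ccont_bounded_near _ _ (cdiff_ccont _ _ (cdiff_pole_term G q p ltac:(apply H0; now left)
         ltac:(apply RtoC_neq; intros ->; contradiction)))) (IH Hp NL S0)) as [K [d [Hd H]]].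
    exists K, d. split; auto. intros z N Hz. simpl.
    replace (pole_term G q z + pole_sum G L z - pole_term G p z)%C
      with (pole_term G q z + (pole_sum G L z - pole_term G p z))%C by ring. auto.
Qed.

Lemma bounded_near_ext (f g : C -> C) (p : C) :
  (forall z, z <> p -> f z = g z) -> bounded_near f p -> bounded_near g p.
Proof.
  intros E [K [d [Hd H]]]. exists K, d. split; auto. intros z N Hz.
  rewrite <- E; auto.
Qed.

Lemma remainder_bounded_at_node (G : C -> C) (n : nat) (p : R) :
  (forall z, cdiff G z) -> In p (nodes n) -> bounded_near (remainder G n) p.
Proof.
  intros HG Hp. destruct (nodes_spec n p Hp) as [Hc Hb].
  assert (HPI := PI_gt_2).
  assert (Np : p <> 0) by (intros ->; rewrite Rabs_R0 in Hb; lra).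
  apply bounded_near_ext with (fun z =>
    (G z / z / ccos z + (G p / RtoC p) * RtoC (sin p) / (z - RtoC p)) +
    (pole_sum G (nodes n) z - pole_term G p z))%C.
  - intros z Nz. unfold remainder.
    assert (E : pole_term G p z = (G p / RtoC p * RtoC (sin p) / (z - RtoC p))%C).
    { unfold pole_term. field. split; [now apply RtoC_neq|now apply Csub_neq_0]. }
    rewrite E. ring.
  - apply bounded_near_plus.
    + apply (principal_part_bounded (fun z => G z / z)%C); auto.
      apply cdiff_div; [now apply RtoC_neq|apply HG|apply cdiff_id].
    + apply pole_sum_bounded; auto; [apply nodes_NoDup|].
      intros q Hq ->. destruct (nodes_spec n 0 Hq) as [_ Q]. rewrite Rabs_R0 in Q. lra.
Qed.

Lemma remainder_bounded_at_0 (G : C -> C) (n : nat) :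
  (forall z, cdiff G z) -> G 0 = 0%C -> bounded_near (remainder G n) 0.
Proof.
  intros HG G0. assert (HPI := PI_gt_2).
  destruct (HG 0%C) as [phi [Hphi E]].
  apply bounded_near_ext with (fun z => phi z / ccos z + pole_sum G (nodes n) z)%C.
  - intros z Nz. unfold remainder. rewrite (E z), G0. f_equal. f_equal.
    field. auto.
  - apply ccont_bounded_near. apply ccont_plus.
    + apply ccont_mult; auto. apply ccont_comp with (f := Cinv).
      * apply ccont_inv. rewrite ccos_RtoC, cos_0. apply C1_nz.
      * apply cdiff_ccont, cdiff_ccos.
    + apply cdiff_ccont, cdiff_pole_sum. intros q Hq.
      destruct (nodes_spec n q Hq) as [_ Q].
      assert (q <> 0) by (intros ->; rewrite Rabs_R0 in Q; lra).
      split; auto. apply RtoC_neq. auto.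
Qed.

(** Telescopes to a bound of order [sqrt N] for the harmonic sums that occur in
    [pole_sum_far]. *)
Lemma inv_le_sqrt_diff (j : R) : 1 <= j -> / j <= 2 * (sqrt j - sqrt (j - 1)).
Proof.
  intros Hj. set (u := sqrt j). set (v := sqrt (j - 1)).
  assert (Hu : u * u = j) by (apply sqrt_sqrt; lra).
  assert (Hv : v * v = j - 1) by (apply sqrt_sqrt; lra).
  assert (Pu : 0 <= u) by apply sqrt_pos. assert (Pv : 0 <= v) by apply sqrt_pos.
  assert (u1 : 1 <= u) by nra. assert (vu : v <= u) by nra.
  apply Rmult_le_reg_r with j; [lra|]. rewrite Rinv_l by lra. nra.
Qed.

(** On the boundary of the square of half-side [N pi] the [k]-th pair of terms is
    at most [2 M / ((k + 1) (N - k))], that is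
    [2 M (1 / (k + 1) + 1 / (N - k)) / (N + 1)]. The bound for general [n <= N] is
    the form in which the induction telescopes; at [n = N] it is
    [O(1 / sqrt N)]. *)
Lemma pole_sum_far (G : C -> C) (M : R) (N n : nat) (z : C) :
  0 <= M -> (forall t : R, Cmod (G t) <= M) -> (n <= N)%nat ->
  (forall p : R, Rabs p < INR N * PI -> INR N * PI - Rabs p <= Cmod (z - RtoC p)) ->
  Cmod (pole_sum G (nodes n) z) <=
  4 * M * (sqrt (INR n) + sqrt (INR N) - sqrt (INR N - INR n)) / (INR N + 1).
Proof.
  intros HM HG Hn Hz. induction n as [|n IH].
  - simpl. rewrite Cmod_0, sqrt_0, Rminus_0_r. right. field. assert (H := pos_INR N). lra.
  - assert (IH' := IH ltac:(lia)). clear IH.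
    assert (HPI := PI_gt_2). assert (Hn0 := pos_INR n).
    assert (HnN : INR n + 1 <= INR N) by (rewrite <- S_INR; apply le_INR; lia).
    assert (Hk := node_ge n).
    assert (Hd : INR N - INR n <= INR N * PI - node n) by (unfold node; nra).
    assert (T : forall p, Rabs p = node n -> cos p = 0 ->
      Cmod (pole_term G p z) <= M * (/ (INR n + 1) + / (INR N - INR n)) / (INR N + 1)).
    { intros p Hp S2. unfold pole_term.
      assert (Far := Hz p ltac:(lra)). rewrite Hp in Far.
      assert (Np : (RtoC p * (z - RtoC p))%C <> 0%C).
      { apply Cmult_neq_0.
        - apply RtoC_neq. intros ->. rewrite Rabs_R0 in Hp. lra.
        - intros E0. rewrite E0, Cmod_0 in Far. lra. }
      rewrite Cmod_div, !Cmod_mult, !Cmod_R, Hp by auto.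
      rewrite (abs_sin_of_cos_0 p S2), Rmult_1_r.
      replace (M * (/ (INR n + 1) + / (INR N - INR n)) / (INR N + 1))
        with (M * / ((INR n + 1) * (INR N - INR n))) by (field; lra).
      unfold Rdiv. apply Rmult_le_compat; auto using Cmod_ge_0.
      - left. apply Rinv_0_lt_compat. apply Rmult_lt_0_compat; lra.
      - apply Rinv_le_contravar; [apply Rmult_lt_0_compat; lra|].
        apply Rmult_le_compat; lra. }
    assert (T1 := T (node n) ltac:(apply Rabs_pos_eq; lra) (cos_node n)).
    assert (T2 := T (- node n) ltac:(rewrite Rabs_Ropp; apply Rabs_pos_eq; lra)
      ltac:(rewrite cos_neg; apply cos_node)).
    cbn [nodes pole_sum].
    assert (Tr : Cmod (pole_term G (node n) z + (pole_term G (- node n) z + pole_sum G (nodes n) z))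
      <= Cmod (pole_term G (node n) z) + (Cmod (pole_term G (- node n) z) + Cmod (pole_sum G (nodes n) z))).
    { eapply Rle_trans; [apply Cmod_triangle|]. apply Rplus_le_compat_l, Cmod_triangle. }
    assert (I1 := inv_le_sqrt_diff (INR n + 1) ltac:(lra)).
    assert (I2 := inv_le_sqrt_diff (INR N - INR n) ltac:(lra)).
    replace (INR n + 1 - 1) with (INR n) in I1 by ring.
    rewrite S_INR. replace (INR N - (INR n + 1)) with (INR N - INR n - 1) by ring.
    eapply Rle_trans; [exact Tr|].
    set (e := M * (/ (INR n + 1) + / (INR N - INR n)) / (INR N + 1)) in *.
    apply Rle_trans with (2 * e +
      4 * M * (sqrt (INR n) + sqrt (INR N) - sqrt (INR N - INR n)) / (INR N + 1)); [lra|].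
    unfold e.
    replace (2 * (M * (/ (INR n + 1) + / (INR N - INR n)) / (INR N + 1)) +
      4 * M * (sqrt (INR n) + sqrt (INR N) - sqrt (INR N - INR n)) / (INR N + 1))
      with ((2 * (/ (INR n + 1) + / (INR N - INR n)) +
       4 * (sqrt (INR n) + sqrt (INR N) - sqrt (INR N - INR n))) * (M / (INR N + 1))) by (field; lra).
    replace (4 * M * (sqrt (INR n + 1) + sqrt (INR N) - sqrt (INR N - INR n - 1)) / (INR N + 1))
      with (4 * (sqrt (INR n + 1) + sqrt (INR N) - sqrt (INR N - INR n - 1)) * (M / (INR N + 1)))
      by (field; lra).
    apply Rmult_le_compat_r; [|lra].
    apply Rmult_le_pos; auto. left. apply Rinv_0_lt_compat. lra.
Qed.

(** The growth that [phragmen_lindelof] provides for functions of exponential type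
    [1] bounded by [M] on the real line. *)
Definition strip_type1 (G : C -> C) (M : R) : Prop :=
  (forall z, cdiff G z) /\ (forall z, Cmod (G z) <= M * exp (Rabs (Im z))).

Lemma strip_type1_real (G : C -> C) (M t : R) : strip_type1 G M -> Cmod (G t) <= M.
Proof.
  intros [_ H]. specialize (H t). simpl in H. rewrite Rabs_R0, exp_0 in H. lra.
Qed.

Lemma strip_type1_nonneg (G : C -> C) (M : R) : strip_type1 G M -> 0 <= M.
Proof. intros H. eapply Rle_trans; [apply Cmod_ge_0|apply (strip_type1_real G M 0 H)]. Qed.

Lemma abs_cos_INR_PI (N : nat) (x : R) : Rabs x = INR N * PI -> Rabs (cos x) = 1.
Proof.
  intros H.
  assert (S : sin x = 0).
  { assert (E : sin (INR N * PI) = 0).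
    { apply sin_eq_0_1. exists (Z.of_nat N). now rewrite INR_IZR_INZ. }
    rewrite <- H in E. unfold Rabs in E. destruct (Rcase_abs x); auto.
    rewrite sin_neg in E. lra. }
  assert (T := sin2_cos2 x). rewrite S in T. unfold Rsqr in T.
  assert (Q0 := pow2_abs (cos x)). assert (Q1 := Rabs_pos (cos x)). nra.
Qed.

(** On the boundary of the square of half-side [N pi] the growth of [G] is
    absorbed by [cos], the factor [1 / z] and [pole_sum_far] make both parts of the
    remainder small, and the remainder has only removable singularities
    inside. *)
Theorem interpolation (G : C -> C) (M : R) (N : nat) (x : R) :
  strip_type1 G M -> G 0 = 0%C -> (0 < N)%nat ->
  Rabs x < INR N * PI -> x <> 0 -> cos x <> 0 ->
  Cmod (remainder G N x) <= 12 * M / sqrt (INR N).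
Proof.
  intros HG G0 HN Hx Nx Ncx. assert (HM := strip_type1_nonneg G M HG).
  assert (HR := fun t => strip_type1_real G M t HG). destruct HG as [HD HB].
  assert (HPI := PI_gt_2).
  assert (HN1 : 1 <= INR N) by (apply (le_INR 1); lia).
  set (X := INR N * PI) in *. assert (HX : 2 < X) by (unfold X; nra).
  assert (Ps : 0 < sqrt (INR N)) by (apply sqrt_lt_R0; lra).
  assert (Ns : forall p, In p (nodes N) -> p <> 0).
  { intros p Hp ->. destruct (nodes_spec N 0 Hp) as [_ Q]. rewrite Rabs_R0 in Q. lra. }
  assert (InP : forall z, In z (map RtoC (0 :: nodes N)) <-> z = RtoC 0 \/ exists p, In p (nodes N) /\ z = RtoC p).
  { intros z. rewrite in_map_iff. split.
    - intros [p [<- [<- |Hp]]]; eauto.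
    - intros [-> |[p [Hp ->]]]; eexists; split; eauto; [now left|now right]. }
  apply (maximum_modulus (remainder G N) (map RtoC (0 :: nodes N)) (- X) X (- X) X).
  - simpl. now apply Rabs_lt_between.
  - simpl. lra.
  - rewrite InP. intros [E|[p [Hp E]]].
    + apply Nx. now inversion E.
    + apply Ncx. inversion E. subst. now apply nodes_spec in Hp.
  - intros z [R1 R2] Hz. rewrite InP in Hz. unfold remainder. apply cdiff_plus.
    + apply cdiff_div; [|apply cdiff_div; [|apply HD|apply cdiff_id]|apply cdiff_ccos].
      * intros E. destruct (ccos_eq_0 z E) as [E1 E2]. apply Hz. right.
        exists (Re z). split.
        -- apply nodes_complete; auto. apply Rabs_le. exact R1.
        -- destruct z as [u v]. simpl in *. now rewrite E2.
      * intros ->. apply Hz. now left.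
    + apply cdiff_pole_sum. intros p Hp. split; auto. intros ->. apply Hz. right. now exists p.
  - intros z Hz. rewrite InP in Hz. destruct Hz as [-> |[p [Hp ->]]].
    + now apply remainder_bounded_at_0.
    + now apply remainder_bounded_at_node.
  - intros z [[R1 R2] Ez] _.
    assert (Hbig : X <= Cmod z /\ exp (Rabs (Im z)) / 4 <= Cmod (ccos z) /\
      (forall p : R, Rabs p < X -> X - Rabs p <= Cmod (z - RtoC p))).
    { assert (F1 := Rabs_fst_le_Cmod z). assert (F2 := Rabs_snd_le_Cmod z).
      assert (Pe := exp_pos (Rabs (Im z))).
      assert (Cases : Rabs (Re z) = X \/ Rabs (Im z) = X).
      { destruct Ez as [-> |[-> |[-> | ->]]]; rewrite ?Rabs_Ropp, (Rabs_pos_eq X) by lra; auto. }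
      destruct Cases as [E|E].
      - split; [unfold Re in E; lra|]. split.
        + assert (Q := Cmod_ccos_ge_vert z (abs_cos_INR_PI N _ E)). lra.
        + intros p Hp. eapply Rle_trans; [|apply Rabs_fst_le_Cmod]. simpl.
          fold (Re z). rewrite <- E.
          assert (T := Rabs_triang (Re z + - p) p).
          replace (Re z + - p + p) with (Re z) in T by ring. lra.
      - split; [unfold Im in E; lra|]. split.
        + apply Cmod_ccos_ge_horiz. lra.
        + intros p Hp. eapply Rle_trans; [|apply Rabs_snd_le_Cmod]. simpl.
          fold (Im z). rewrite <- E. rewrite Ropp_0, Rplus_0_r. assert (Q := Rabs_pos p). lra. }
    destruct Hbig as [Zbig [Cbig Far]].
    assert (Pe := exp_pos (Rabs (Im z))).
    assert (S1 := pole_sum_far G M N N z HM HR (le_n N) Far).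
    rewrite Rminus_diag, sqrt_0, Rminus_0_r in S1.
    assert (Zn : z <> 0%C) by (intros ->; rewrite Cmod_0 in Zbig; lra).
    assert (Cn : ccos z <> 0%C) by (intros E; rewrite E, Cmod_0 in Cbig; lra).
    assert (S0 : Cmod (G z / z / ccos z) <= 4 * M / X).
    { rewrite !Cmod_div by auto.
      apply Rmult_le_reg_r with (Cmod z * Cmod (ccos z)); [apply Rmult_lt_0_compat; lra|].
      replace (Cmod (G z) / Cmod z / Cmod (ccos z) * (Cmod z * Cmod (ccos z)))
        with (Cmod (G z)) by (field; split; lra).
      eapply Rle_trans; [apply HB|].
      apply Rle_trans with (4 * M / X * (X * (exp (Rabs (Im z)) / 4))).
      - right. field. lra.
      - apply Rmult_le_compat_l.
        + apply Rmult_le_pos; [lra|]. left. apply Rinv_0_lt_compat. lra.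
        + apply Rmult_le_compat; lra. }
    unfold remainder. eapply Rle_trans; [apply Cmod_triangle|].
    assert (Ss : sqrt (INR N) * sqrt (INR N) = INR N) by (apply sqrt_sqrt; lra).
    assert (H1 : 4 * M / X <= 4 * M / sqrt (INR N)).
    { apply Rmult_le_compat_l; [lra|]. apply Rinv_le_contravar; auto.
      assert (1 <= sqrt (INR N)) by nra. assert (sqrt (INR N) <= INR N) by nra.
      unfold X. nra. }
    assert (H2 : 4 * M * (sqrt (INR N) + sqrt (INR N)) / (INR N + 1) <= 8 * M / sqrt (INR N)).
    { apply Rmult_le_reg_r with (sqrt (INR N) * (INR N + 1)); [apply Rmult_lt_0_compat; lra|].
      replace (4 * M * (sqrt (INR N) + sqrt (INR N)) / (INR N + 1) * (sqrt (INR N) * (INR N + 1)))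
        with (8 * M * (sqrt (INR N) * sqrt (INR N))) by (field; lra).
      replace (8 * M / sqrt (INR N) * (sqrt (INR N) * (INR N + 1)))
        with (8 * M * (INR N + 1)) by (field; lra).
      rewrite Ss. nra. }
    replace (12 * M / sqrt (INR N)) with (4 * M / sqrt (INR N) + 8 * M / sqrt (INR N)) by (field; lra).
    lra.
  - apply Rmult_le_pos; [lra|]. left. now apply Rinv_0_lt_compat.
Qed.

(** * Comparison with the sine, and rigidity *)

Lemma le_of_inv_sqrt_limit (A B0 K : R) (N0 : nat) :
  0 <= K -> (forall N, (N0 < N)%nat -> A <= B0 + K / sqrt (INR N)) -> A <= B0.
Proof.
  intros HK H. apply Rnot_lt_le. intros Hlt.
  set (e := A - B0). assert (He : 0 < e) by (unfold e; lra).
  destruct (INR_unbounded ((K / e)^2 + INR N0)) as [N HN].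
  assert (Q := pow2_ge_0 (K / e)). assert (P0 := pos_INR N0).
  assert (HNN : (N0 < N)%nat) by (apply INR_lt; lra).
  specialize (H N HNN).
  assert (Pk : 0 <= K / e) by (apply Rmult_le_pos; auto; left; now apply Rinv_0_lt_compat).
  assert (S1 : K / e < sqrt (INR N)).
  { rewrite <- (sqrt_pow2 (K / e)) by auto. apply sqrt_lt_1; lra. }
  assert (K / sqrt (INR N) < e); [|unfold e in *; lra].
  apply Rmult_lt_reg_r with (sqrt (INR N)); [lra|].
  replace (K / sqrt (INR N) * sqrt (INR N)) with K by (field; lra).
  apply Rmult_lt_compat_l with (r := e) in S1; auto.
  replace (e * (K / e)) with K in S1 by (field; lra). lra.
Qed.

Lemma large_strip (x : R) : exists N0, forall N, (N0 < N)%nat -> (0 < N)%nat /\ Rabs x < INR N * PI.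
Proof.
  destruct (INR_unbounded (Rabs x)) as [N0 HN0]. exists N0. intros N HN. split; [lia|].
  apply lt_INR in HN. assert (H := PI_gt_2). assert (Q := Rabs_pos x). nra.
Qed.

Lemma pole_term_real (G : C -> C) (p x : R) :
  p <> 0 -> x <> p -> pole_term G p x = (G p * RtoC (- (sin p / (p * (p - x)))))%C.
Proof.
  intros Hp Hx. unfold pole_term.
  rewrite RtoC_opp, RtoC_div by (apply Rmult_integral_contrapositive_currified; lra).
  rewrite RtoC_mult, RtoC_minus. field. repeat split.
  - apply Csub_neq_0, RtoC_neq; auto.
  - now apply RtoC_neq.
  - apply Csub_neq_0, RtoC_neq; auto.
Qed.

Lemma node_weight_pos (p x : R) : PI / 2 <= Rabs p -> Rabs x < PI / 2 -> 0 < p * (p - x).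
Proof.
  intros Hp Hx. assert (HPI := PI_gt_2). apply Rabs_lt_between in Hx.
  unfold Rabs in Hp. destruct (Rcase_abs p); nra.
Qed.

(** For [|x| < pi/2] the weights [1 / (p (p - x))] are all positive, and [csin]
    makes all terms equal to minus the weights, so that it majorizes every [G] of
    the same size. *)
Lemma pole_sum_comparison (G : C -> C) (M x : R) (L : list R) :
  0 <= M -> (forall t : R, Cmod (G t) <= M) -> Rabs x < PI / 2 ->
  (forall p, In p L -> cos p = 0 /\ PI / 2 <= Rabs p) ->
  exists T, 0 <= T /\ pole_sum csin L x = RtoC (- T) /\ Cmod (pole_sum G L x) <= M * T.
Proof.
  intros HM HG Hx. induction L as [|p L IH]; intros HL.
  - exists 0. simpl. rewrite Cmod_0, Ropp_0. repeat split; lra.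
  - destruct IH as [T [HT [E1 E2]]]; [intros; apply HL; now right|].
    destruct (HL p (or_introl eq_refl)) as [Hc Hp].
    assert (W := node_weight_pos p x Hp Hx). assert (HPI := PI_gt_2).
    assert (Np : p <> 0) by (intros ->; rewrite Rabs_R0 in Hp; lra).
    assert (Nx : x <> p) by (intros ->; lra).
    assert (S2 := sin_sqr_of_cos_0 p Hc).
    assert (Pw : 0 < / (p * (p - x))) by now apply Rinv_0_lt_compat.
    exists (/ (p * (p - x)) + T). cbn [pole_sum]. rewrite !pole_term_real by auto. repeat split.
    + lra.
    + rewrite E1, csin_RtoC, <- RtoC_mult, <- RtoC_plus. f_equal.
      replace (sin p * - (sin p / (p * (p - x)))) with (- (sin p * sin p * / (p * (p - x)))) by (field; lra).
      rewrite S2. ring.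
    + eapply Rle_trans; [apply Cmod_triangle|]. rewrite Rmult_plus_distr_l.
      apply Rplus_le_compat; auto. rewrite Cmod_mult, Cmod_R.
      apply Rmult_le_compat; auto using Cmod_ge_0, Rabs_pos.
      rewrite Rabs_Ropp. unfold Rdiv. rewrite Rabs_mult, (Rabs_pos_eq (/ _)) by lra.
      rewrite (abs_sin_of_cos_0 p Hc). lra.
Qed.

Lemma strip_type1_csin : strip_type1 csin 1.
Proof.
  split; [apply cdiff_csin|]. intros z. rewrite Rmult_1_l. apply Cmod_csin_le.
Qed.

Lemma csin_0 : csin 0 = 0%C.
Proof. rewrite csin_RtoC, sin_0. reflexivity. Qed.

(** Interpolation for [G] and for [csin] itself, compared term by term. *)
Theorem sine_comparison (G : C -> C) (M x : R) :
  strip_type1 G M -> G 0 = 0%C -> Rabs x < PI / 2 -> Cmod (G x) <= M * Rabs (sin x).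
Proof.
  intros HG G0 Hx. assert (HPI := PI_gt_2).
  destruct (Req_dec x 0) as [-> |Nx].
  { rewrite G0, Cmod_0, sin_0, Rabs_R0. lra. }
  assert (HM := strip_type1_nonneg G M HG).
  assert (Hx' := proj1 (Rabs_lt_between _ _) Hx).
  assert (Hc : 0 < cos x) by (apply cos_gt_0; lra).
  set (u := sin x / x / cos x).
  assert (Hu : Rabs (sin x) = u * (Rabs x * cos x)).
  { assert (E : sin x = u * cos x * x) by (unfold u; field; lra).
    assert (Pu : 0 <= u).
    { unfold u. apply Rmult_le_pos; [|left; now apply Rinv_0_lt_compat].
      destruct (Rle_dec 0 x).
      - apply Rmult_le_pos; [left; apply sin_gt_0; lra|left; apply Rinv_0_lt_compat; lra].
      - replace (sin x / x) with (sin (- x) * / (- x)) by (rewrite sin_neg; field; lra).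
        apply Rmult_le_pos; [left; apply sin_gt_0; lra|left; apply Rinv_0_lt_compat; lra]. }
    rewrite E at 1. rewrite !Rabs_mult, (Rabs_pos_eq u), (Rabs_pos_eq (cos x)) by lra. ring. }
  assert (Pax : 0 < Rabs x) by now apply Rabs_pos_lt.
  assert (Key : Cmod (G x) / Rabs x / cos x <= M * u).
  { destruct (large_strip x) as [N0 HN0].
    apply le_of_inv_sqrt_limit with (24 * M) N0; [lra|].
    intros N HN. destruct (HN0 N HN) as [HN1 HN2].
    assert (Ps : 0 < sqrt (INR N)) by (apply sqrt_lt_R0, lt_0_INR; lia).
    assert (I1 := interpolation G M N x HG G0 HN1 HN2 Nx ltac:(lra)).
    assert (I2 := interpolation csin 1 N x strip_type1_csin csin_0 HN1 HN2 Nx ltac:(lra)).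
    destruct (pole_sum_comparison G M x (nodes N) HM (fun t => strip_type1_real G M t HG) Hx)
      as [T [HT [E1 E2]]].
    { intros p Hp. destruct (nodes_spec N p Hp). tauto. }
    unfold remainder in I1, I2. rewrite E1, csin_RtoC, ccos_RtoC in I2.
    rewrite <- !RtoC_div, <- RtoC_plus, Cmod_R in I2 by lra. fold u in I2.
    apply Rabs_le_between in I2.
    assert (J := Cmod_sub_ge (G x / x / ccos x) (- pole_sum G (nodes N) x)%C).
    replace (G x / x / ccos x - - pole_sum G (nodes N) x)%C
      with (G x / x / ccos x + pole_sum G (nodes N) x)%C in J by ring.
    rewrite Cmod_opp, ccos_RtoC, !Cmod_div, !Cmod_R, (Rabs_pos_eq (cos x)) in J
      by (try lra; apply RtoC_neq; lra).
    rewrite ccos_RtoC in I1.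
    assert (M * T <= M * (u + 12 * 1 / sqrt (INR N))) by (apply Rmult_le_compat_l; lra).
    replace (24 * M / sqrt (INR N)) with (M * (12 * 1 / sqrt (INR N)) + 12 * M / sqrt (INR N)) by (field; lra).
    lra. }
  rewrite Hu.
  apply Rmult_le_compat_r with (r := Rabs x * cos x) in Key;
    [|left; now apply Rmult_lt_0_compat].
  replace (Cmod (G x) / Rabs x / cos x * (Rabs x * cos x)) with (Cmod (G x)) in Key by (field; lra).
  lra.
Qed.

Lemma pole_sum_nonpos (D : C -> C) (x : R) (L : list R) :
  Rabs x < PI / 2 ->
  (forall p, In p L -> PI / 2 <= Rabs p /\ 0 <= Re (D p) * sin p) ->
  Re (pole_sum D L x) <= 0 /\
  forall p, In p L -> Re (pole_sum D L x) <= - (Re (D p) * sin p / (p * (p - x))).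
Proof.
  intros Hx. assert (HPI := PI_gt_2). induction L as [|q L IH]; intros HL.
  - simpl. split; [lra|tauto].
  - destruct IH as [IH1 IH2]; [intros; apply HL; now right|].
    destruct (HL q (or_introl eq_refl)) as [Hq Hs].
    assert (W := node_weight_pos q x Hq Hx).
    assert (Nq : q <> 0) by (intros ->; rewrite Rabs_R0 in Hq; lra).
    assert (Nx : x <> q) by (intros ->; lra).
    assert (E : Re (pole_term D q x) = - (Re (D q) * sin q / (q * (q - x)))).
    { rewrite pole_term_real by auto. destruct (D q) as [u v]. simpl. unfold Rdiv. ring. }
    assert (0 <= Re (D q) * sin q / (q * (q - x))).
    { apply Rmult_le_pos; auto. left. now apply Rinv_0_lt_compat. }
    cbn [pole_sum In].
    assert (Ep : Re (pole_term D q x + pole_sum D L x)%C = Re (pole_term D q x) + Re (pole_sum D L x)) by reflexivity.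
    rewrite Ep, E. split; [lra|]. intros p [-> |Hp]; [lra|]. specialize (IH2 p Hp). lra.
Qed.

Lemma pole_sum_vanish (D : C -> C) (x : C) (L : list R) :
  (forall p, In p L -> D p = 0%C) -> pole_sum D L x = 0%C.
Proof.
  induction L as [|q L IH]; intros HL; [reflexivity|]. cbn [pole_sum].
  rewrite IH by (intros; apply HL; now right). unfold pole_term.
  rewrite (HL q (or_introl eq_refl)). unfold Cdiv. ring.
Qed.

(** The lower bound on [Re (G x)] near [0+] says that [G' 0] is at least [M].
    The difference [D = M sin - G] satisfies [Re (D p) * sin p >= 0] at every zero
    [p] of [cos], so each single term of its interpolation sum is at most
    [D x / (x cos x)], which tends to [0] with [x]. *)
Theorem sine_rigidity (G : C -> C) (M : R) :
  strip_type1 G M -> (forall t : R, Im (G t) = 0) -> G 0 = 0%C ->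
  (forall eps, 0 < eps -> exists delta, 0 < delta /\
     forall x, 0 < x < delta -> (M - eps) * x <= Re (G x)) ->
  forall x : R, G x = RtoC (M * sin x).
Proof.
  intros HG HI G0 Hd. assert (HPI := PI_gt_2).
  assert (HM := strip_type1_nonneg G M HG).
  set (D := fun z => (RtoC M * csin z - G z)%C).
  assert (HD : strip_type1 D (2 * M)).
  { split.
    - intros z. apply cdiff_minus; [|apply HG]. apply cdiff_mult; [apply cdiff_const|apply cdiff_csin].
    - intros z. unfold D. eapply Rle_trans; [apply Cmod_triangle_sub|].
      rewrite Cmod_mult, Cmod_R, (Rabs_pos_eq M) by auto.
      assert (Q := proj2 HG z). assert (Q' := Cmod_csin_le z).
      assert (M * Cmod (csin z) <= M * exp (Rabs (Im z))) by (now apply Rmult_le_compat_l). lra. }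
  assert (D0 : D 0 = 0%C) by (unfold D; rewrite csin_0, G0; ring).
  assert (Dre : forall t : R, Re (D t) = M * sin t - Re (G t)).
  { intros t. unfold D. rewrite csin_RtoC. destruct (G t) as [u v]. simpl. ring. }
  assert (Dim : forall t : R, Im (D t) = 0).
  { intros t. unfold D. rewrite csin_RtoC. assert (Q := HI t).
    destruct (G t) as [u v]. simpl in *. subst v. ring. }
  assert (Dsgn : forall p, cos p = 0 -> 0 <= Re (D p) * sin p).
  { intros p Hc. rewrite Dre. assert (S2 := sin_sqr_of_cos_0 p Hc).
    assert (Q := Rle_trans _ _ _ (Rabs_fst_le_Cmod (G p)) (strip_type1_real G M p HG)).
    fold (Re (G p)) in Q. apply Rabs_le_between in Q.
    assert (E : (sin p - 1) * (sin p + 1) = 0) by lra.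
    apply Rmult_integral in E. destruct E as [E|E].
    - replace (sin p) with 1 by lra. lra.
    - replace (sin p) with (-1) by lra. lra. }
  assert (Dnode : forall p, cos p = 0 -> D p = 0%C).
  { intros p Hc. assert (S2 := sin_sqr_of_cos_0 p Hc).
    assert (Hp : Re (D p) * sin p <= 0).
    { apply Rnot_lt_le. intros Hlt.
      (* bounds the denominator [p * (p - x)] for all small [x] *)
      set (c := Rabs p * (Rabs p + 1)).
      assert (Pp : PI / 2 <= Rabs p).
      { apply Rnot_lt_le. intros L. apply Rabs_lt_between in L.
        assert (0 < cos p) by (apply cos_gt_0; lra). lra. }
      assert (Pc : 0 < c) by (unfold c; nra).
      set (eps := Re (D p) * sin p / (4 * c)).
      assert (He : 0 < eps) by (apply Rdiv_lt_0_compat; lra).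
      destruct (Hd eps He) as [delta [Hdelta Hx]].
      set (x := Rmin (delta / 2) (/2)).
      assert (x1 : x <= delta / 2) by apply Rmin_l. assert (x2 : x <= /2) by apply Rmin_r.
      assert (x0 : 0 < x) by (apply Rmin_glb_lt; lra).
      specialize (Hx x ltac:(lra)).
      assert (Ax : Rabs x < PI / 2) by (rewrite Rabs_pos_eq; lra).
      assert (Cx : /2 <= cos x).
      { assert (Q := cos_quadratic x). apply Rabs_le_between in Q. nra. }
      assert (W := node_weight_pos p x Pp Ax).
      assert (Wc : p * (p - x) <= c).
      { unfold c. rewrite <- (Rabs_pos_eq (p * (p - x))) by lra. rewrite Rabs_mult.
        apply Rmult_le_compat_l; [apply Rabs_pos|].
        eapply Rle_trans; [apply Rabs_triang|]. rewrite Rabs_Ropp, (Rabs_pos_eq x); lra. }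
      assert (Key : Re (D p) * sin p / (p * (p - x)) <= Re (D x) / x / cos x).
      { destruct (large_strip (Rabs p)) as [N0 HN0]. 
        apply le_of_inv_sqrt_limit with (24 * M) N0; [lra|].
        intros N HN. destruct (HN0 N HN) as [HN1 HN2]. rewrite Rabs_Rabsolu in HN2.
        assert (I := interpolation D (2 * M) N x HD D0 HN1 ltac:(lra) ltac:(lra) ltac:(lra)).
        destruct (pole_sum_nonpos D x (nodes N) Ax) as [_ S].
        { intros q Hq. destruct (nodes_spec N q Hq). split; [tauto|]. now apply Dsgn. }
        specialize (S p (nodes_complete N p Hc ltac:(lra))).
        assert (Q := Rle_trans _ _ _ (Rabs_fst_le_Cmod _) I).
        apply Rabs_le_between in Q. destruct Q as [Q _].
        unfold remainder in Q. rewrite ccos_RtoC in Q.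
        assert (E : fst (D x / x / RtoC (cos x) + pole_sum D (nodes N) x)%C
          = Re (D x) / x / cos x + Re (pole_sum D (nodes N) x)).
        { replace (D x / x / RtoC (cos x))%C with (RtoC (Re (D x) / x / cos x)).
          - reflexivity.
          - rewrite !RtoC_div by lra. f_equal. f_equal.
            apply injective_projections; simpl; [auto|]. symmetry. apply Dim. }
        rewrite E in Q. replace (24 * M) with (12 * (2 * M)) by ring. lra. }
      assert (U : Re (D x) / x / cos x <= 2 * eps).
      { apply Rmult_le_reg_r with (x * cos x); [apply Rmult_lt_0_compat; lra|].
        replace (Re (D x) / x / cos x * (x * cos x)) with (Re (D x)) by (field; lra).
        rewrite Dre. assert (Q := abs_sin_le x). rewrite (Rabs_pos_eq x) in Q by lra.
        assert (Q' := Rle_abs (sin x)).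
        assert (M * sin x <= M * x) by (apply Rmult_le_compat_l; lra).
        assert (0 <= eps * x * (2 * cos x - 1)).
        { apply Rmult_le_pos; [left; now apply Rmult_lt_0_compat|lra]. }
        lra. }
      assert (V : Re (D p) * sin p / c <= Re (D p) * sin p / (p * (p - x))).
      { apply Rmult_le_compat_l; [lra|]. apply Rinv_le_contravar; lra. }
      assert (Re (D p) * sin p / c = 4 * eps) by (unfold eps; field; lra). lra. }
    assert (Hz : Re (D p) = 0).
    { assert (H := Dsgn p Hc). assert (E0 : Re (D p) * sin p = 0) by lra.
      apply Rmult_integral in E0. destruct E0 as [E0|E0]; auto. rewrite E0 in S2. lra. }
    apply injective_projections; [exact Hz|apply Dim]. }
  assert (Main : forall x : R, D x = 0%C).
  { intros x. destruct (Req_dec x 0) as [-> |Nx]; auto.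
    destruct (Req_dec (cos x) 0) as [Hc|Hc]; auto.
    destruct (large_strip x) as [N0 HN0].
    assert (Z : Cmod (D x / x / ccos x) <= 0).
    { apply le_of_inv_sqrt_limit with (24 * M) N0; [lra|].
      intros N HN. destruct (HN0 N HN) as [HN1 HN2].
      assert (I := interpolation D (2 * M) N x HD D0 HN1 HN2 Nx Hc).
      unfold remainder in I. rewrite pole_sum_vanish, Cplus_0_r in I.
      - replace (24 * M) with (12 * (2 * M)) by ring. lra.
      - intros p Hp. destruct (nodes_spec N p Hp). auto. }
    assert (Z0 : (D x / x / ccos x)%C = 0%C).
    { apply Cmod_eq_0. assert (Q := Cmod_ge_0 (D x / x / ccos x)). lra. }
    assert (Nx' := RtoC_neq x 0 Nx). assert (Nc := RtoC_neq _ _ Hc).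
    rewrite ccos_RtoC in Z0.
    replace (D x) with (D x / x / RtoC (cos x) * (x * RtoC (cos x)))%C by (field; auto).
    rewrite Z0. ring. }
  intros x. specialize (Main x). unfold D in Main.
  rewrite csin_RtoC, <- RtoC_mult in Main.
  replace (G x) with (RtoC (M * sin x) - (RtoC (M * sin x) - G x))%C by ring.
  rewrite Main. ring.
Qed.

(** * From functions of exponential type to sine products *)

Definition strip_type (gamma : R) (G : C -> C) (M : R) : Prop :=
  (forall z, cdiff G z) /\ (forall z, Cmod (G z) <= M * exp (gamma * Rabs (Im z))).

Lemma strip_type_rescale (gamma M : R) (G : C -> C) :
  0 < gamma -> strip_type gamma G M -> strip_type1 (fun z => G (RtoC (/ gamma) * z)%C) M.
Proof.
  intros Hg [HD HB]. split.
  - intros z. apply cdiff_comp; auto. apply cdiff_mult; [apply cdiff_const|apply cdiff_id].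
  - intros z. eapply Rle_trans; [apply HB|]. right. f_equal. f_equal.
    destruct z as [x y]. simpl. rewrite Rmult_0_l, Rplus_0_r, Rabs_mult.
    rewrite (Rabs_pos_eq (/ gamma)) by (left; now apply Rinv_0_lt_compat). field. lra.
Qed.

Lemma sine_comparison_scaled (gamma M x : R) (G : C -> C) :
  0 < gamma -> strip_type gamma G M -> G 0 = 0%C -> gamma * Rabs x < PI / 2 ->
  Cmod (G x) <= M * Rabs (sin (gamma * x)).
Proof.
  intros Hg HG G0 Hx.
  assert (Q := sine_comparison _ M (gamma * x) (strip_type_rescale gamma M G Hg HG)).
  simpl in Q.
  replace (RtoC (/ gamma) * RtoC (gamma * x))%C with (RtoC x) in Q
    by (rewrite <- RtoC_mult; f_equal; field; lra).
  apply Q.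
  - now rewrite Cmult_0_r.
  - rewrite Rabs_mult, (Rabs_pos_eq gamma); lra.
Qed.

Lemma sine_rigidity_scaled (gamma M : R) (G : C -> C) :
  0 < gamma -> strip_type gamma G M -> (forall t : R, Im (G t) = 0) -> G 0 = 0%C ->
  (forall eps, 0 < eps -> exists delta, 0 < delta /\
     forall x, 0 < x < delta -> (M * gamma - eps) * x <= Re (G x)) ->
  forall x : R, G x = RtoC (M * sin (gamma * x)).
Proof.
  intros Hg HG HI G0 Hd x.
  assert (Q := sine_rigidity _ M (strip_type_rescale gamma M G Hg HG)).
  simpl in Q.
  assert (Hin : forall t : R, (RtoC (/ gamma) * RtoC t)%C = RtoC (/ gamma * t))
    by (intros; now rewrite RtoC_mult).
  specialize (Q ltac:(intros t; rewrite Hin; apply HI) ltac:(now rewrite Cmult_0_r)).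
  rewrite <- Q.
  - rewrite Hin. f_equal. f_equal. field. lra.
  - intros eps He. destruct (Hd (eps * gamma)) as [delta [Hdelta H]]; [now apply Rmult_lt_0_compat|].
    exists (gamma * delta). split; [now apply Rmult_lt_0_compat|].
    intros t Ht. rewrite Hin.
    assert (T : 0 < / gamma * t < delta).
    { split.
      - apply Rmult_lt_0_compat; [now apply Rinv_0_lt_compat|lra].
      - apply Rmult_lt_reg_l with gamma; auto. rewrite <- Rmult_assoc, Rinv_r; lra. }
    specialize (H _ T).
    replace ((M * gamma - eps * gamma) * (/ gamma * t)) with ((M - eps) * t) in H by (field; lra).
    exact H.
Qed.

(** This is the strict decrease of [sin s / s], and the source of strict
    inequality away from the zeros of [sin (tau t)]. *)
Lemma sin_ratio_small (tau omega u : R) :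
  0 < tau < omega -> 0 < u -> omega * u <= PI -> tau * sin (omega * u) < omega * sin (tau * u).
Proof.
  intros Ht Hu Hou.
  destruct (MVT_cor2 (fun t => omega * sin (tau * t) - tau * sin (omega * t))
    (fun t => omega * tau * (cos (tau * t) - cos (omega * t))) 0 u Hu) as [c [E Hc]].
  - intros c _. apply is_derive_Reals. auto_derive; auto. ring.
  - rewrite !Rmult_0_r, sin_0 in E.
    assert (cos (omega * c) < cos (tau * c)).
    { apply cos_decreasing_1; nra. }
    assert (0 < omega * tau * (cos (tau * c) - cos (omega * c)) * (u - 0)).
    { repeat apply Rmult_lt_0_compat; lra. }
    lra.
Qed.

Lemma sin_ratio_large (tau omega u : R) :
  0 < tau < omega -> PI / 2 <= omega * u -> tau * u <= PI / 2 -> tau < omega * sin (tau * u).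
Proof.
  intros Ht Hu Htu. assert (HPI := PI_gt_2).
  set (u0 := PI / 2 / omega).
  assert (E0 : omega * u0 = PI / 2) by (unfold u0; field; lra).
  assert (P0 : 0 < u0) by (unfold u0; repeat apply Rdiv_lt_0_compat; lra).
  assert (Hu0 : u0 <= u) by (apply Rmult_le_reg_l with omega; lra).
  assert (S := sin_ratio_small tau omega u0 Ht P0 ltac:(lra)).
  rewrite E0, sin_PI2 in S.
  assert (sin (tau * u0) <= sin (tau * u)).
  { apply sin_incr_1; try nra. }
  nra.
Qed.

Lemma nearest_sine_zero (tau x : R) :
  0 < tau -> exists a, sin (tau * a) = 0 /\ tau * Rabs (x - a) <= PI / 2.
Proof.
  intros Ht. assert (HPI := PI_gt_2).
  set (y := tau * x / PI - /2). destruct (archimed y) as [A1 A2].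
  set (k := IZR (up y)) in *.
  exists (k * PI / tau). split.
  - apply sin_eq_0_1. exists (up y). fold k. field. lra.
  - rewrite <- (Rabs_pos_eq tau) at 1 by lra. rewrite <- Rabs_mult.
    replace (tau * (x - k * PI / tau)) with ((y + /2 - k) * PI) by (unfold y; field; lra).
    rewrite Rabs_mult, (Rabs_pos_eq PI) by lra.
    assert (Rabs (y + /2 - k) <= /2) by (apply Rabs_le; lra). nra.
Qed.

Lemma Rbar_glb_lt_p_infty (E : Rbar -> Prop) :
  Rbar_lt (Rbar_glb E) p_infty -> exists s, E s /\ Rbar_lt s p_infty.
Proof.
  intros H. apply NNPP. intros N.
  rewrite (Rbar_is_glb_unique E p_infty) in H; [exact H|]. split.
  - intros s Hs. apply Rbar_not_lt_le. intros L. apply N. now exists s.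
  - intros b _. now destruct b.
Qed.

Lemma B_exp_type (gamma : R) (f : C -> C) : B gamma f -> exp_type f gamma.
Proof.
  intros [_ H] eps He.
  destruct (Rbar_glb_lt_p_infty _ (H eps He)) as [s [[r ->] Hs]].
  set (E := fun y : R => exists z : C, r <= Cmod z /\ y = Cmod (f z) * exp (- ((gamma + eps) * Cmod z))) in *.
  assert (Hub := proj1 (Lub_Rbar_correct E)).
  exists (real (Lub_Rbar E)), r. intros z Hz.
  assert (Q : Rbar_le (Cmod (f z) * exp (- ((gamma + eps) * Cmod z))) (Lub_Rbar E)).
  { apply Hub. now exists z. }
  destruct (Lub_Rbar E) as [m| |]; simpl in *; try contradiction.
  apply Rmult_le_compat_r with (r := exp ((gamma + eps) * Cmod z)) in Q; [|left; apply exp_pos].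
  rewrite Rmult_assoc, <- exp_plus, Rplus_opp_l, exp_0, Rmult_1_r in Q. exact Q.
Qed.

(** At a zero [a] of [sin (tau t)] the functions [sin (tau t)] and
    [sin (tau (a + t))] differ by a sign, so the product is bounded by [M] on the
    real line. *)
Lemma strip_type_sine_product (tau sigma M a : R) (f : C -> C) :
  0 < tau -> 0 < sigma -> (forall z, cdiff f z) -> exp_type f sigma ->
  (forall t : R, Cmod (RtoC (sin (tau * t)) * f t) <= M) ->
  sin (tau * a) = 0 ->
  strip_type (sigma + tau) (fun z => csin (RtoC tau * z) * f (RtoC a + z))%C M.
Proof.
  intros Ht Hs HD HT HM Ha. 
  assert (HDG : forall z, cdiff (fun z => csin (RtoC tau * z) * f (RtoC a + z))%C z).
  { intros z. apply cdiff_mult.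
    - apply cdiff_comp; [apply cdiff_csin|]. apply cdiff_mult; [apply cdiff_const|apply cdiff_id].
    - apply cdiff_comp; auto. apply cdiff_plus; [apply cdiff_const|apply cdiff_id]. }
  split; auto. intros z. apply (phragmen_lindelof (fun z => csin (RtoC tau * z) * f (RtoC a + z))%C); auto.
  - lra.
  - intros eps He. destruct (HT eps He) as [K [r H]].
    exists (Rabs K * exp ((sigma + eps) * Rabs a)), (r + Rabs a). intros w Hw.
    rewrite Cmod_mult.
    assert (W1 : Cmod (RtoC a + w) <= Rabs a + Cmod w).
    { eapply Rle_trans; [apply Cmod_triangle|]. rewrite Cmod_R. lra. }
    assert (W2 : r <= Cmod (RtoC a + w)).
    { assert (Q := Cmod_triangle (RtoC a + w) (- RtoC a)).
      replace (RtoC a + w + - RtoC a)%C with w in Q by ring.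
      rewrite Cmod_opp, Cmod_R in Q. lra. }
    assert (F1 : Cmod (f (RtoC a + w)%C) <= Rabs K * exp ((sigma + eps) * (Rabs a + Cmod w))).
    { eapply Rle_trans; [apply H; auto|].
      assert (Pe := exp_pos ((sigma + eps) * Cmod (RtoC a + w))).
      apply Rle_trans with (Rabs K * exp ((sigma + eps) * Cmod (RtoC a + w))).
      - apply Rmult_le_compat_r; [lra|apply Rle_abs].
      - apply Rmult_le_compat_l; [apply Rabs_pos|]. apply exp_le.
        apply Rmult_le_compat_l; lra. }
    assert (F2 : Cmod (csin (RtoC tau * w)%C) <= exp (tau * Cmod w)).
    { eapply Rle_trans; [apply Cmod_csin_le|]. apply exp_le.
      eapply Rle_trans; [apply Rabs_snd_le_Cmod|]. rewrite Cmod_mult, Cmod_R, Rabs_pos_eq; lra. }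
    replace (Rabs K * exp ((sigma + eps) * Rabs a) * exp ((sigma + tau + eps) * Cmod w))
      with (exp (tau * Cmod w) * (Rabs K * exp ((sigma + eps) * (Rabs a + Cmod w)))).
    + apply Rmult_le_compat; auto using Cmod_ge_0.
    + replace ((sigma + tau + eps) * Cmod w) with (tau * Cmod w + (sigma + eps) * Cmod w) by ring.
      rewrite Rmult_plus_distr_l, !exp_plus. ring.
  - intros t. rewrite Cmod_mult, <- RtoC_mult, <- RtoC_plus, csin_RtoC, Cmod_R.
    specialize (HM (a + t)). rewrite Cmod_mult, Cmod_R, Rmult_plus_distr_l, sin_plus, Ha in HM.
    rewrite Rmult_0_l, Rplus_0_l, Rabs_mult in HM.
    replace (Rabs (cos (tau * a))) with 1 in HM.
    + lra.
    + assert (S := sin2_cos2 (tau * a)). rewrite Ha in S. unfold Rsqr in S.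
      assert (Q0 := pow2_abs (cos (tau * a))). assert (Q1 := Rabs_pos (cos (tau * a))). nra.
Qed.

(** * The sharp bound and its extremal functions *)

Definition sine_bounded (tau M : R) (f : C -> C) : Prop :=
  forall t : R, Cmod (RtoC (sin (tau * t)) * f t) <= M.

Lemma abs_sin_pos_angle (y : R) : Rabs y <= PI -> Rabs (sin y) = sin (Rabs y).
Proof.
  intros H. apply Rabs_le_between in H. destruct (Rle_lt_dec 0 y) as [P|P].
  - rewrite (Rabs_pos_eq y) by auto. apply Rabs_pos_eq, sin_ge_0; lra.
  - rewrite (Rabs_left y), <- Rabs_Ropp, <- sin_neg by auto. apply Rabs_pos_eq, sin_ge_0; lra.
Qed.

(** With [a] the nearest zero of [sin (tau t)] and [u = x - a]: for
    [omega |u| < pi/2] use the comparison with the sine, otherwise the trivial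
    bound [|G u| <= M]. *)
Lemma bound_off_sine_zeros (tau sigma M x : R) (f : C -> C) :
  0 < tau -> 0 < sigma -> (forall z, cdiff f z) -> exp_type f sigma ->
  sine_bounded tau M f -> sin (tau * x) <> 0 ->
  Cmod (f x) <= (sigma / tau + 1) * M /\ (0 < M -> Cmod (f x) < (sigma / tau + 1) * M).
Proof.
  intros Ht Hs HD HT HM Hx. assert (HPI := PI_gt_2).
  destruct (nearest_sine_zero tau x Ht) as [a [Ha Hu]].
  set (u := x - a) in *. set (omega := sigma + tau).
  assert (HG := strip_type_sine_product tau sigma M a f Ht Hs HD HT HM Ha). fold omega in HG.
  set (G := fun z => (csin (RtoC tau * z) * f (RtoC a + z))%C) in *.
  assert (HM0 : 0 <= M) by (eapply Rle_trans; [apply Cmod_ge_0|apply (HM 0)]).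
  assert (Nu : u <> 0).
  { intros E. apply Hx. replace x with a by (unfold u in E; lra). exact Ha. }
  assert (Pu : 0 < Rabs u) by now apply Rabs_pos_lt.
  assert (Gu : Cmod (G u) = sin (tau * Rabs u) * Cmod (f x)).
  { unfold G. rewrite <- RtoC_mult, <- RtoC_plus, csin_RtoC, Cmod_mult, Cmod_R.
    replace (a + u) with x by (unfold u; ring). f_equal.
    assert (At : Rabs (tau * u) = tau * Rabs u) by (rewrite Rabs_mult, (Rabs_pos_eq tau); lra).
    rewrite <- At. apply abs_sin_pos_angle. lra. }
  assert (Key : exists c, Cmod (G u) <= M * c /\ tau * c < omega * sin (tau * Rabs u)).
  { destruct (Rlt_le_dec (omega * Rabs u) (PI / 2)) as [L|L].
    - exists (sin (omega * Rabs u)). split.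
      + assert (Q := sine_comparison_scaled omega M u G ltac:(unfold omega; lra) HG).
        assert (At : Rabs (omega * u) = omega * Rabs u)
          by (rewrite Rabs_mult, (Rabs_pos_eq omega); unfold omega; lra).
        rewrite abs_sin_pos_angle, At in Q by lra. apply Q; auto.
        unfold G. rewrite Cmult_0_r, csin_0. ring.
      + apply sin_ratio_small; auto; unfold omega in *; lra.
    - exists 1. split.
      + assert (Q := proj2 HG u). simpl in Q. rewrite Rabs_R0, Rmult_0_r, exp_0 in Q. exact Q.
      + rewrite Rmult_1_r. apply sin_ratio_large; unfold omega in *; lra. }
  destruct Key as [c [K1 K2]]. rewrite Gu in K1.
  assert (Ps : 0 < sin (tau * Rabs u)).
  { apply sin_gt_0; [now apply Rmult_lt_0_compat|lra]. }
  assert (E : (sigma / tau + 1) * M = M * omega / tau) by (unfold omega; field; lra).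
  rewrite E.
  assert (K3 : Cmod (f x) * (tau * sin (tau * Rabs u)) <= M * (tau * c)) by nra.
  assert (Pts : 0 < tau * sin (tau * Rabs u)) by now apply Rmult_lt_0_compat.
  assert (E2 : M * omega / tau * (tau * sin (tau * Rabs u)) = M * (omega * sin (tau * Rabs u)))
    by (field; lra).
  split.
  - apply Rmult_le_reg_r with (tau * sin (tau * Rabs u)); auto. rewrite E2.
    eapply Rle_trans; [exact K3|]. apply Rmult_le_compat_l; lra.
  - intros HMp. apply Rmult_lt_reg_r with (tau * sin (tau * Rabs u)); auto. rewrite E2.
    eapply Rle_lt_trans; [exact K3|]. now apply Rmult_lt_compat_l.
Qed.

Lemma sine_nonzero_nearby (tau x delta : R) :
  0 < tau -> sin (tau * x) = 0 -> 0 < delta ->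
  exists h, 0 < h < delta /\ sin (tau * (x + h)) <> 0.
Proof.
  intros Ht Hx Hd. assert (HPI := PI_gt_2).
  set (h := Rmin (delta / 2) (/ tau)).
  assert (Pt : 0 < / tau) by now apply Rinv_0_lt_compat.
  assert (h1 : h <= delta / 2) by apply Rmin_l. assert (h2 : h <= / tau) by apply Rmin_r.
  assert (h0 : 0 < h) by (apply Rmin_glb_lt; lra).
  exists h. split; [lra|].
  rewrite Rmult_plus_distr_l, sin_plus, Hx, Rmult_0_l, Rplus_0_l.
  apply Rmult_integral_contrapositive_currified.
  - intros E. assert (S := sin2_cos2 (tau * x)). rewrite Hx, E in S. unfold Rsqr in S. lra.
  - apply Rgt_not_eq, sin_gt_0; [now apply Rmult_lt_0_compat|].
    apply Rmult_le_compat_l with (r := tau) in h2; [|lra]. rewrite Rinv_r in h2; lra.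
Qed.

Theorem sharp_bound (tau sigma M x : R) (f : C -> C) :
  0 < tau -> 0 < sigma -> (forall z, cdiff f z) -> exp_type f sigma ->
  sine_bounded tau M f -> Cmod (f x) <= (sigma / tau + 1) * M.
Proof.
  intros Ht Hs HD HT HM.
  destruct (Req_dec (sin (tau * x)) 0) as [Hx|Hx].
  2: { now apply bound_off_sine_zeros. }
  apply Rnot_lt_le. intros N.
  destruct (cdiff_ccont f x (HD x) (Cmod (f x) - (sigma / tau + 1) * M)) as [d [Hd H]]; [lra|].
  destruct (sine_nonzero_nearby tau x d Ht Hx Hd) as [h [Hh Hsin]].
  specialize (H (x + h)). rewrite <- RtoC_minus, Cmod_R in H.
  replace (x + h - x) with h in H by ring. rewrite Rabs_pos_eq in H by lra.
  specialize (H ltac:(lra)).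
  assert (Q := Cmod_sub_ge (f x) (f (x + h))). rewrite Cmod_sub_sym in Q.
  assert (B0 := proj1 (bound_off_sine_zeros tau sigma M (x + h) f Ht Hs HD HT HM Hsin)). lra.
Qed.

(** Phragmen-Lindelof forces the product with the sine to vanish in the whole
    plane; where the sine has a zero, necessarily a real one, the bound on the
    real line takes over. *)
Lemma sine_bounded_0_zero (tau sigma : R) (f : C -> C) :
  0 < tau -> 0 < sigma -> (forall z, cdiff f z) -> exp_type f sigma ->
  sine_bounded tau 0 f -> forall z, f z = 0%C.
Proof.
  intros Ht Hs HD HT HM z.
  assert (H0 : sin (tau * 0) = 0) by (rewrite Rmult_0_r; apply sin_0).
  destruct (strip_type_sine_product tau sigma 0 0 f Ht Hs HD HT HM H0) as [_ HB].
  specialize (HB z). rewrite Rmult_0_l, Cplus_0_l in HB.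
  destruct (Ceq_dec (csin (RtoC tau * z)) 0) as [E|E].
  - destruct (csin_eq_0 _ E) as [_ E2]. destruct z as [x y]. simpl in E2.
    assert (y = 0) by nra. subst y.
    assert (Q := sharp_bound tau sigma 0 x f Ht Hs HD HT HM). rewrite Rmult_0_r in Q.
    apply Cmod_eq_0. assert (P := Cmod_ge_0 (f x)). unfold RtoC in *. lra.
  - rewrite Cmod_mult in HB. apply Cmod_gt_0 in E. apply Cmod_eq_0.
    assert (P := Cmod_ge_0 (f z)). nra.
Qed.

(** At a zero [x0] of the sine, equality says that the product
    [sin (tau u) * f (x0 + u)] has the largest derivative at [u = 0] that its bound
    and type allow, up to the sign [e]. *)
Theorem extremal_identity (tau sigma M x0 : R) (f : C -> C) :
  0 < tau -> 0 < sigma -> (forall z, cdiff f z) -> exp_type f sigma ->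
  sine_bounded tau M f -> (forall x : R, Im (f x) = 0) -> sin (tau * x0) = 0 ->
  Cmod (f x0) = (sigma / tau + 1) * M ->
  exists e, (e = 1 \/ e = -1) /\
    forall u, e * sin (tau * u) * Re (f (RtoC (x0 + u))) = M * sin ((sigma + tau) * u).
Proof.
  intros Ht Hs HD HT HM HI Hx0 Heq.
  assert (Fre : forall t : R, f t = RtoC (Re (f t))).
  { intros t. apply injective_projections; [reflexivity|apply HI]. }
  set (A := (sigma / tau + 1) * M) in *.
  assert (HA : 0 <= A) by (rewrite <- Heq; apply Cmod_ge_0).
  assert (He : exists e, (e = 1 \/ e = -1) /\ e * Re (f x0) = A).
  { rewrite (Fre x0), Cmod_R in Heq. unfold Rabs in Heq.
    destruct (Rcase_abs (Re (f x0))); [exists (-1)|exists 1]; split; auto; lra. }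
  destruct He as [e [He Ee]]. exists e. split; auto.
  set (omega := sigma + tau).
  assert (HG := strip_type_sine_product tau sigma M x0 f Ht Hs HD HT HM Hx0). fold omega in HG.
  set (G := fun z => (RtoC e * (csin (RtoC tau * z) * f (RtoC x0 + z)))%C).
  assert (Greal : forall u : R, G u = RtoC (e * sin (tau * u) * Re (f (RtoC (x0 + u))))).
  { intros u. unfold G. rewrite <- RtoC_mult, <- RtoC_plus, csin_RtoC, (Fre (x0 + u)) at 1.
    rewrite !RtoC_mult. ring. }
  assert (HG' : strip_type omega G M).
  { destruct HG as [G1 G2]. split.
    - intros z. apply cdiff_mult; [apply cdiff_const|apply G1].
    - intros z. unfold G. rewrite Cmod_mult, Cmod_R.
      replace (Rabs e) with 1; [rewrite Rmult_1_l; apply G2|].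
      destruct He as [-> | ->]; [now rewrite Rabs_R1|]. rewrite Rabs_left; lra. }
  assert (EA : A * tau = M * omega) by (unfold A, omega; field; lra).
  assert (R0 := sine_rigidity_scaled omega M G ltac:(unfold omega; lra) HG').
  intros u. apply RtoC_inj. rewrite <- Greal. apply R0; clear R0 u.
  - intros t. rewrite Greal. reflexivity.
  - unfold G. rewrite Cmult_0_r, csin_0. ring.
  (* the derivative of [G] at [0] is [tau * A = M * omega] *)
  - intros eps Heps.
    set (eta := eps / (2 * tau)). assert (Heta : 0 < eta) by (apply Rdiv_lt_0_compat; lra).
    destruct (cdiff_ccont f x0 (HD x0) eta Heta) as [d [Hd H]].
    set (q := A * tau^2 + 1). assert (Pt2 : 0 < tau^2) by (apply pow_lt; auto).
    assert (Pq : 0 < q) by (unfold q; nra).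
    exists (Rmin d (Rmin (/ tau) (eps / q))).
    assert (Pt : 0 < / tau) by now apply Rinv_0_lt_compat.
    split. { repeat apply Rmin_glb_lt; auto. now apply Rdiv_lt_0_compat. }
    intros x Hx.
    assert (M1 := Rmin_l d (Rmin (/ tau) (eps / q))).
    assert (M2 := Rmin_r d (Rmin (/ tau) (eps / q))).
    assert (M3 := Rmin_l (/ tau) (eps / q)). assert (M4 := Rmin_r (/ tau) (eps / q)).
    rewrite Greal, re_RtoC.
    specialize (H (x0 + x)). rewrite <- RtoC_minus, Cmod_R in H.
    replace (x0 + x - x0) with x in H by ring. rewrite Rabs_pos_eq in H by lra.
    specialize (H ltac:(lra)).
    assert (F : Rabs (Re (f (RtoC (x0 + x))) - Re (f x0)) < eta).
    { eapply Rle_lt_trans; [|exact H]. apply (Rabs_fst_le_Cmod (f (RtoC (x0 + x)) - f x0)). }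
    assert (F' : A - eta <= e * Re (f (RtoC (x0 + x)))).
    { apply Rabs_lt_between in F. destruct He as [-> | ->]; lra. }
    assert (Tx : 0 < tau * x <= 1).
    { split; [apply Rmult_lt_0_compat; lra|].
      apply Rmult_le_reg_l with (/ tau); auto. rewrite <- Rmult_assoc, Rinv_l; lra. }
    assert (S1 := sin_quadratic (tau * x) ltac:(rewrite Rabs_pos_eq; lra)).
    assert (S2 := abs_sin_le (tau * x)). rewrite (Rabs_pos_eq (tau * x)) in S2 by lra.
    apply Rabs_le_between in S1. apply Rabs_le_between in S2.
    assert (S0 : 0 <= sin (tau * x)).
    { apply sin_ge_0; assert (HPI := PI_gt_2); lra. }
    assert (Xq : x * q <= eps).
    { apply Rle_trans with (eps / q * q); [apply Rmult_le_compat_r; lra|]. right. field. lra. }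
    assert (Et : tau * eta = eps / 2) by (unfold eta; field; lra).
    rewrite <- EA.
    apply Rle_trans with (sin (tau * x) * (A - eta)).
    + assert (sin (tau * x) * A >= (tau * x - (tau * x)^2/2) * A) by nra.
      assert (sin (tau * x) * eta <= tau * x * eta) by (apply Rmult_le_compat_r; lra).
      assert (A * tau^2 * x <= eps) by (unfold q in Xq; nra).
      assert (A * tau^2 * x * x <= eps * x) by (apply Rmult_le_compat_r; lra).
      replace (tau * x * eta) with (tau * eta * x) in * by ring. rewrite Et in *. nra.
    + replace (e * sin (tau * x) * Re (f (RtoC (x0 + x))))
        with (sin (tau * x) * (e * Re (f (RtoC (x0 + x))))) by ring.
      now apply Rmult_le_compat_l.
Qed.

(** * Quotients of sines *)

Lemma sine_zeros_isolated (tau x : R) :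
  0 < tau -> exists d, 0 < d /\ forall t, t <> x -> Rabs (t - x) < d -> sin (tau * t) <> 0.
Proof.
  intros Ht. assert (HPI := PI_gt_2).
  destruct (Req_dec (sin (tau * x)) 0) as [Hx|Hx].
  - exists (/ tau). split; [now apply Rinv_0_lt_compat|]. intros t Nt Hd.
    replace (tau * t) with (tau * x + tau * (t - x)) by ring.
    rewrite sin_plus, Hx, Rmult_0_l, Rplus_0_l.
    apply Rmult_integral_contrapositive_currified.
    + intros E. assert (S := sin2_cos2 (tau * x)). rewrite Hx, E in S. unfold Rsqr in S. lra.
    + assert (A : Rabs (tau * (t - x)) = tau * Rabs (t - x)) by (rewrite Rabs_mult, (Rabs_pos_eq tau); lra).
      assert (P : 0 < Rabs (t - x)) by (apply Rabs_pos_lt; lra).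
      apply Rmult_lt_compat_l with (r := tau) in Hd; auto. rewrite Rinv_r in Hd by lra.
      intros E. assert (Q := abs_sin_pos_angle (tau * (t - x)) ltac:(lra)).
      rewrite E, Rabs_R0, A in Q. 
      assert (0 < sin (tau * Rabs (t - x))); [|lra].
      apply sin_gt_0; [now apply Rmult_lt_0_compat|lra].
  - exists (Rabs (sin (tau * x)) / tau). split.
    { apply Rdiv_lt_0_compat; auto. now apply Rabs_pos_lt. }
    intros t _ Hd E.
    destruct (MVT_gen (fun t => sin (tau * t)) x t (fun t => tau * cos (tau * t))) as [c [_ Hc]].
    + intros. auto_derive; auto; ring.
    + intros s _. apply derivable_continuous_pt. apply ex_derive_Reals_0. auto_derive; auto.
    + rewrite E, Rminus_0_l in Hc. apply (f_equal Rabs) in Hc.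
      rewrite Rabs_Ropp, !Rabs_mult, (Rabs_pos_eq tau) in Hc by lra.
      assert (C1 : Rabs (cos (tau * c)) <= 1) by (apply Rabs_le, COS_bound).
      apply Rmult_lt_compat_l with (r := tau) in Hd; auto.
      replace (tau * (Rabs (sin (tau * x)) / tau)) with (Rabs (sin (tau * x))) in Hd by (field; lra).
      assert (P := Rabs_pos (t - x)).
      assert (tau * Rabs (cos (tau * c)) * Rabs (t - x) <= tau * 1 * Rabs (t - x)).
      { apply Rmult_le_compat_r; auto. apply Rmult_le_compat_l; lra. }
      lra.
Qed.

(** The zeros of [sin (tau t)] are isolated, so [g / c] is the continuous extension
    of the quotient. *)
Lemma cont_ext_quotient (tau omega c x : R) (g : R -> R) :
  0 < tau -> c <> 0 -> continuity_pt g x ->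
  (forall t, sin (tau * t) * g t = c * sin (omega * t)) ->
  cont_ext (fun t => sin (omega * t) / sin (tau * t)) x = g x / c.
Proof.
  intros Ht Hc Hg H. unfold cont_ext.
  rewrite (is_lim_unique _ x (Finite (g x / c))); [reflexivity|].
  apply is_lim_ext_loc with (fun t => g t / c).
  - destruct (sine_zeros_isolated tau x Ht) as [d [Hd Hs]].
    exists (mkposreal d Hd). intros t Bt Nt.
    change (Rabs (t - x) < d) in Bt.
    assert (N := Hs t Nt Bt). 
    apply Rmult_eq_reg_r with (c * sin (tau * t)); [|now apply Rmult_integral_contrapositive_currified].
    replace (g t / c * (c * sin (tau * t))) with (sin (tau * t) * g t) by (field; auto).
    rewrite H. field. auto.
  - apply (is_lim_continuity (fun t => g t / c)). 
    apply continuity_pt_mult; auto. apply continuity_pt_const. intros ? ?; reflexivity.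
Qed.

Lemma ccont_continuity_pt (f : C -> C) (x : R) :
  ccont f x -> continuity_pt (fun t => Re (f (RtoC t))) x.
Proof. intros H. apply continuity_pt_filterlim. exact (ccont_hor f x 0 H). Qed.

(** These are the derivatives at [0] of the two members of the hypothesis. As [g]
    need not be differentiable, the comparison is made on difference quotients. *)
Lemma sine_product_slope (tau omega c : R) (g : R -> R) :
  0 < tau -> 0 < omega -> continuity_pt g 0 ->
  (forall t, sin (tau * t) * g t = c * sin (omega * t)) -> tau * g 0 = c * omega.
Proof.
  intros Ht Ho Hg H. apply Rminus_diag_uniq. apply NNPP. intros N.
  apply Rabs_pos_lt in N. set (D := Rabs (tau * g 0 - c * omega)) in *.
  set (eta := D / (4 * tau)). assert (Heta : 0 < eta) by (apply Rdiv_lt_0_compat; lra).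
  destruct (Hg eta Heta) as [d [Hd Hcont]].
  set (Q := tau^2 * (Rabs (g 0) + eta) + Rabs c * omega^2 + 1).
  assert (HQ : 1 <= Q).
  { unfold Q. assert (A1 := Rabs_pos (g 0)). assert (A2 := Rabs_pos c).
    assert (A3 := pow2_ge_0 tau). assert (A4 := pow2_ge_0 omega).
    assert (0 <= tau^2 * (Rabs (g 0) + eta)) by (apply Rmult_le_pos; lra).
    assert (0 <= Rabs c * omega^2) by (apply Rmult_le_pos; lra). lra. }
  set (t := Rmin (Rmin (d / 2) (D / (2 * Q))) (Rmin (/ tau) (/ omega))).
  assert (T0 : 0 < t).
  { repeat apply Rmin_glb_lt; try (apply Rinv_0_lt_compat; auto); [lra|apply Rdiv_lt_0_compat; lra]. }
  assert (T1 : t <= d / 2) by (eapply Rle_trans; [apply Rmin_l|apply Rmin_l]).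
  assert (T2 : t <= D / (2 * Q)) by (eapply Rle_trans; [apply Rmin_l|apply Rmin_r]).
  assert (T3 : t <= / tau) by (eapply Rle_trans; [apply Rmin_r|apply Rmin_l]).
  assert (T4 : t <= / omega) by (eapply Rle_trans; [apply Rmin_r|apply Rmin_r]).
  assert (Gt : Rabs (g t - g 0) < eta).
  { apply (Hcont t). split; [split; [exact I|lra]|]. simpl. unfold Rdist.
    rewrite Rminus_0_r, Rabs_pos_eq; lra. }
  assert (U : forall k, 0 < k -> t <= / k -> Rabs (sin (k * t) - k * t) <= k^2 * t^2 / 2).
  { intros k Hk Hkt. replace (k^2 * t^2) with ((k * t)^2) by ring. apply sin_quadratic.
    apply Rmult_le_compat_l with (r := k) in Hkt; [|lra]. rewrite Rinv_r in Hkt by lra.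
    rewrite Rabs_pos_eq; nra. }
  assert (U1 := U tau Ht T3). assert (U2 := U omega Ho T4).
  assert (Gb : Rabs (g t) <= Rabs (g 0) + eta).
  { replace (g t) with (g 0 + (g t - g 0)) by ring. eapply Rle_trans; [apply Rabs_triang|]. lra. }
  assert (V : Rabs (tau * g t - c * omega) * t <= Q * t^2 / 2).
  { rewrite <- (Rabs_pos_eq t) at 2 by lra. rewrite <- Rabs_mult.
    replace ((tau * g t - c * omega) * t)
      with (- ((sin (tau * t) - tau * t) * g t) + c * (sin (omega * t) - omega * t))
      by (assert (E := H t); lra).
    eapply Rle_trans; [apply Rabs_triang|]. rewrite Rabs_Ropp, !Rabs_mult.
    assert (W1 : Rabs (sin (tau * t) - tau * t) * Rabs (g t) <= tau^2 * t^2 / 2 * (Rabs (g 0) + eta))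
      by (apply Rmult_le_compat; auto using Rabs_pos).
    assert (W2 : Rabs c * Rabs (sin (omega * t) - omega * t) <= Rabs c * (omega^2 * t^2 / 2))
      by (apply Rmult_le_compat_l; auto using Rabs_pos).
    assert (0 <= t^2) by apply pow2_ge_0. unfold Q. lra. }
  assert (V' : Rabs (tau * g t - c * omega) <= Q * t / 2).
  { apply Rmult_le_reg_r with t; auto. lra. }
  assert (Tq : Q * t <= D / 2).
  { apply Rle_trans with (Q * (D / (2 * Q))); [apply Rmult_le_compat_l; lra|]. right. field. lra. }
  assert (Tr : D <= tau * Rabs (g t - g 0) + Rabs (tau * g t - c * omega)).
  { unfold D. replace (tau * g 0 - c * omega) with (- (tau * (g t - g 0)) + (tau * g t - c * omega)) by ring.
    eapply Rle_trans; [apply Rabs_triang|]. rewrite Rabs_Ropp, Rabs_mult, (Rabs_pos_eq tau); lra. }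
  assert (tau * Rabs (g t - g 0) < tau * eta) by (now apply Rmult_lt_compat_l).
  assert (tau * eta = D / 4) by (unfold eta; field; lra). lra.
Qed.

Lemma sin_multiple_zero (tau omega x : R) (n : nat) :
  0 < tau -> omega = INR n * tau -> sin (tau * x) = 0 -> sin (omega * x) = 0.
Proof.
  intros Ht -> H. destruct (sin_eq_0_0 _ H) as [k Hk]. apply sin_eq_0_1.
  exists (Z.of_nat n * k)%Z. rewrite mult_IZR, <- INR_IZR_INZ, Rmult_assoc, Hk. ring.
Qed.

Lemma sup_norm_cases (h : R -> C) :
  sup_norm h = p_infty \/ exists m, sup_norm h = Finite m /\ 0 <= m /\ forall t, Cmod (h t) <= m.
Proof.
  unfold sup_norm. set (E := fun y : R => exists t : R, y = Cmod (h t)).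
  assert (H := proj1 (Lub_Rbar_correct E)).
  assert (H' : forall t, Rbar_le (Cmod (h t)) (Lub_Rbar E)) by (intros t; apply H; now exists t).
  destruct (Lub_Rbar E) as [m| |]; auto.
  - right. exists m. split; auto. split; [|exact H'].
    eapply Rle_trans; [apply Cmod_ge_0|apply (H' 0)].
  - destruct (H' 0).
Qed.

Lemma Rbar_mult_pos_p_infty (k : R) : 0 < k -> Rbar_mult (Finite k) p_infty = p_infty.
Proof.
  intros H. apply is_Rbar_mult_unique. apply is_Rbar_mult_sym, is_Rbar_mult_p_infty_pos. exact H.
Qed.

Lemma sin_shift_by_zero (k x0 u : R) :
  sin (k * x0) = 0 -> sin (k * (x0 + u)) = cos (k * x0) * sin (k * u).
Proof. intros H. rewrite Rmult_plus_distr_l, sin_plus, H. ring. Qed.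

Lemma cos_sqr_of_sin_0 (y : R) : sin y = 0 -> cos y * cos y = 1.
Proof. intros H. assert (S := sin2_cos2 y). rewrite H in S. unfold Rsqr in S. lra. Qed.

Theorem corollary1p5 (tau sigma : R) (Htau : 0 < tau) (Hsigma : 0 < sigma) :
  (forall f : C -> C, B sigma f ->
     forall x : R,
       Rbar_le (Finite (Cmod (f (RtoC x))))
         (Rbar_mult (Finite (sigma / tau + 1))
            (sup_norm (fun t : R => (RtoC (sin (tau * t)) * f (RtoC t))%C))))
  /\
  (forall f : C -> C, B sigma f ->
     (forall x : R, Im (f (RtoC x)) = 0) ->
     ~ (forall z : C, f z = RtoC 0) ->
     ((exists x0 : R,
         cos (tau * x0) <> 0 /\
         Finite (Cmod (f (RtoC x0))) =
         Rbar_mult (Finite (sigma / tau + 1))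
           (sup_norm (fun t : R => (RtoC (sin (tau * t)) * f (RtoC t))%C)))
      <->
      ((exists n : nat, (0 < n)%nat /\ sigma / tau = INR n) /\
       exists c : R, c <> 0 /\
         forall x : R,
           f (RtoC x) =
           RtoC (c * cont_ext (fun t => sin ((sigma + tau) * t) / sin (tau * t)) x)))).
Proof.
  assert (Pr : 0 < sigma / tau) by (apply Rdiv_lt_0_compat; lra).
  assert (HPI := PI_gt_2).
  split.
  - intros f Bf x. assert (HT := B_exp_type sigma f Bf). assert (HD := entire_cdiff f (proj1 Bf)).
    destruct (sup_norm_cases (fun t : R => (RtoC (sin (tau * t)) * f (RtoC t))%C))
      as [-> |[m [-> [Hm0 Hm]]]].
    + rewrite Rbar_mult_pos_p_infty by lra. exact I.
    + exact (sharp_bound tau sigma m x f Htau Hsigma HD HT Hm).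
  - intros f Bf HI Nf. assert (HT := B_exp_type sigma f Bf). assert (HD := entire_cdiff f (proj1 Bf)).
    assert (Fre : forall t : R, f t = RtoC (Re (f t))).
    { intros t. apply injective_projections; [reflexivity|apply HI]. }
    assert (Fc : forall x, continuity_pt (fun t => Re (f (RtoC t))) x).
    { intros x. apply ccont_continuity_pt, cdiff_ccont, HD. }
    split.
    + intros [x0 [_ Heq]].
      destruct (sup_norm_cases (fun t : R => (RtoC (sin (tau * t)) * f (RtoC t))%C))
        as [Hinf|[m [Hm1 [Hm0 Hm]]]].
      { rewrite Hinf, Rbar_mult_pos_p_infty in Heq by lra. discriminate. }
      rewrite Hm1 in Heq. apply (f_equal real) in Heq. simpl in Heq.
      assert (Pm : 0 < m).
      { destruct Hm0 as [P|E]; auto. exfalso. apply Nf. subst m.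
        exact (sine_bounded_0_zero tau sigma f Htau Hsigma HD HT Hm). }
      assert (Hx0 : sin (tau * x0) = 0).
      { apply NNPP. intros N.
        assert (Q := proj2 (bound_off_sine_zeros tau sigma m x0 f Htau Hsigma HD HT Hm N) Pm). lra. }
      destruct (extremal_identity tau sigma m x0 f Htau Hsigma HD HT Hm HI Hx0 Heq) as [e [He Hid]].
      set (omega := sigma + tau) in *.
      assert (Hn : exists n : nat, (0 < n)%nat /\ sigma / tau = INR n).
      (* the next zero of [sin (tau u)] must be a zero of [sin (omega u)] *)
      { assert (E := Hid (PI / tau)).
        replace (tau * (PI / tau)) with PI in E by (field; lra).
        rewrite sin_PI, Rmult_0_r, Rmult_0_l in E. symmetry in E.
        apply Rmult_integral in E. destruct E as [E|E]; [lra|].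
        destruct (sin_eq_0_0 _ E) as [k Hk].
        assert (Ek : sigma / tau + 1 = IZR k).
        { apply Rmult_eq_reg_r with PI; [|lra]. rewrite <- Hk. unfold omega. field. lra. }
        assert (Kpos : (1 < k)%Z) by (apply lt_IZR; lra).
        exists (Z.to_nat (k - 1)). split; [lia|].
        rewrite INR_IZR_INZ, Z2Nat.id, minus_IZR by lia. lra. }
      split; auto. destruct Hn as [n [Hn0 Hn]].
      assert (Ho : omega = INR (S n) * tau).
      { rewrite S_INR, <- Hn. unfold omega. field. lra. }
      assert (Hox : sin (omega * x0) = 0) by (now apply (sin_multiple_zero tau omega x0 (S n))).
      assert (C1 := cos_sqr_of_sin_0 _ Hx0). assert (C2 := cos_sqr_of_sin_0 _ Hox).
      assert (E2 : e * e = 1) by (destruct He as [-> | ->]; ring).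
      (* the cosines are signs: they undo the translation by [x0] in both sines *)
      set (c := m * (e * cos (tau * x0) * cos (omega * x0))).
      assert (Hc : c <> 0).
      { unfold c. intros E. apply Rmult_integral in E. destruct E as [E|E]; [lra|].
        assert (E3 : (e * cos (tau * x0) * cos (omega * x0)) * (e * cos (tau * x0) * cos (omega * x0)) = 1).
        { transitivity ((e * e) * (cos (tau * x0) * cos (tau * x0)) * (cos (omega * x0) * cos (omega * x0))); [ring|].
          rewrite E2, C1, C2. ring. }
        rewrite E in E3. lra. }
      assert (Hprod : forall t, sin (tau * t) * Re (f (RtoC t)) = c * sin (omega * t)).
      { intros t. assert (E := Hid (t - x0)).
        replace (x0 + (t - x0)) with t in E by ring.
        assert (S1 := sin_shift_by_zero tau x0 (t - x0) Hx0).
        assert (S2 := sin_shift_by_zero omega x0 (t - x0) Hox).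
        replace (x0 + (t - x0)) with t in S1, S2 by ring. rewrite S1, S2. unfold c.
        transitivity (cos (tau * x0) * (e * e) * sin (tau * (t - x0)) * Re (f (RtoC t))); [rewrite E2; ring|].
        transitivity (cos (tau * x0) * e * (e * sin (tau * (t - x0)) * Re (f (RtoC t)))); [ring|].
        rewrite E.
        transitivity (m * (e * cos (tau * x0)) * (cos (omega * x0) * cos (omega * x0)) * sin (omega * (t - x0)));
          [rewrite C2; ring|ring]. }
      exists c. split; auto. intros x.
      rewrite (cont_ext_quotient tau omega c x (fun t => Re (f (RtoC t))) Htau Hc (Fc x) Hprod).
      rewrite (Fre x) at 1. f_equal. field. auto.
    + intros [[n [Hn0 Hn]] [c [Hc Hf]]].
      set (omega := sigma + tau) in *.
      assert (Po : 0 < omega) by (unfold omega; lra).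
      assert (Ho : omega = INR (S n) * tau).
      { rewrite S_INR, <- Hn. unfold omega. field. lra. }
      assert (Hprod : forall t, sin (tau * t) * Re (f (RtoC t)) = c * sin (omega * t)).
      { intros t. destruct (Req_dec (sin (tau * t)) 0) as [E|E].
        - rewrite E, (sin_multiple_zero tau omega t (S n) Htau Ho E). ring.
        - rewrite Hf, re_RtoC. unfold cont_ext. rewrite Lim_continuity.
          + simpl. field. auto.
          + apply derivable_continuous_pt, ex_derive_Reals_0. auto_derive. auto. }
      exists 0. split.
      { rewrite Rmult_0_r, cos_0. lra. }
      assert (Hsup : sup_norm (fun t : R => (RtoC (sin (tau * t)) * f (RtoC t))%C) = Finite (Rabs c)).
      { apply is_lub_Rbar_unique.
        assert (Hmod : forall t, Cmod (RtoC (sin (tau * t)) * f (RtoC t))%C = Rabs c * Rabs (sin (omega * t))).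
        { intros t. rewrite (Fre t), <- RtoC_mult, Cmod_R, Hprod. apply Rabs_mult. }
        split.
        - intros y [t ->]. rewrite Hmod. simpl.
          rewrite <- (Rmult_1_r (Rabs c)) at 2. apply Rmult_le_compat_l; [apply Rabs_pos|].
          apply Rabs_le, SIN_bound.
        - intros b Hb. apply Hb. exists (PI / 2 / omega). rewrite Hmod.
          replace (omega * (PI / 2 / omega)) with (PI / 2) by (field; lra).
          rewrite sin_PI2, Rabs_R1. ring. }
      rewrite Hsup. simpl. f_equal.
      assert (Sl := sine_product_slope tau omega c (fun t => Re (f (RtoC t))) Htau Po (Fc 0) Hprod).
      simpl in Sl. rewrite (Fre 0), Cmod_R.
      replace (Re (f 0)) with ((sigma / tau + 1) * c).
      * rewrite Rabs_mult, (Rabs_pos_eq (sigma / tau + 1)); lra.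
      * apply Rmult_eq_reg_l with tau; [|lra]. rewrite Sl. unfold omega. field. lra.
Qed.
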